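(* Let $\Bbbk$ be an algebraically closed field. For every Hopf algebra $H$ over $\Bbbk$ in either of the following classes, the map $f:\operatorname{Spc}\mathsf{stmod}(H)\to\operatorname{Spc}\mathsf{stmod}(D(H))$, $f(\mathbf{P})=\{X\in\mathsf{stmod}(D(H)):\overline{F}(X)\in\mathbf{P}\}$, is a homeomorphism, and the thick ideals of $\mathsf{stmod}(D(H))$ and of $\mathsf{stmod}(H)$ are in bijection: (1) finite-dimensional cosemisimple quasitriangular Hopf algebras (e.g. group algebras of finite groups $G$ in characteristic dividing the order of $G$); (2) Benson–Witherspoon smash coproducts $(\Bbbk[G]\#\Bbbk L)^*$, where $G$ and $L$ are finite groups, $L$ acts on $G$ by group automorphisms, $\Bbbk[G]$ is the dual group algebra of $G$, $\Bbbk L$ is the group algebra of $L$, and $\Bbbk$ has characteristic $p$ dividing the order of $G$ and not dividing the order of $L$.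
   Context: For a finite-dimensional Hopf algebra $H$, $\mathsf{stmod}(H)$ is the stable category of finite-dimensional $H$-modules: objects are finite-dimensional modules, morphisms are module maps modulo those factoring through a projective module; it is triangulated with $\Sigma=\Omega^{-1}$ and monoidal under $\otimes_\Bbbk$. $D(H)$ is the Drinfeld double of $H$; it contains $H$ as a Hopf subalgebra, and restriction of modules from $D(H)$ to $H$ is exact and preserves projectives, so it induces a monoidal triangulated functor $\overline{F}:\mathsf{stmod}(D(H))\to\mathsf{stmod}(H)$. $H$ is cosemisimple if $H^*$ is a semisimple algebra. $(\Bbbk[G]\#\Bbbk L)^*$ is the Hopf dual of the smash product; explicitly, as an algebra it is $\Bbbk G\otimes\Bbbk[L]$ and, with $\{p_x\}_{x\in L}$ the basis of $\Bbbk[L]$ dual to $L$, $\Delta(g\otimes p_x)=\sum_{y\in L}(g\otimes p_y)\otimes(y^{-1}.g\otimes p_{y^{-1}x})$, $\epsilon(g\otimes p_x)=\delta_{x,1}$, $S(g\otimes p_x)=x^{-1}.(g^{-1})\otimes p_{x^{-1}}$. A thick ideal of a monoidal triangulated category $\mathbf{T}$ is a full triangulated subcategory closed under direct summands and under tensoring on both sides with arbitrary objects. A prime ideal is a proper thick ideal $\mathbf{P}$ such that $\mathbf{I}\otimes\mathbf{J}\subseteq\mathbf{P}$ implies $\mathbf{I}\subseteq\mathbf{P}$ or $\mathbf{J}\subseteq\mathbf{P}$ for all thick ideals $\mathbf{I},\mathbf{J}$. The Balmer spectrum $\operatorname{Spc}\mathbf{T}$ is the set of prime ideals, with closed sets $\{\mathbf{P}:\mathcal{T}\cap\mathbf{P}=\varnothing\}$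 for collections $\mathcal{T}$ of objects. *)

(* Defs.v *)
From HB Require Import structures.
From mathcomp Require Import all_boot all_order all_algebra all_fingroup.
From mathcomp Require Import mxtens.
From mathcomp Require Import boolp classical_sets functions topology.

Set Implicit Arguments.
Unset Strict Implicit.
Unset Printing Implicit Defensive.

Import GRing.Theory.
Local Open Scope ring_scope.

(* Finite-dimensional algebras and Hopf algebras over K are presented by      *)
(* their structure constants in a basis (e_i) indexed by a finite type I:     *)
(*   e_i e_j   = \sum_k  amul i j k e_k       1    = \sum_i aone i e_i        *)
(*   Delta e_i = \sum_jk comul i j k e_j (x) e_k     eps(e_i) = counit i      *)
(*   S(e_i)    = \sum_j  antipode i j e_j                                     *)
(* The records below hold the constants only; the axioms are the predicates   *)
(* is_algebra and is_hopf. An element is given by its coordinates, as an      *)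
(* {ffun I -> K}; the tensor product of the spaces with bases I and J has     *)
(* basis I * J.                                                               *)

Record algebra (K : fieldType) (I : finType) := Algebra {
  amul : I -> I -> I -> K;
  aone : I -> K
}.

Section Algebras.
Variable K : fieldType.

Definition elt_mul (I : finType) (A : algebra K I) (x y : {ffun I -> K}) :
    {ffun I -> K} :=
  [ffun k => \sum_i \sum_j x i * y j * amul A i j k].

Definition elt_one (I : finType) (A : algebra K I) : {ffun I -> K} :=
  [ffun i => aone A i].

Definition basis (I : finType) (i : I) : {ffun I -> K} :=
  [ffun j => (i == j)%:R].

Record is_algebra (I : finType) (A : algebra K I) : Prop := IsAlgebra {
  elt_mulA : forall x y z,
    elt_mul A x (elt_mul A y z) = elt_mul A (elt_mul A x y) z;
  elt_mul1l : forall x, elt_mul A (elt_one A) x = x;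
  elt_mul1r : forall x, elt_mul A x (elt_one A) = x
}.

Definition tens_algebra (I J : finType) (A : algebra K I) (B : algebra K J) :
    algebra K (I * J)%type :=
  Algebra (fun u v w => amul A u.1 v.1 w.1 * amul B u.2 v.2 w.2)
          (fun u => aone A u.1 * aone B u.2).

End Algebras.

Record hopf (K : fieldType) (I : finType) := Hopf {
  hopf_algebra :> algebra K I;
  comul : I -> I -> I -> K;
  counit : I -> K;
  antipode : I -> I -> K
}.

Section Hopf.
Variables (K : fieldType) (I : finType).
Implicit Type H : hopf K I.

Definition elt_comul H (x : {ffun I -> K}) : {ffun I * I -> K} :=
  [ffun u => \sum_i x i * comul H i u.1 u.2].

Definition elt_counit H (x : {ffun I -> K}) : K := \sum_i x i * counit H i.

Definition elt_antipode H (x : {ffun I -> K}) : {ffun I -> K} :=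
  [ffun j => \sum_i x i * antipode H i j].

Definition is_coalgebra H : Prop :=
  [/\ forall i a b c, \sum_j comul H i j c * comul H j a b =
                      \sum_j comul H i a j * comul H j b c,
      forall i k, \sum_j counit H j * comul H i j k = (i == k)%:R
    & forall i j, \sum_k comul H i j k * counit H k = (i == j)%:R].

Definition is_bialgebra H : Prop :=
  [/\ is_algebra H, is_coalgebra H,
      (forall x y, elt_comul H (elt_mul H x y) =
         elt_mul (tens_algebra H H) (elt_comul H x) (elt_comul H y)) /\
      elt_comul H (elt_one H) = elt_one (tens_algebra H H)
    & (forall x y, elt_counit H (elt_mul H x y) =
         elt_counit H x * elt_counit H y) /\
      elt_counit H (elt_one H) = 1].

Record is_hopf H : Prop := IsHopf {
  hopf_bialgebra : is_bialgebra H;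
  antipode_l : forall i,
    \sum_j \sum_k comul H i j k *:
      (elt_mul H (elt_antipode H (basis K j)) (basis K k) : {ffun I -> K^o})
    = counit H i *: (elt_one H : {ffun I -> K^o});
  antipode_r : forall i,
    \sum_j \sum_k comul H i j k *:
      (elt_mul H (basis K j) (elt_antipode H (basis K k)) : {ffun I -> K^o})
    = counit H i *: (elt_one H : {ffun I -> K^o})
}.

(* H^* with the convolution product, in the dual basis. *)
Definition dual_algebra H : algebra K I :=
  Algebra (fun j k i => comul H i j k) (fun i => counit H i).

(* R = \sum_ij R (i, j) e_i (x) e_j is a universal R-matrix. Elements of the  *)
(* triple tensor power have coordinates indexed by (I * I) * I.               *)
Definition is_Rmatrix H (R : {ffun I * I -> K}) : Prop :=
  let H2 := tens_algebra H H in
  let H3 := tens_algebra H2 H in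
  let R12 : {ffun I * I * I -> K} :=
    [ffun u => R (u.1.1, u.1.2) * aone H u.2] in
  let R13 : {ffun I * I * I -> K} :=
    [ffun u => R (u.1.1, u.2) * aone H u.1.2] in
  let R23 : {ffun I * I * I -> K} :=
    [ffun u => R (u.1.2, u.2) * aone H u.1.1] in
  [/\ exists R' : {ffun I * I -> K},
        elt_mul H2 R R' = elt_one H2 /\ elt_mul H2 R' R = elt_one H2,
      forall x : {ffun I -> K},
        elt_mul H2 [ffun u => elt_comul H x (u.2, u.1)] R =
        elt_mul H2 R (elt_comul H x),
      [ffun u => \sum_i R (i, u.2) * comul H i u.1.1 u.1.2] = elt_mul H3 R13 R23
    & [ffun u => \sum_j R (u.1.1, j) * comul H j u.1.2 u.2] =
      elt_mul H3 R13 R12].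

Definition quasitriangular H : Prop := exists R, is_Rmatrix H R.

(* Coefficients of the inverse of the (bijective) antipode of a               *)
(* finite-dimensional Hopf algebra.                                           *)
Definition antipodeV H (i j : I) : K :=
  invmx (\matrix_(a < #|I|, b < #|I|) antipode H (enum_val a) (enum_val b))
    (enum_rank i) (enum_rank j).

Definition amul3 H (i j k l : I) : K :=
  \sum_t amul H i j t * amul H t k l.

Definition comul3 H (i j k l : I) : K :=
  \sum_t comul H i j t * comul H t k l.

(* The Drinfeld double D(H) = (H^* )^cop (x) H, with basis e^a (x) e_h indexed *)
(* by (a, h), (e^a) being the dual basis. The product is                      *)
(*   (f (x) h)(f' (x) h') = f * f'(S^-1(h_3) ? h_1) (x) h_2 h',               *)
(* the unit eps (x) 1, the coproduct (f_2 (x) h_1) (x) (f_1 (x) h_2) where    *)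
(* f(xy) = f_1(x) f_2(y), the counit f (x) h |-> f(1) eps(h), and             *)
(*   S(f (x) h) = (eps (x) S(h)) (f o S^-1 (x) 1).                            *)
Definition double_algebra H : algebra K (I * I)%type :=
  Algebra
    (fun u v w => \sum_x comul H w.1 u.1 x *
       \sum_p \sum_q \sum_r comul3 H u.2 p q r *
         (\sum_s antipodeV H r s * amul3 H s x p v.1) * amul H q v.2 w.2)
    (fun u => counit H u.1 * aone H u.2).

Definition double H : hopf K (I * I)%type :=
  Hopf (double_algebra H)
    (fun u v w => amul H w.1 v.1 u.1 * comul H u.2 v.2 w.2)
    (fun u => aone H u.1 * counit H u.2)
    (fun u w => elt_mul (double_algebra H)
       [ffun v => counit H v.1 * antipode H u.2 v.2]
       [ffun v => antipodeV H v.1 u.1 * aone H v.2] w).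

End Hopf.

(* The Hopf dual of k[G] # kL, with basis g (x) p_x indexed by (g, x). The    *)
(* MathComp action `to` is a right action by group automorphisms;             *)
(* x.g := to g x^-1 is the corresponding left action.                         *)
Section SmashCoproduct.
Variables (K : fieldType) (gT lT : finGroupType).
Variable to : groupAction [set: lT] [set: gT].

Definition lact (x : lT) (g : gT) : gT := to g (x^-1)%g.

Definition smash_coproduct : hopf K (gT * lT)%type :=
  Hopf
    (Algebra
      (fun u v w => ((u.2 == v.2) && (w == ((u.1 * v.1)%g, u.2)))%:R)
      (fun u => (u.1 == 1%g)%:R))
    (fun u v w => \sum_(y : lT)
       ((v == (u.1, y)) && (w == (lact y^-1 u.1, (y^-1 * u.2)%g)))%:R)
    (fun u => (u.2 == 1%g)%:R)
    (fun u v => (v == (lact u.2^-1 (u.1^-1)%g, (u.2^-1)%g))%:R).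

End SmashCoproduct.

(* A finite-dimensional left module on K^d (column vectors) is given by the   *)
(* matrices of the basis elements; a linear map M -> N is a matrix in         *)
(* 'M_(rdim N, rdim M) acting by f *m v.                                      *)
Record rep (K : fieldType) (I : finType) := Rep {
  rdim : nat;
  ract : I -> 'M[K]_rdim
}.

Section Modules.
Variables (K : fieldType) (I : finType) (A : algebra K I).
Implicit Types M N P : rep K I.

Definition is_module M : Prop :=
  (forall i j, ract M i *m ract M j = \sum_k amul A i j k *: ract M k) /\
  \sum_i aone A i *: ract M i = 1%:M.

Definition is_hom M N (f : 'M[K]_(rdim N, rdim M)) : Prop :=
  forall i, f *m ract M i = ract N i *m f.

Definition mx_inj m n (f : 'M[K]_(m, n)) : Prop :=
  injective (fun v : 'cV[K]_n => f *m v).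

Definition mx_surj m n (f : 'M[K]_(m, n)) : Prop :=
  forall w : 'cV[K]_m, exists v : 'cV[K]_n, f *m v = w.

Definition rep0 : rep K I := @Rep K I 0 (fun _ => 0).

Definition dsum M N : rep K I :=
  Rep (fun i => block_mx (ract M i) 0 0 (ract N i)).

(* Submodules of finite-dimensional modules are direct summands. *)
Definition semisimple : Prop :=
  forall M N (f : 'M[K]_(rdim N, rdim M)),
    is_module M -> is_module N -> is_hom f -> mx_inj f ->
    exists2 r : 'M[K]_(rdim M, rdim N), is_hom r & r *m f = 1%:M.

Definition projective P : Prop :=
  is_module P /\
  forall M N (g : 'M[K]_(rdim N, rdim M)) (f : 'M[K]_(rdim N, rdim P)),
    is_module M -> is_module N -> is_hom g -> is_hom f -> mx_surj g ->
    exists2 h : 'M[K]_(rdim M, rdim P), is_hom h & g *m h = f.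

Definition short_exact M N P (f : 'M[K]_(rdim N, rdim M))
    (g : 'M[K]_(rdim P, rdim N)) : Prop :=
  [/\ is_hom f /\ is_hom g, mx_inj f, mx_surj g
    & forall v : 'cV[K]_(rdim N),
        g *m v = 0 <-> exists u : 'cV[K]_(rdim M), v = f *m u].

(* Equality of morphisms in stmod(A). *)
Definition stable_eq M N (f g : 'M[K]_(rdim N, rdim M)) : Prop :=
  exists P (a : 'M[K]_(rdim P, rdim M)) (b : 'M[K]_(rdim N, rdim P)),
    [/\ projective P, is_hom a, is_hom b & f - g = b *m a].

Definition stable_iso M N : Prop :=
  exists (f : 'M[K]_(rdim N, rdim M)) (g : 'M[K]_(rdim M, rdim N)),
    [/\ is_hom f, is_hom g, stable_eq (g *m f) 1%:M & stable_eq (f *m g) 1%:M].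

(* 0 -> M -i-> Q -q-> S -> 0 with Q projective: S is a model of Sigma M, the  *)
(* cosyzygy of M. Over a finite-dimensional Hopf algebra, projective and      *)
(* injective modules coincide.                                                *)
Definition suspension M Q S (i : 'M[K]_(rdim Q, rdim M))
    (q : 'M[K]_(rdim S, rdim Q)) : Prop :=
  [/\ is_module M, projective Q, is_module S & short_exact i q].

(* The standard triangle M -f-> N -g-> C -h-> S on a module map f: C is the   *)
(* pushout of f along i : M -> Q, i.e. the cokernel of (i, f) : M -> Q (+) N, *)
(* and h is induced by q : Q -> S and 0 : N -> S. The distinguished triangles *)
(* of stmod(A) are those isomorphic in stmod(A) to a standard one.            *)
Definition standard_triangle M N C S (f : 'M[K]_(rdim N, rdim M))
    (g : 'M[K]_(rdim C, rdim N)) (h : 'M[K]_(rdim S, rdim C)) : Prop :=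
  exists Q (i : 'M[K]_(rdim Q, rdim M)) (q : 'M[K]_(rdim S, rdim Q))
         (j : 'M[K]_(rdim C, rdim Q)),
    [/\ suspension i q, is_module N /\ is_module C, is_hom h,
        @short_exact M (dsum Q N) C (col_mx i f) (row_mx j (- g))
      & h *m j = q /\ h *m g = 0].

End Modules.

Definition cosemisimple (K : fieldType) (I : finType) (H : hopf K I) : Prop :=
  semisimple (dual_algebra H).

Section TensorTriangular.
Variables (K : fieldType) (I : finType) (H : hopf K I).
Implicit Types (M N X Y : rep K I) (P : set (rep K I)).

(* H acts on M (x) N through Delta; *t is the Kronecker product. *)
Definition tens M N : rep K I :=
  Rep (fun i => \sum_j \sum_k comul H i j k *: (ract M j *t ract N k)).

(* Full triangulated subcategories of stmod(H), given by their objects. For a *)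
(* class closed under isomorphisms in stmod(H), closure under cones need only *)
(* be required of the standard triangles.                                     *)
Record triangulated_subcat P : Prop := TriangulatedSubcat {
  tri_module : forall M, P M -> is_module H M;
  tri_iso : forall M N, is_module H N -> stable_iso H M N -> P M -> P N;
  tri_zero : P (rep0 K I);
  tri_dsum : forall M N, P M -> P N -> P (dsum M N);
  tri_shift : forall M Q S (i : 'M[K]_(rdim Q, rdim M))
    (q : 'M[K]_(rdim S, rdim Q)), suspension H i q -> P M <-> P S;
  tri_cone : forall M N C S (f : 'M[K]_(rdim N, rdim M))
    (g : 'M[K]_(rdim C, rdim N)) (h : 'M[K]_(rdim S, rdim C)),
    standard_triangle H f g h -> P M -> P N -> P C
}.

Record thick_ideal P : Prop := ThickIdeal {
  thick_tri : triangulated_subcat P;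
  thick_summand : forall M N, is_module H M -> is_module H N ->
    P (dsum M N) -> P M /\ P N;
  thick_tens : forall M X, P M -> is_module H X ->
    P (tens M X) /\ P (tens X M)
}.

Record prime_ideal P : Prop := PrimeIdeal {
  prime_thick : thick_ideal P;
  prime_proper : exists2 M, is_module H M & ~ P M;
  prime_tens : forall J L : set (rep K I), thick_ideal J -> thick_ideal L ->
    (forall M N, J M -> L N -> P (tens M N)) ->
    (J `<=` P)%classic \/ (L `<=` P)%classic
}.

Record thick_ideals := MkThick {
  thick_set :> set (rep K I);
  thick_setP : thick_ideal thick_set
}.

Record Spc := MkSpc {
  prime_set :> set (rep K I);
  prime_setP : prime_ideal prime_set
}.

Definition Spc_V (T : set (rep K I)) : set Spc :=
  [set P | forall X, T X -> ~ prime_set P X]%classic.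

Definition Spc_open (U : set Spc) : Prop :=
  exists T : set (rep K I), U = (~` Spc_V T)%classic.

Lemma Spc_openP (U : set Spc) : Spc_open U <->
  exists T : set (rep K I),
    forall P : Spc, U P <-> exists2 X, T X & prime_set P X.
Proof.
split=> -[T UT]; exists T.
  move=> P; rewrite UT; split=> [/existsNP[X]|[X TX PX] /(_ X TX)//].
  by move=> /not_implyP[TX /contrapT PX]; exists X.
apply/seteqP; split=> P.
  by move=> /UT[X TX PX] /(_ X TX).
move=> /existsNP[X] /not_implyP[TX /contrapT PX].
by apply/UT; exists X.
Qed.

Lemma Spc_openT : Spc_open setT.
Proof.
apply/Spc_openP; exists setT => P; split=> // _.
by exists (rep0 K I) => //; case: (prime_thick (prime_setP P)) => -[].
Qed.

Lemma Spc_openI : setI_closed Spc_open.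
Proof.
move=> U V /Spc_openP[S US] /Spc_openP[T VT]; apply/Spc_openP.
exists [set Z | exists X Y, [/\ S X, T Y, is_module H X, is_module H Y
                             & Z = dsum X Y]]%classic => P.
have [[tmod _ _ tD _ _] tsum _] := prime_thick (prime_setP P).
split=> [[/US[X SX PX] /VT[Y TY PY]]|[Z [X [Y [SX TY mX mY ->]]] PZ]].
  exists (dsum X Y); last exact: tD.
  by exists X, Y; split=> //; apply: tmod.
by have [PX PY] := tsum _ _ mX mY PZ; split; [apply/US; exists X|apply/VT; exists Y].
Qed.

Lemma Spc_openU (J : Type) (F : J -> set Spc) :
  (forall j, Spc_open (F j)) -> Spc_open (\bigcup_j F j).
Proof.
move=> oF; apply/Spc_openP.
exists [set X | forall P : Spc, prime_set P X -> (\bigcup_j F j)%classic P]%classic.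
move=> P; split=> [[j _ FjP]|[X FX PX]]; last exact: FX.
have /Spc_openP[T FT] := oF j; have [X TX PX] := (FT P).1 FjP.
by exists X => // P' P'X; exists j => //; apply/FT; exists X.
Qed.

HB.instance Definition _ := gen_eqMixin Spc.
HB.instance Definition _ := gen_choiceMixin Spc.
HB.instance Definition _ :=
  isOpenTopological.Build Spc Spc_openT Spc_openI Spc_openU.

Lemma Spc_closedP (C : set Spc) :
  closed C <-> exists T : set (rep K I), C = Spc_V T.
Proof.
rewrite -openC; split=> [[T CT]|[T ->]]; exists T => //.
by rewrite -[C]setCK CT setCK.
Qed.

End TensorTriangular.

Definition homeomorphism (S T : topologicalType) (f : S -> T) : Prop :=
  continuous f /\
  exists g : T -> S, [/\ cancel f g, cancel g f & continuous g].

Section Restriction.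
Variables (K : fieldType) (I : finType) (H : hopf K I).

(* Restriction along H -> D(H), h |-> eps (x) h. *)
Definition res (X : rep K (I * I)%type) : rep K I :=
  Rep (fun i => \sum_a counit H a *: ract X (a, i)).

(* P |-> {X | res X \in P} is a well-defined homeomorphism                    *)
(* Spc stmod(H) -> Spc stmod(D(H)).                                           *)
Definition res_homeomorphism : Prop :=
  exists f : Spc H -> Spc (double H),
    (forall (P : Spc H) (X : rep K (I * I)%type),
       prime_set (f P) X <-> is_module (double H) X /\ prime_set P (res X)) /\
    homeomorphism f.

Definition thick_ideals_bijection : Prop :=
  exists phi : thick_ideals (double H) -> thick_ideals H, bijective phi.

End Restriction.

(* Main.v *)
(* Let k be the unit object of stmod(H), Res the restriction from D(H) to H    *)
(* and Ind its left adjoint. Everything follows from two properties of H:      *)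
(*  (a) the unit object of D(H) is a direct summand of Ind k;                  *)
(*  (b) every H-module M generates the same thick ideal as some Res X.         *)
(* Objects Res X carry a half-braiding N (x) Res X = Res X (x) N, and          *)
(* Ind (Res X (x) N) = X (x) Ind N. Hence, by (a), a thick ideal J of D(H) is  *)
(* the preimage under Res of the thick ideal                                   *)
(*   {M | Ind (N (x) M (x) N') in J for all N, N'},                            *)
(* and by (b) taking preimages under Res is injective. The resulting bijection *)
(* of thick ideals respects primes, and by (b) it is a homeomorphism.          *)
(*  (a) holds as soon as some lam in H^* is a two-sided integral with          *)
(* lam(1) = 1 and lam(S^-1(h_2) x h_1) = eps(h) lam(x). If H is cosemisimple,  *)
(* complete reducibility of H as an H^*-module gives a two-sided integral, and *)
(* it has lam(xy) = lam(S^-2(y_1) x) alpha(y_2) for an algebra map alpha. An   *)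
(* R-matrix R satisfies (lam (x) lam)(R) <> 0, which forces alpha = eps; it    *)
(* also turns every H-module into a D(H)-module, whence (b). For the smash     *)
(* coproduct, lam(g (x) p_x) = [g = 1] / |L| is a trace, and for (b) one       *)
(* takes k[L] (x) M with L permuting the first factor.                         *)

Require Import Defs.
From mathcomp Require Import all_boot all_order all_algebra all_fingroup.
From HB Require Import structures.
From mathcomp Require Import mxtens ring boolp classical_sets topology.
(* Again: the libraries shadow [ract] and [basis]. *)
Import Defs.

Set Implicit Arguments.
Unset Strict Implicit.
Unset Printing Implicit Defensive.
Set SsrOldRewriteGoalsOrder.

Import GRing.Theory.
Local Open Scope ring_scope.

(** * Sweedler calculus *)

(** Thick ideals cannot tell the double from H, once properties (a) and (b) above hold; they are the
    hypotheses [unit_retract] and [detect] of [spectrum_transfer]. The half-braiding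
    ([half_braiding]) and the projection formula ([ind_tens_iso]) give Ind (N (x) Res X (x) N') = X
    (x) Ind (N (x) N'). Hence an object X of J puts all these objects in J; conversely, if X (x) Ind
    k lies in J, so does its retract X, by (a). This is [pull_pushforward]. By (b) a thick ideal of
    H is known from the objects Res X in it, which gives [push_pullback]. For primes one must pass
    from a product Res X (x) Res Y to products with an arbitrary object in the middle, and again the
    half-braiding does it ([pullback_prime], [pushforward_prime]).

    That preimages of thick subcategories are thick is proved once ([preimage_thick_subcat]) for
    functors that act on all linear maps and preserve projectives. Preservation of projectives by
    tensor products and by Res rests on [twist]: the modules X (x) M, M (x) X and Res Ind M are
    twists of M, up to isomorphism, and a section of the action map H (x) M -> M transports to a
    twist ([twist_proj_basis]).

    For (a), [unit_retract_ind] needs an integral lam that is invariant under the adjoint action. In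
    the cosemisimple quasitriangular case the integral comes from [cosemisimple_integral], its
    Nakayama automorphism from [nakayama], and [integral_rmx_neq0] with [modular_rmx] removes the
    modular character, giving [cosemisimple_rmx_integral]; (b) is [rmx_drep]. For smash coproducts
    lam is explicit ([smash_unit_retract]) and (b) is [smash_detect].

    Identities in tensor powers of H are tested on multilinear maps into arbitrary vector spaces.
    With matrix spaces as targets, the same calculus covers actions on modules. *)

Section LinearCombinations.
Variable K : fieldType.
Implicit Types A B C D : finType.

(* [l1 (amul H i j) F] is the linear extension of F at e_i e_j, and            *)
(* [l2 (comul H i) F] is the bilinear extension of F at Delta e_i, so that     *)
(* [l2 (comul H i) (fun a b => F a b)] reads F(h_1, h_2) for h = e_i. An       *)
(* identity between elements of H (x) ... (x) H is stated as the equality of   *)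
(* the values of all multilinear F.                                            *)
Definition l1 A (V : lmodType K) (c : A -> K) (F : A -> V) : V :=
  \sum_a c a *: F a.

Definition l2 A B (V : lmodType K) (c : A -> B -> K) (F : A -> B -> V) : V :=
  \sum_a \sum_b c a b *: F a b.

Lemma eq_l1 A (V : lmodType K) (c : A -> K) (F G : A -> V) :
  (forall a, F a = G a) -> l1 c F = l1 c G.
Proof. by move=> FG; apply: eq_bigr => a _; rewrite FG. Qed.

Lemma eq_l2 A B (V : lmodType K) (c : A -> B -> K) (F G : A -> B -> V) :
  (forall a b, F a b = G a b) -> l2 c F = l2 c G.
Proof.
by move=> FG; apply: eq_bigr => a _; apply: eq_bigr => b _; rewrite FG.
Qed.

Lemma l1_map A (V W : lmodType K) (h : {linear V -> W}) (c : A -> K) F :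
  h (l1 c F) = l1 c (fun a => h (F a)).
Proof. by rewrite /l1 linear_sum; apply: eq_bigr => a _; rewrite linearZ. Qed.

Lemma l2_map A B (V W : lmodType K) (h : {linear V -> W}) (c : A -> B -> K) F :
  h (l2 c F) = l2 c (fun a b => h (F a b)).
Proof.
rewrite /l2 linear_sum; apply: eq_bigr => a _; rewrite linear_sum.
by apply: eq_bigr => b _; rewrite linearZ.
Qed.

Lemma l1Z A (V : lmodType K) (k : K) (c : A -> K) (F : A -> V) :
  k *: l1 c F = l1 c (fun a => k *: F a).
Proof. exact: (l1_map ( *:%R k)). Qed.

Lemma l2Z A B (V : lmodType K) (k : K) (c : A -> B -> K) (F : A -> B -> V) :
  k *: l2 c F = l2 c (fun a b => k *: F a b).
Proof. exact: (l2_map ( *:%R k)). Qed.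

Lemma l1_scal A (V : lmodType K) (c d : A -> K) (v : V) :
  l1 c (d : A -> K^o) *: v = l1 c (fun a => d a *: v).
Proof. by rewrite /l1 scaler_suml; apply: eq_bigr => a _; rewrite scalerA. Qed.

Lemma l2_scal A B (V : lmodType K) (c d : A -> B -> K) (v : V) :
  l2 c (d : A -> B -> K^o) *: v = l2 c (fun a b => d a b *: v).
Proof.
rewrite /l2 scaler_suml; apply: eq_bigr => a _; rewrite scaler_suml.
by apply: eq_bigr => b _; rewrite scalerA.
Qed.

Lemma l11C A B (V : lmodType K) c d (F : A -> B -> V) :
  l1 c (fun a => l1 d (fun b => F a b)) = l1 d (fun b => l1 c (fun a => F a b)).
Proof.
rewrite /l1; under eq_bigr do rewrite scaler_sumr.
rewrite exchange_big; apply: eq_bigr => b _; rewrite scaler_sumr.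
by apply: eq_bigr => a _; rewrite !scalerA mulrC.
Qed.

Lemma l2E A B (V : lmodType K) (c : A -> B -> K) (F : A -> B -> V) :
  l2 c F = l1 (fun u : A * B => c u.1 u.2) (fun u => F u.1 u.2).
Proof. by rewrite /l1 /l2 pair_big. Qed.

Lemma l12C A B C (V : lmodType K) c d (F : A -> B -> C -> V) :
  l1 c (fun a => l2 d (fun b b' => F a b b')) =
  l2 d (fun b b' => l1 c (fun a => F a b b')).
Proof.
rewrite l2E -l11C; apply: eq_l1 => a; exact: l2E.
Qed.

Lemma l21C A B C (V : lmodType K) c d (F : A -> B -> C -> V) :
  l2 c (fun a a' => l1 d (fun b => F a a' b)) =
  l1 d (fun b => l2 c (fun a a' => F a a' b)).
Proof. by rewrite l12C. Qed.

Lemma l22C A B C D (V : lmodType K) c d (F : A -> B -> C -> D -> V) :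
  l2 c (fun a a' => l2 d (fun b b' => F a a' b b')) =
  l2 d (fun b b' => l2 c (fun a a' => F a a' b b')).
Proof. by rewrite l2E l12C; apply: eq_l2 => b b'; rewrite l2E. Qed.

Lemma l1_delta A (V : lmodType K) (a : A) (F : A -> V) :
  l1 (fun b => (a == b)%:R) F = F a.
Proof.
rewrite /l1 (bigD1 a) //= eqxx scale1r big1 ?addr0 // => b /negbTE ba.
by rewrite eq_sym ba scale0r.
Qed.

Lemma l1_deltar A (c : A -> K) (a : A) : l1 c (fun b => (b == a)%:R : K^o) = c a.
Proof.
rewrite /l1 (bigD1 a) //= eqxx big1 ?addr0 => [|b /negbTE ->].
  by rewrite /GRing.scale /= mulr1.
by rewrite scaler0.
Qed.

Lemma l1_mulmxl A m n p (c : A -> K) (F : A -> 'M[K]_(m, n)) (X : 'M[K]_(n, p)) :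
  l1 c F *m X = l1 c (fun a => F a *m X).
Proof. exact: (l1_map (mulmxr X)). Qed.

Lemma l1_mulmxr A m n p (c : A -> K) (F : A -> 'M[K]_(n, p)) (X : 'M[K]_(m, n)) :
  X *m l1 c F = l1 c (fun a => X *m F a).
Proof. exact: (l1_map (mulmx X)). Qed.

Lemma l2_mulmxl A B m n p c (F : A -> B -> 'M[K]_(m, n)) (X : 'M[K]_(n, p)) :
  l2 c F *m X = l2 c (fun a b => F a b *m X).
Proof. exact: (l2_map (mulmxr X)). Qed.

Lemma l2_mulmxr A B m n p c (F : A -> B -> 'M[K]_(n, p)) (X : 'M[K]_(m, n)) :
  X *m l2 c F = l2 c (fun a b => X *m F a b).
Proof. exact: (l2_map (mulmx X)). Qed.

(** The arguments are swapped so that multiplication by a fixed right factor is a named map, which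
    can carry a linear structure. *)
Definition rtensmx m n p q (X : 'M[K]_(p, q)) (Y : 'M[K]_(m, n)) := Y *t X.

Fact rtensmx_linear m n p q (X : 'M[K]_(p, q)) : linear (@rtensmx m n p q X).
Proof. by move=> k A B; apply/matrixP=> i j; rewrite !mxE mulrDl mulrA. Qed.

Fact tensmx_linear m n p q (X : 'M[K]_(p, q)) :
  linear (@tensmx _ p q m n X).
Proof. by move=> k A B; apply/matrixP=> i j; rewrite !mxE mulrDr mulrCA. Qed.

HB.instance Definition _ m n p q (X : 'M[K]_(p, q)) :=
  GRing.isLinear.Build K _ _ _ (@rtensmx m n p q X) (@rtensmx_linear m n p q X).
HB.instance Definition _ m n p q (X : 'M[K]_(p, q)) :=
  GRing.isLinear.Build K _ _ _ (@tensmx K p q m n X) (@tensmx_linear m n p q X).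

Lemma l1_tensl A m n p q (c : A -> K) (F : A -> 'M[K]_(m, n)) (X : 'M[K]_(p, q)) :
  l1 c F *t X = l1 c (fun a => F a *t X).
Proof. exact: (l1_map (rtensmx X)). Qed.

Lemma l1_tensr A m n p q (c : A -> K) (F : A -> 'M[K]_(m, n)) (X : 'M[K]_(p, q)) :
  X *t l1 c F = l1 c (fun a => X *t F a).
Proof. exact: (l1_map (tensmx X)). Qed.

Lemma l2_tensl A B m n p q c (F : A -> B -> 'M[K]_(m, n)) (X : 'M[K]_(p, q)) :
  l2 c F *t X = l2 c (fun a b => F a b *t X).
Proof. exact: (l2_map (rtensmx X)). Qed.

Lemma l2_tensr A B m n p q c (F : A -> B -> 'M[K]_(m, n)) (X : 'M[K]_(p, q)) :
  X *t l2 c F = l2 c (fun a b => X *t F a b).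
Proof. exact: (l2_map (tensmx X)). Qed.

Lemma tensmxZl m n p q k (Y : 'M[K]_(m, n)) (X : 'M[K]_(p, q)) :
  (k *: Y) *t X = k *: (Y *t X).
Proof. exact: (linearZ_LR (rtensmx X)). Qed.

Lemma tensmxZr m n p q k (Y : 'M[K]_(m, n)) (X : 'M[K]_(p, q)) :
  X *t (k *: Y) = k *: (X *t Y).
Proof. exact: (linearZ_LR (tensmx X)). Qed.

Lemma tensmx11 m n : 1%:M *t 1%:M = 1%:M :> 'M[K]_(m * n).
Proof.
apply/matrixP => i j; case: (mxtens_indexP i) => i0 i1.
case: (mxtens_indexP j) => j0 j1; rewrite tensmxE !mxE -natrM mulnb.
by rewrite (can_eq (@mxtens_indexK _ _)) xpair_eqE.
Qed.

Lemma l2_deltar A B (c : A -> B -> K) (a : A) (b : B) :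
  l2 c (fun p q => (p == a)%:R * (q == b)%:R : K^o) = c a b.
Proof.
rewrite -(l1_deltar (c a) b) -(l1_deltar (fun p => l1 (c p) (fun q => (q == b)%:R : K^o)) a).
apply: eq_bigr => p _; rewrite /GRing.scale /= mulr_suml; apply: eq_bigr => q _.
by rewrite /GRing.scale /= -mulrA [X in _ * X]mulrC.
Qed.

End LinearCombinations.

Section CoefficientLaws.
Variables (K : fieldType) (I : finType).

(** Associativity of the product of a row, a matrix and a column. The type [K^o] is the field as a
    module over itself, so that [l1] can also produce coefficients. *)
Lemma l1_comp (A B : finType) (V : lmodType K) (x : A -> K) (c : A -> B -> K)
    (F : B -> V) :
  l1 (fun k => l1 x (fun i => c i k : K^o)) F = l1 x (fun i => l1 (c i) F).
Proof.
rewrite {1}/l1; under eq_bigr do rewrite /l1 scaler_suml.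
rewrite exchange_big; apply: eq_bigr => a _; rewrite scaler_sumr.
by apply: eq_bigr => b _; rewrite scalerA.
Qed.

Lemma l2_comp (A A' B : finType) (V : lmodType K) (x : A -> A' -> K)
    (c : A -> A' -> B -> K) (F : B -> V) :
  l1 (fun k => l2 x (fun i j => c i j k : K^o)) F =
  l2 x (fun i j => l1 (c i j) F).
Proof.
by rewrite l2E -l1_comp; apply: eq_bigr => k _; rewrite l2E.
Qed.

Lemma l1_basis (V : lmodType K) (i : I) (F : I -> V) : l1 (basis K i) F = F i.
Proof. by rewrite -[RHS](l1_delta i); apply: eq_bigr => k _; rewrite ffunE. Qed.

Lemma elt_mulE (A : algebra K I) x y k :
  elt_mul A x y k = l1 x (fun i => l1 y (fun j => amul A i j k : K^o)).
Proof.
rewrite ffunE; apply: eq_bigr => i _; rewrite scaler_sumr.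
by apply: eq_bigr => j _; rewrite scalerA.
Qed.

Lemma l1_elt_mul (A : algebra K I) x y (V : lmodType K) (F : I -> V) :
  l1 (elt_mul A x y) F = l1 x (fun i => l1 y (fun j => l1 (amul A i j) F)).
Proof.
transitivity (l1 (fun k => l1 x (fun i => l1 y (fun j => amul A i j k : K^o) : K^o)) F).
  by apply: eq_bigr => k _; rewrite elt_mulE.
rewrite (l1_comp x (fun i k => l1 y (fun j => amul A i j k : K^o))).
by apply: eq_l1 => i; rewrite -(l1_comp y (amul A i)).
Qed.

Lemma l1_elt_one (A : algebra K I) (V : lmodType K) (F : I -> V) :
  l1 (elt_one A) F = l1 (aone A) F.
Proof. by apply: eq_bigr => k _; rewrite ffunE. Qed.

End CoefficientLaws.

(** * Hopf algebra axioms on test functions *)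

Section BialgebraLaws.
Variables (K : fieldType) (I : finType).

Section Algebra.
Variables (A : algebra K I) (V : lmodType K).
Implicit Type F : I -> V.
Hypothesis A_alg : is_algebra A.

Lemma amulA i j k F : l1 (amul A i j) (fun a => l1 (amul A a k) F) =
  l1 (amul A j k) (fun a => l1 (amul A i a) F).
Proof.
have /(congr1 (fun x : {ffun I -> K} => l1 x F)) :=
  elt_mulA A_alg (basis K i) (basis K j) (basis K k).
rewrite !l1_elt_mul !l1_basis => /esym.
under eq_l1 do rewrite l1_basis; move=> ->.
by rewrite l1_elt_mul !l1_basis.
Qed.

Lemma amul1l i F : l1 (aone A) (fun a => l1 (amul A a i) F) = F i.
Proof.
rewrite -l1_elt_one -[RHS]l1_basis -[in RHS](elt_mul1l A_alg (basis K i)).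
by rewrite l1_elt_mul; apply: eq_l1 => a; rewrite l1_basis.
Qed.

Lemma amul1r i F : l1 (aone A) (fun a => l1 (amul A i a) F) = F i.
Proof.
rewrite -l1_elt_one -[RHS]l1_basis -[in RHS](elt_mul1r A_alg (basis K i)).
by rewrite l1_elt_mul l1_basis.
Qed.

End Algebra.

Section Coalgebra.
Variables (H : hopf K I) (V : lmodType K).
Implicit Type F : I -> V.
Hypothesis H_coalg : is_coalgebra H.

Lemma comulA i (F : I -> I -> I -> V) :
  l2 (comul H i) (fun j c => l2 (comul H j) (fun a b => F a b c)) =
  l2 (comul H i) (fun a j => l2 (comul H j) (fun b c => F a b c)).
Proof.
have [cA _ _] := H_coalg.
transitivity (\sum_a \sum_b \sum_c
    (\sum_j comul H i j c * comul H j a b) *: F a b c).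
  rewrite /l2; under eq_bigr do under eq_bigr do rewrite scaler_sumr.
  under eq_bigr do rewrite exchange_big.
  rewrite exchange_big; apply: eq_bigr => a _.
  under eq_bigr do under eq_bigr do rewrite scaler_sumr.
  under eq_bigr do rewrite exchange_big.
  rewrite exchange_big; apply: eq_bigr => b _.
  rewrite exchange_big; apply: eq_bigr => c _; rewrite scaler_suml.
  by apply: eq_bigr => j _; rewrite scalerA.
rewrite /l2; apply: eq_bigr => a _; rewrite -/(l2 _ _) /l2.
under [RHS]eq_bigr do rewrite scaler_sumr.
rewrite [RHS]exchange_big; apply: eq_bigr => b _.
under [RHS]eq_bigr do rewrite scaler_sumr.
rewrite [RHS]exchange_big; apply: eq_bigr => c _; rewrite cA scaler_suml.
by apply: eq_bigr => j _; rewrite scalerA.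
Qed.

Lemma comul1l i F : l2 (comul H i) (fun a b => counit H a *: F b) = F i.
Proof.
have [_ c1 _] := H_coalg.
rewrite /l2 exchange_big -[RHS](l1_delta i); apply: eq_bigr => k _ /=.
by rewrite -c1 scaler_suml; apply: eq_bigr => j _; rewrite scalerA mulrC.
Qed.

Lemma comul1r i F : l2 (comul H i) (fun a b => counit H b *: F a) = F i.
Proof.
have [_ _ c1] := H_coalg.
rewrite /l2 -[RHS](l1_delta i); apply: eq_bigr => k _ /=.
by rewrite -c1 scaler_suml; apply: eq_bigr => j _; rewrite scalerA.
Qed.

End Coalgebra.

Section Bialgebra.
Variables (H : hopf K I) (V : lmodType K).
Implicit Type F : I -> V.

Lemma l1_elt_comul x (F : I -> I -> V) :
  l1 (elt_comul H x) (fun u => F u.1 u.2) = l1 x (fun i => l2 (comul H i) F).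
Proof.
transitivity (l1 (fun u : I * I => l1 x (fun i => comul H i u.1 u.2 : K^o))
   (fun u => F u.1 u.2)); first by apply: eq_bigr => u _; rewrite ffunE.
by rewrite (l1_comp x (fun i u => comul H i u.1 u.2)); apply: eq_l1 => i; rewrite l2E.
Qed.

Lemma l1_tens_amul (J : finType) (A : algebra K I) (B : algebra K J) u v
    (W : lmodType K) (F : I -> J -> W) :
  l1 (amul (tens_algebra A B) u v) (fun w => F w.1 w.2) =
  l1 (amul A u.1 v.1) (fun p => l1 (amul B u.2 v.2) (fun q => F p q)).
Proof.
transitivity (l2 (fun p q => amul A u.1 v.1 p * amul B u.2 v.2 q) F).
  by rewrite l2E.
apply: eq_bigr => p _; rewrite scaler_sumr.
by apply: eq_bigr => q _; rewrite scalerA.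
Qed.

Lemma l1_tens_aone (J : finType) (A : algebra K I) (B : algebra K J)
    (W : lmodType K) (F : I -> J -> W) :
  l1 (aone (tens_algebra A B)) (fun w => F w.1 w.2) =
  l1 (aone A) (fun p => l1 (aone B) (fun q => F p q)).
Proof.
transitivity (l2 (fun p q => aone A p * aone B q) F); first by rewrite l2E.
apply: eq_bigr => p _; rewrite scaler_sumr.
by apply: eq_bigr => q _; rewrite scalerA.
Qed.

Hypothesis H_bialg : is_bialgebra H.

Lemma comulM i j (F : I -> I -> V) :
  l1 (amul H i j) (fun k => l2 (comul H k) F) =
  l2 (comul H i) (fun a b => l2 (comul H j) (fun c d =>
    l1 (amul H a c) (fun p => l1 (amul H b d) (fun q => F p q)))).
Proof.
have [_ _ [cM _] _] := H_bialg.
have /(congr1 (fun x : {ffun I * I -> K} => l1 x (fun u => F u.1 u.2))) :=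
  cM (basis K i) (basis K j).
rewrite l1_elt_comul !l1_elt_mul !l1_basis => ->.
transitivity (l1 (elt_comul H (basis K i)) (fun u =>
   l2 (comul H j) (fun c d =>
    l1 (amul H u.1 c) (fun p => l1 (amul H u.2 d) (fun q => F p q))))).
  have e G : l2 (comul H j) G =
      l1 (elt_comul H (basis K j)) (fun v => G v.1 v.2) :> V.
    by rewrite l1_elt_comul l1_basis.
  apply: eq_l1 => u; rewrite e.
  by apply: eq_l1 => v; exact: (l1_tens_amul H H u v F).
rewrite (l1_elt_comul _ (fun a b => l2 (comul H j) (fun c d =>
  l1 (amul H a c) (fun p => l1 (amul H b d) (fun q => F p q))))).
by rewrite l1_basis.
Qed.

Lemma comul1 (F : I -> I -> V) :
  l1 (aone H) (fun k => l2 (comul H k) F) =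
  l1 (aone H) (fun a => l1 (aone H) (fun b => F a b)).
Proof.
have [_ _ [_ c1] _] := H_bialg.
have /(congr1 (fun x : {ffun I * I -> K} => l1 x (fun u => F u.1 u.2))) := c1.
rewrite l1_elt_comul !l1_elt_one => ->.
exact: (l1_tens_aone H H F).
Qed.

Lemma counitE x : elt_counit H x = l1 x (counit H : I -> K^o).
Proof. by []. Qed.

Lemma counitM i j : l1 (amul H i j) (counit H : I -> K^o) = counit H i * counit H j.
Proof.
have [_ _ _ [eM _]] := H_bialg.
by have := eM (basis K i) (basis K j); rewrite !counitE l1_elt_mul !l1_basis.
Qed.

Lemma counit1 : l1 (aone H) (counit H : I -> K^o) = 1.
Proof. by have [_ _ _ [_]] := H_bialg; rewrite counitE l1_elt_one. Qed.

End Bialgebra.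

Section Antipode.
Variables (H : hopf K I) (V : lmodType K).
Implicit Type F : I -> V.
Hypothesis H_hopf : is_hopf H.

Lemma l1_scale_ffun (c : K) (x : {ffun I -> K^o}) F :
  l1 (c *: x) F = c *: l1 x F.
Proof.
by rewrite l1Z; apply: eq_bigr => k _; rewrite ffunE scalerA mulrC.
Qed.

Lemma l1_sum_ffun (A : finType) (c : A -> {ffun I -> K^o}) F :
  l1 (\sum_a c a) F = \sum_a l1 (c a) F.
Proof.
rewrite /l1 exchange_big; apply: eq_bigr => k _.
by rewrite sum_ffunE scaler_suml.
Qed.

Lemma l1_elt_antipode i F : l1 (elt_antipode H (basis K i)) F = l1 (antipode H i) F.
Proof.
apply: eq_bigr => k _; rewrite ffunE; congr (_ *: _).
exact: (l1_basis i (fun i => antipode H i k : K^o)).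
Qed.

Lemma antipodeL i F :
  l2 (comul H i) (fun a b => l1 (antipode H a) (fun s => l1 (amul H s b) F)) =
  counit H i *: l1 (aone H) F.
Proof.
have /(congr1 (fun x : {ffun I -> K^o} => l1 x F)) := antipode_l H_hopf i.
move=> /esym e; rewrite -(l1_elt_one H F); apply: etrans _ (etrans (esym e) (l1_scale_ffun _ _ F)).
rewrite l1_sum_ffun.
apply: eq_bigr => a _; rewrite l1_sum_ffun; apply: eq_bigr => b _.
rewrite l1_scale_ffun; congr (_ *: _).
symmetry; etransitivity; first exact: (l1_elt_mul H _ _ F).
rewrite l1_elt_antipode; by apply: eq_l1 => s; rewrite l1_basis.
Qed.

Lemma antipodeR i F :
  l2 (comul H i) (fun a b => l1 (antipode H b) (fun s => l1 (amul H a s) F)) =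
  counit H i *: l1 (aone H) F.
Proof.
have /(congr1 (fun x : {ffun I -> K^o} => l1 x F)) := antipode_r H_hopf i.
move=> /esym e; rewrite -(l1_elt_one H F); apply: etrans _ (etrans (esym e) (l1_scale_ffun _ _ F)).
rewrite l1_sum_ffun.
apply: eq_bigr => a _; rewrite l1_sum_ffun; apply: eq_bigr => b _.
rewrite l1_scale_ffun; congr (_ *: _).
symmetry; etransitivity; first exact: (l1_elt_mul H _ _ F).
by rewrite l1_basis l1_elt_antipode.
Qed.

End Antipode.
End BialgebraLaws.

(** * Convolution inverses and the antipode *)

Section Convolution.
Variables (K : fieldType) (C : finType) (n : nat).
Variables (cop : C -> C -> C -> K) (eps : C -> K).
Hypothesis copA : forall i (F : C -> C -> C -> 'M[K]_n),
  l2 (cop i) (fun j c => l2 (cop j) (fun a b => F a b c)) =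
  l2 (cop i) (fun a j => l2 (cop j) (fun b c => F a b c)).
Hypothesis cop1l : forall i (F : C -> 'M[K]_n),
  l2 (cop i) (fun a b => eps a *: F b) = F i.
Hypothesis cop1r : forall i (F : C -> 'M[K]_n),
  l2 (cop i) (fun a b => eps b *: F a) = F i.

(** The usual g = g * (f * h) = (g * f) * h = h. The coalgebra is abstract because it is needed both
    for H and for H (x) H. *)
Lemma convolution_inverse_unique (f g h : C -> 'M[K]_n) :
  (forall i, l2 (cop i) (fun a b => g a *m f b) = eps i *: 1%:M) ->
  (forall i, l2 (cop i) (fun a b => f a *m h b) = eps i *: 1%:M) ->
  g =1 h.
Proof.
move=> gf fh i; rewrite -[LHS]cop1r -[RHS]cop1l.
transitivity (l2 (cop i) (fun a j => l2 (cop j) (fun b c => g a *m f b *m h c))).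
  apply: eq_l2 => a j.
  rewrite -[X in _ *: X]mulmx1 scalemxAr -fh l2_mulmxr.
  by apply: eq_l2 => b c; rewrite mulmxA.
rewrite -copA; apply: eq_l2 => j c.
by rewrite -l2_mulmxl gf -scalemxAl mul1mx.
Qed.

End Convolution.

Section Coordinates.
Variables (K : fieldType) (I : finType) (V : lmodType K).

Definition cV_lin (F : I -> V) (v : 'cV[K]_#|I|) : V :=
  \sum_k v (enum_rank k) 0 *: F k.

Fact cV_lin_linear F : linear (cV_lin F).
Proof.
move=> k u v; rewrite /cV_lin scaler_sumr -big_split; apply: eq_bigr => i _.
by rewrite !mxE scalerDl scalerA.
Qed.

HB.instance Definition _ F :=
  GRing.isLinear.Build K _ _ _ (cV_lin F) (cV_lin_linear F).

Lemma cV_lin_l1 (A : finType) F (c : A -> K) (G : A -> 'cV[K]_#|I|) :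
  cV_lin F (l1 c G) = l1 c (fun a => cV_lin F (G a)).
Proof. exact: (l1_map (cV_lin F)). Qed.

Definition cVdelta (i : I) : 'cV[K]_#|I| := delta_mx (enum_rank i) 0.

Lemma cV_lin_delta F i : cV_lin F (cVdelta i) = F i.
Proof.
rewrite -[RHS](l1_delta i); apply: eq_bigr => k _.
by rewrite mxE eqxx andbT eq_sym (inj_eq enum_rank_inj).
Qed.

End Coordinates.

Section RegularModule.
Variables (K : fieldType) (I : finType) (A : algebra K I).

(** Matrices are indexed by ordinals and bases by finite types; this is the translation through the
    enumeration of [I]. *)
Definition mxI (f : I -> I -> K) : 'M[K]_#|I| :=
  \matrix_(p, q) f (enum_val p) (enum_val q).

Lemma mxI_delta f j : mxI f *m cVdelta K j = l1 (f^~ j) (@cVdelta K I).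
Proof.
apply/matrixP => p q; rewrite ord1 /cVdelta -colE mxE mxE enum_rankK.
rewrite /l1 summxE (bigD1 (enum_val p)) //= big1 ?addr0.
  by rewrite !mxE enum_valK !eqxx mulr1.
move=> k kp; rewrite !mxE -[p]enum_valK (inj_eq enum_rank_inj).
by rewrite eq_sym (negbTE kp) mulr0.
Qed.

Lemma cV_ext n (M N : 'M[K]_(n, #|I|)) :
  (forall j : I, M *m cVdelta K j = N *m cVdelta K j) -> M = N.
Proof.
move=> MN; apply/matrixP => p q.
have /(congr1 (fun v : 'cV_n => v p 0)) := MN (enum_val q).
by rewrite /cVdelta -!colE !mxE enum_valK.
Qed.

Definition regL i : 'M[K]_#|I| := mxI (fun k j => amul A i j k).

Lemma regL_delta i j : regL i *m cVdelta K j = l1 (amul A i j) (@cVdelta K I).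
Proof. exact: mxI_delta. Qed.

Hypothesis A_alg : is_algebra A.

Lemma regLM i j : regL i *m regL j = l1 (amul A i j) regL.
Proof.
apply: cV_ext => k; rewrite -mulmxA regL_delta l1_mulmxr l1_mulmxl.
under eq_l1 do rewrite regL_delta; under [RHS]eq_l1 do rewrite regL_delta.
by rewrite (amulA A_alg).
Qed.

Lemma regL1 : l1 (aone A) regL = 1%:M.
Proof.
apply: cV_ext => k; rewrite l1_mulmxl mul1mx.
by under eq_l1 do rewrite regL_delta; rewrite (amul1l A_alg).
Qed.

Definition cV1 := l1 (aone A) (@cVdelta K I).

(** The regular representation is faithful because evaluation at 1 recovers the element. Matrix
    identities below return to identities in H in this way. *)
Lemma regL_cV1 i : regL i *m cV1 = cVdelta K i.
Proof.
by rewrite l1_mulmxr; under eq_l1 do rewrite regL_delta; rewrite (amul1r A_alg).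
Qed.

End RegularModule.

Section AntipodeAntimorphism.
Variables (K : fieldType) (I : finType) (H : hopf K I).
Hypothesis H_hopf : is_hopf H.
Let H_bi := hopf_bialgebra H_hopf.
Let H_alg : is_algebra H. Proof. by case: H_bi. Qed.
Let H_coalg : is_coalgebra H. Proof. by case: H_bi. Qed.

Lemma antipode1 (V : lmodType K) (F : I -> V) :
  l1 (aone H) (fun i => l1 (antipode H i) F) = l1 (aone H) F.
Proof.
transitivity (l1 (aone H) (fun i => counit H i *: l1 (aone H) F)).
  under [RHS]eq_l1 do rewrite -(antipodeL H_hopf).
  rewrite (comul1 H_bi); apply: eq_l1 => i.
  rewrite l11C; apply: eq_l1 => s.
  by rewrite (amul1r H_alg).
by rewrite -l1_scal (counit1 H_bi) scale1r.
Qed.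

Lemma counit_antipode i : l1 (antipode H i) (counit H : I -> K^o) = counit H i.
Proof.
have := antipodeL H_hopf i (counit H : I -> K^o).
rewrite (counit1 H_bi) [_ *: 1]mulr1 => <-.
under eq_l2 => a b do under eq_l1 do rewrite (counitM H_bi) mulrC.
transitivity (l2 (comul H i) (fun a b => counit H b *: l1 (antipode H a) (counit H : I -> K^o))).
  by rewrite (comul1r H_coalg).
by apply: eq_l2 => a b; rewrite l1Z.
Qed.

Let rho := regL H.
Let sig i := l1 (antipode H i) rho.

Let rhoM i j : rho i *m rho j = l1 (amul H i j) rho := regLM H_alg i j.

Let sr i : l2 (comul H i) (fun a b => sig a *m rho b) = counit H i *: 1%:M.
Proof.
rewrite -(regL1 H_alg) -(antipodeL H_hopf); apply: eq_l2 => a b.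
by rewrite l1_mulmxl; apply: eq_l1 => s; rewrite rhoM.
Qed.

Let rs i : l2 (comul H i) (fun a b => rho a *m sig b) = counit H i *: 1%:M.
Proof.
rewrite -(regL1 H_alg) -(antipodeR H_hopf); apply: eq_l2 => a b.
by rewrite l1_mulmxr; apply: eq_l1 => s; rewrite rhoM.
Qed.

Lemma l2_pair (A A' B B' : finType) (V : lmodType K) c d
    (F : A * B -> A' * B' -> V) :
  l2 (fun u v => c u.1 v.1 * d u.2 v.2) F =
  l2 c (fun a a' => l2 d (fun b b' => F (a, b) (a', b'))).
Proof.
transitivity (\sum_a \sum_b \sum_(v : A' * B') (c a v.1 * d b v.2) *: F (a, b) v).
  by rewrite pair_bigA; apply: eq_bigr => -[].
rewrite /l2; apply: eq_bigr => a _.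
transitivity (\sum_j \sum_a' \sum_b' (c a a' * d j b') *: F (a, j) (a', b')).
  by apply: eq_bigr => j _; rewrite pair_bigA /=; apply: eq_bigr => -[].
rewrite exchange_big; apply: eq_bigr => a' _; rewrite scaler_sumr.
apply: eq_bigr => b _; rewrite scaler_sumr; apply: eq_bigr => b' _.
by rewrite scalerA.
Qed.

(** In the convolution algebra of maps from H (x) H to End(H), both S(xy) and S(y) S(x) are inverse
    to the product map [f], the first on the left and the second on the right. *)
Lemma antipodeM (V : lmodType K) i j (F : I -> V) :
  l1 (amul H i j) (fun k => l1 (antipode H k) F) =
  l1 (antipode H j) (fun b => l1 (antipode H i) (fun a => l1 (amul H b a) F)).
Proof.
pose cop (i j k : I * I) := comul H i.1 j.1 k.1 * comul H i.2 j.2 k.2.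
pose eps (i : I * I) := counit H i.1 * counit H i.2.
pose f (u : I * I) := rho u.1 *m rho u.2.
pose g (u : I * I) := l1 (amul H u.1 u.2) sig.
pose h (u : I * I) := sig u.2 *m sig u.1.
suff gh : g (i, j) = h (i, j).
  have := congr1 (fun M => cV_lin F (M *m cV1 H)) gh.
  rewrite /g /h /= l1_mulmxl cV_lin_l1 /sig.
  under eq_l1 => a do rewrite l1_mulmxl cV_lin_l1.
  under eq_l1 => a do under eq_l1 => b do rewrite (regL_cV1 H_alg) cV_lin_delta.
  move=> ->; rewrite !l1_mulmxl cV_lin_l1; apply: eq_l1 => b.
  rewrite (l1_mulmxr _ _ (rho b)) l1_mulmxl cV_lin_l1; apply: eq_l1 => a.
  rewrite rhoM l1_mulmxl cV_lin_l1; apply: eq_l1 => c.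
  by rewrite (regL_cV1 H_alg) cV_lin_delta.
have copE k (F' : I * I -> I * I -> 'M[K]_#|I|) : l2 (cop k) F' =
    l2 (comul H k.1) (fun a a' => l2 (comul H k.2) (fun b b' => F' (a, b) (a', b'))).
  exact: l2_pair.
apply: (@convolution_inverse_unique _ _ _ cop eps _ _ _ f) => {i j} i.
- move=> F'; rewrite !copE.
  under eq_l2 => a b do under eq_l2 => c d do rewrite copE /=.
  under eq_l2 => a b do rewrite l22C.
  rewrite (comulA H_coalg).
  under [RHS]eq_l2 => a b do under eq_l2 => c d do rewrite copE /=.
  under [RHS]eq_l2 => a b do rewrite l22C.
  apply: eq_l2 => a b; apply: eq_l2 => c d.
  by rewrite (comulA H_coalg).
- move=> F'; rewrite !copE.
  under eq_l2 => a b do under eq_l2 => c d do rewrite /eps /= -scalerA.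
  under eq_l2 => a b do rewrite -l2Z (comul1l H_coalg i.2 (fun d => F' (b, d))).
  by rewrite (comul1l H_coalg i.1 (fun b => F' (b, i.2))); case: i.
- move=> F'; rewrite !copE.
  under eq_l2 => a b do under eq_l2 => c d do rewrite /eps /= -scalerA.
  under eq_l2 => a b do rewrite -l2Z (comul1r H_coalg i.2 (fun d => F' (a, d))).
  by rewrite (comul1r H_coalg i.1 (fun b => F' (b, i.2))); case: i.
- rewrite copE /g /f /=.
  transitivity (l1 (amul H i.1 i.2) (fun k => counit H k *: 1%:M : 'M[K]_#|I|)).
    under [RHS]eq_l1 do rewrite -sr.
    rewrite (comulM H_bi); apply: eq_l2 => a b; apply: eq_l2 => c d.
    rewrite l1_mulmxl; apply: eq_l1 => p.
    by rewrite rhoM l1_mulmxr.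
  by rewrite -l1_scal (counitM H_bi).
- rewrite copE /h /f /=.
  transitivity (l2 (comul H i.1) (fun a b => counit H i.2 *: (rho a *m sig b))).
    apply: eq_l2 => a b.
    under eq_l2 => c d do rewrite mulmxA -(mulmxA (rho a)).
    by rewrite -l2_mulmxl -l2_mulmxr rs -scalemxAr -scalemxAl mulmx1.
  by rewrite -l2Z rs scalerA mulrC.
Qed.

Definition cV_lin2 (V : lmodType K) (F : I -> I -> V) (v : 'cV[K]_(#|I| * #|I|)) : V :=
  \sum_a \sum_b v (mxtens_index (enum_rank a, enum_rank b)) 0 *: F a b.

Fact cV_lin2_linear (V : lmodType K) (F : I -> I -> V) : linear (cV_lin2 F).
Proof.
move=> k u v; rewrite /cV_lin2 scaler_sumr -big_split; apply: eq_bigr => a _.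
rewrite scaler_sumr -big_split; apply: eq_bigr => b _.
by rewrite !mxE scalerDl scalerA.
Qed.

HB.instance Definition _ (V : lmodType K) (F : I -> I -> V) :=
  GRing.isLinear.Build K _ _ _ (cV_lin2 F) (cV_lin2_linear F).

Lemma cV_lin2_l1 (V : lmodType K) (A : finType) (F : I -> I -> V) (c : A -> K) G :
  cV_lin2 F (l1 c G) = l1 c (fun a => cV_lin2 F (G a)).
Proof. exact: (l1_map (cV_lin2 F)). Qed.

Lemma cV_lin2_l2 (V : lmodType K) (A : finType) (F : I -> I -> V) (c : A -> A -> K) G :
  cV_lin2 F (l2 c G) = l2 c (fun a b => cV_lin2 F (G a b)).
Proof. exact: (l2_map (cV_lin2 F)). Qed.

Lemma cV_lin2_delta (V : lmodType K) (F : I -> I -> V) i j :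
  cV_lin2 F (cVdelta K i *t cVdelta K j) = F i j.
Proof.
rewrite -[RHS](l1_delta j) -[RHS](l1_delta i (fun i => l1 _ (F i))).
apply: eq_bigr => a _; rewrite scaler_sumr; apply: eq_bigr => b _.
rewrite scalerA; congr (_ *: _).
rewrite mxE mxtens_indexK !mxE /= !(inj_eq enum_rank_inj).
by rewrite [_ == 0](_ : _ = true) 1?[X in _ * (_ && X)%:R](_ : _ = true)
  ?andbT 1?[a == _]eq_sym 1?[b == _]eq_sym // -val_eqE /= ?div0n ?mod0n.
Qed.

(** The same argument for maps from H to End(H) (x) End(H): the coproduct of S(h) and S(h_2) (x)
    S(h_1) are both convolution inverse to the coproduct. Evaluation at 1 (x) 1 recovers the
    tensors. *)
Lemma antipode_comul (V : lmodType K) i (F : I -> I -> V) :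
  l1 (antipode H i) (fun k => l2 (comul H k) F) =
  l2 (comul H i) (fun a b =>
    l1 (antipode H b) (fun p => l1 (antipode H a) (fun q => F p q))).
Proof.
pose f i := l2 (comul H i) (fun a b => rho a *t rho b).
pose g i := l1 (antipode H i) f.
pose h i := l2 (comul H i) (fun a b => sig b *t sig a).
pose u := cV1 H *t cV1 H.
have rtu a b : (rho a *t rho b) *m u = cVdelta K a *t cVdelta K b.
  by rewrite tensmx_mul !(regL_cV1 H_alg).
suff gh : g i = h i.
  have := congr1 (fun M => cV_lin2 F (M *m u)) gh.
  rewrite /g /h l1_mulmxl cV_lin2_l1 l2_mulmxl cV_lin2_l2.
  under eq_l1 => k do rewrite l2_mulmxl cV_lin2_l2.
  under eq_l1 => k do under eq_l2 => a b do rewrite rtu cV_lin2_delta.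
  move=> ->; apply: eq_l2 => a b; rewrite l1_tensl l1_mulmxl cV_lin2_l1.
  apply: eq_l1 => p; rewrite l1_tensr l1_mulmxl cV_lin2_l1.
  by apply: eq_l1 => q; rewrite rtu cV_lin2_delta.
apply: (@convolution_inverse_unique _ _ _ (comul H) (counit H) _ _ _ f) => {i} i.
- by move=> F'; rewrite (comulA H_coalg).
- by move=> F'; rewrite (comul1l H_coalg).
- by move=> F'; rewrite (comul1r H_coalg).
- transitivity (l2 (comul H i) (fun a b => l1 (antipode H a) (fun s => l1 (amul H s b) f))).
    apply: eq_l2 => a b; rewrite l1_mulmxl; apply: eq_l1 => s.
    rewrite (comulM H_bi) /f l2_mulmxl; apply: eq_l2 => p q.
    rewrite l2_mulmxr; apply: eq_l2 => p' q'.
    rewrite tensmx_mul !rhoM l1_tensl; apply: eq_l1 => x.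
    by rewrite l1_tensr.
  rewrite (antipodeL H_hopf) /f (comul1 H_bi); congr (_ *: _).
  under eq_l1 do rewrite -l1_tensr.
  by rewrite -l1_tensl regL1 // tensmx11.
- transitivity (l2 (comul H i) (fun a b => l2 (comul H a) (fun p q =>
     l2 (comul H b) (fun r s => (rho p *m sig s) *t (rho q *m sig r))))).
    apply: eq_l2 => a b; rewrite l2_mulmxl; apply: eq_l2 => p q.
    by rewrite l2_mulmxr; apply: eq_l2 => r s; rewrite tensmx_mul.
  rewrite (comulA H_coalg i (fun p q b => l2 (comul H b) (fun r s =>
     (rho p *m sig s) *t (rho q *m sig r)))).
  transitivity (l2 (comul H i) (fun p j => (rho p *m sig j) *t (1%:M : 'M[K]_#|I|))).
    apply: eq_l2 => p j.
    rewrite -(comulA H_coalg j (fun q r s =>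
      (rho p *m sig s) *t (rho q *m sig r))).
    under eq_l2 => w s do rewrite -l2_tensr rs tensmxZr.
    by rewrite (comul1l H_coalg j (fun s => (rho p *m sig s) *t (1%:M : 'M[K]_#|I|))).
  by rewrite -l2_tensl rs tensmxZl tensmx11.
Qed.

(** [antipodeV] is built with [invmx], which is an inverse only for invertible matrices, so
    bijectivity of the antipode is assumed here. It is supplied by [antipode_unit] and
    [smash_antipode_unit]. *)
Hypothesis S_unit :
  (\matrix_(a < #|I|, b < #|I|) antipode H (enum_val a) (enum_val b)) \in unitmx.

Lemma antipodeK (V : lmodType K) i (F : I -> V) :
  l1 (antipode H i) (fun k => l1 (antipodeV H k) F) = F i.
Proof.
rewrite -l1_comp -[RHS](l1_delta i); apply: eq_bigr => k _; congr (_ *: _).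
have /matrixP /(_ (enum_rank i) (enum_rank k)) := mulmxV S_unit.
rewrite !mxE (inj_eq enum_rank_inj) => <-; rewrite (reindex enum_rank) /=.
  by apply: eq_bigr => j _; rewrite !mxE !enum_rankK.
by exists enum_val => x _; rewrite (enum_rankK, enum_valK).
Qed.

Lemma antipodeVK (V : lmodType K) i (F : I -> V) :
  l1 (antipodeV H i) (fun k => l1 (antipode H k) F) = F i.
Proof.
rewrite -l1_comp -[RHS](l1_delta i); apply: eq_bigr => k _; congr (_ *: _).
have /matrixP /(_ (enum_rank i) (enum_rank k)) := mulVmx S_unit.
rewrite !mxE (inj_eq enum_rank_inj) => <-; rewrite (reindex enum_rank) /=.
  by apply: eq_bigr => j _; rewrite !mxE !enum_rankK.
by exists enum_val => x _; rewrite (enum_rankK, enum_valK).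
Qed.

Lemma antipodeV1 (V : lmodType K) (F : I -> V) :
  l1 (aone H) (fun i => l1 (antipodeV H i) F) = l1 (aone H) F.
Proof. by rewrite -antipode1; apply: eq_l1 => i; rewrite antipodeK. Qed.

Lemma counit_antipodeV i : l1 (antipodeV H i) (counit H : I -> K^o) = counit H i.
Proof.
rewrite -[RHS](antipodeVK i (counit H : I -> K^o)).
by apply: eq_l1 => k; rewrite counit_antipode.
Qed.

Lemma antipodeVM (V : lmodType K) i j (F : I -> V) :
  l1 (amul H i j) (fun k => l1 (antipodeV H k) F) =
  l1 (antipodeV H j) (fun b => l1 (antipodeV H i) (fun a => l1 (amul H b a) F)).
Proof.
transitivity (l1 (antipodeV H j) (fun b => l1 (antipodeV H i) (fun a =>
   l1 (amul H b a) (fun k => l1 (antipode H k) (fun l => l1 (antipodeV H l) F))))).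
  under [RHS]eq_l1 => b do under eq_l1 => a do rewrite antipodeM.
  under [RHS]eq_l1 => b do rewrite antipodeVK.
  by rewrite antipodeVK.
apply: eq_l1 => b; apply: eq_l1 => a; apply: eq_l1 => k.
by rewrite antipodeK.
Qed.

Lemma antipodeV_comul (V : lmodType K) i (F : I -> I -> V) :
  l1 (antipodeV H i) (fun k => l2 (comul H k) F) =
  l2 (comul H i) (fun a b =>
    l1 (antipodeV H b) (fun p => l1 (antipodeV H a) (fun q => F p q))).
Proof.
rewrite -[RHS](antipodeVK i (fun i => l2 (comul H i) (fun a b =>
    l1 (antipodeV H b) (fun p => l1 (antipodeV H a) (fun q => F p q))))).
apply: eq_l1 => k; rewrite antipode_comul; apply: eq_l2 => a b.
under [RHS]eq_l1 => p do rewrite antipodeK.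
by rewrite antipodeK.
Qed.

(** Apply S^-1, which reverses products, to S(h_1) h_2 = eps(h) 1. *)
Lemma antipodeVL (V : lmodType K) i (F : I -> V) :
  l2 (comul H i) (fun a b => l1 (antipodeV H b) (fun s => l1 (amul H s a) F)) =
  counit H i *: l1 (aone H) F.
Proof.
rewrite -antipodeV1 -(antipodeL H_hopf); apply: eq_l2 => a b.
rewrite -[RHS](antipodeVK b (fun b => l1 _ (fun s => l1 (amul H s b) _))).
apply: eq_l1 => s; rewrite l11C -antipodeM; apply: eq_l1 => k.
by rewrite antipodeK.
Qed.

Lemma antipodeVR (V : lmodType K) i (F : I -> V) :
  l2 (comul H i) (fun a b => l1 (antipodeV H a) (fun s => l1 (amul H b s) F)) =
  counit H i *: l1 (aone H) F.
Proof.
rewrite -antipodeV1 -(antipodeR H_hopf); apply: eq_l2 => a b.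
rewrite -[RHS](antipodeVK a (fun a => l1 _ (fun s => l1 (amul H a s) _))).
apply: eq_l1 => s; rewrite -antipodeM; apply: eq_l1 => k.
by rewrite antipodeK.
Qed.

End AntipodeAntimorphism.

(** * Exact functors and thick subcategories *)

Section SplitMatrices.
Variable K : fieldType.

Lemma mx_injP m n (f : 'M[K]_(m, n)) : mx_inj f <-> exists r, r *m f = 1%:M.
Proof.
split=> [finj|[r rf] u v /= /(congr1 (mulmx r))]; last by rewrite !mulmxA rf !mul1mx.
have /row_freeP[r fr] : row_free f^T.
  apply: inj_row_free => v vf; apply: trmx_inj; apply: finj => /=.
  by rewrite trmx0 mulmx0 -[f]trmxK -trmx_mul vf trmx0.
by exists r^T; apply: trmx_inj; rewrite trmx_mul trmxK fr trmx1.
Qed.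

Lemma mx_surjP m n (f : 'M[K]_(m, n)) : mx_surj f <-> exists s, f *m s = 1%:M.
Proof.
split=> [fsurj|[s fs] w]; last by exists (s *m w); rewrite mulmxA fs mul1mx.
have /boolp.choice[g gP] : forall j : 'I_m, exists v : 'cV_n, f *m v = delta_mx j 0.
  by move=> j; apply: fsurj.
exists (\matrix_(i, j) g j i 0); apply/matrixP => i j.
transitivity ((f *m g j) i 0); last by rewrite gP !mxE eqxx andbT.
by rewrite !mxE; apply: eq_bigr => k _; rewrite !mxE.
Qed.

Lemma mx_cV_ext m n (f g : 'M[K]_(m, n)) :
  (forall v : 'cV_n, f *m v = g *m v) -> f = g.
Proof.
move=> fg; apply/matrixP => i j.
have /(congr1 (fun v : 'cV_m => v i 0)) := fg (delta_mx j 0).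
by rewrite -!colE !mxE.
Qed.

End SplitMatrices.

Section Homs.
Variables (K : fieldType) (I : finType).
Implicit Types M N P Q : rep K I.

Lemma is_hom1 M : @is_hom K I M M 1%:M.
Proof. by move=> i; rewrite mul1mx mulmx1. Qed.

Lemma is_hom0 M N : @is_hom K I M N 0.
Proof. by move=> i; rewrite mul0mx mulmx0. Qed.

Lemma is_hom_mul M N P (f : 'M_(rdim N, rdim M)) (g : 'M_(rdim P, rdim N)) :
  is_hom f -> is_hom g -> @is_hom K I M P (g *m f).
Proof. by move=> hf hg i; rewrite -mulmxA hf !mulmxA hg. Qed.

Lemma is_homB M N (f g : 'M_(rdim N, rdim M)) :
  is_hom f -> is_hom g -> @is_hom K I M N (f - g).
Proof. by move=> hf hg i; rewrite mulmxBl mulmxBr hf hg. Qed.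

Lemma is_hom_col M N P (f : 'M_(rdim N, rdim M)) (g : 'M_(rdim P, rdim M)) :
  is_hom f -> is_hom g -> @is_hom K I M (dsum N P) (col_mx f g).
Proof.
move=> hf hg i; rewrite mul_col_mx /= mul_block_col !mul0mx add0r addr0.
by rewrite hf hg.
Qed.

Lemma is_hom_row M N P (f : 'M_(rdim P, rdim M)) (g : 'M_(rdim P, rdim N)) :
  is_hom f -> is_hom g -> @is_hom K I (dsum M N) P (row_mx f g).
Proof.
move=> hf hg i; rewrite mul_mx_row /= mul_row_block !mulmx0 add0r addr0.
by rewrite hf hg.
Qed.

Lemma is_hom_inv M N (f : 'M_(rdim N, rdim M)) (g : 'M_(rdim M, rdim N)) :
  is_hom f -> g *m f = 1%:M -> f *m g = 1%:M -> @is_hom K I N M g.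
Proof.
move=> hf gf fg i; rewrite -[ract N i]mulmx1 -fg !mulmxA -(mulmxA g) -hf.
by rewrite !mulmxA gf mul1mx.
Qed.

Definition retract M N := exists (s : 'M_(rdim N, rdim M)) (r : 'M_(rdim M, rdim N)),
  [/\ is_hom s, is_hom r & r *m s = 1%:M].

Definition iso M N := exists (f : 'M_(rdim N, rdim M)) (g : 'M_(rdim M, rdim N)),
  [/\ is_hom f, g *m f = 1%:M & f *m g = 1%:M].

Lemma iso_retract M N : iso M N -> retract M N.
Proof. by move=> [f [g [hf gf fg]]]; exists f, g; split=> //; apply: is_hom_inv gf fg. Qed.

Lemma iso_sym M N : iso M N -> iso N M.
Proof. by move=> [f [g [hf gf fg]]]; exists g, f; split=> //; apply: is_hom_inv gf fg. Qed.

Lemma iso_refl M : iso M M.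
Proof. by exists 1%:M, 1%:M; split; rewrite ?mulmx1 //; apply: is_hom1. Qed.

Lemma iso_trans M N P : iso M N -> iso N P -> iso M P.
Proof.
move=> [f [g [hf gf fg]]] [f' [g' [hf' gf' fg']]]; exists (f' *m f), (g *m g').
split; first exact: is_hom_mul.
- by rewrite mulmxA -(mulmxA g) gf' mulmx1.
- by rewrite mulmxA -(mulmxA f') fg mulmx1.
Qed.

Lemma retract_trans M N P : retract M N -> retract N P -> retract M P.
Proof.
move=> [s [r [hs hr rs]]] [s' [r' [hs' hr' rs']]]; exists (s' *m s), (r *m r').
split; try exact: is_hom_mul.
by rewrite mulmxA -(mulmxA r) rs' mulmx1.
Qed.

(** Over a field an exact sequence splits linearly, and the equations of a splitting are preserved
    by any additive functor defined on all linear maps. *)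
Lemma short_exactP M N P (f : 'M_(rdim N, rdim M)) (g : 'M_(rdim P, rdim N)) :
  short_exact f g <-> [/\ is_hom f, is_hom g &
    exists r s, [/\ r *m f = 1%:M, g *m s = 1%:M & f *m r + s *m g = 1%:M]].
Proof.
split=> [[[hf hg] /mx_injP[r rf] /mx_surjP[s gs] ker]|[hf hg [r [s [rf gs frsg]]]]].
  split=> //; have gf : g *m f = 0.
    apply: mx_cV_ext => u; rewrite mul0mx -mulmxA; apply/ker.
    by exists u.
  (* The section is corrected by its component along [f], so that r s' = 0. *)
  pose s' := s - f *m (r *m s).
  have gs' : g *m s' = 1%:M by rewrite mulmxBr gs !mulmxA gf !mul0mx subr0.
  exists r, s'; split=> //; have rs' : r *m s' = 0.
    by rewrite mulmxBr [r *m (f *m _)]mulmxA rf mul1mx subrr.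
  apply: mx_cV_ext => v; rewrite mul1mx mulmxDl.
  have : g *m (v - s' *m g *m v) = 0.
    by rewrite mulmxBr !mulmxA gs' mul1mx subrr.
  case/ker=> u vE; have := vE => /(congr1 (mulmx r)).
  rewrite mulmxA rf mul1mx mulmxBr !mulmxA rs' !mul0mx subr0 => ru.
  by rewrite -mulmxA ru -vE subrK.
have gf : g *m f = 0.
  have /(congr1 (mulmx g)) : s *m g *m f = 0.
    apply: (addrI (f *m r *m f)); rewrite -mulmxDl frsg mul1mx.
    by rewrite -mulmxA rf mulmx1 addr0.
  by rewrite mulmx0 !mulmxA gs mul1mx.
split=> //; first by apply/mx_injP; exists r.
  by apply/mx_surjP; exists s.
move=> v; split=> [gv|[u ->]]; last by rewrite mulmxA gf mul0mx.
exists (r *m v); rewrite -[LHS]mul1mx -frsg mulmxDl -[s *m g *m v]mulmxA gv mulmx0.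
by rewrite addr0 mulmxA.
Qed.

Variable A : algebra K I.

Lemma rep0_module : is_module A (rep0 K I).
Proof. by split=> [i j|]; apply/matrixP => -[]. Qed.

Lemma rep0_projective : projective A (rep0 K I).
Proof.
split=> [|M N g f _ _ _ _ _]; first exact: rep0_module.
exists 0; first exact: is_hom0.
by apply/matrixP => i [].
Qed.

Lemma iso_stable M N : iso M N -> stable_iso A M N.
Proof.
move=> [f [g [hf gf fg]]]; exists f, g; split=> //; first exact: is_hom_inv gf fg.
  exists (rep0 K I), 0, 0; rewrite gf subrr mulmx0.
  by split=> //; [exact: rep0_projective|exact: is_hom0|exact: is_hom0].
exists (rep0 K I), 0, 0; rewrite fg subrr mulmx0.
by split=> //; [exact: rep0_projective|exact: is_hom0|exact: is_hom0].
Qed.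

Lemma retract_projective M P :
  is_module A M -> projective A P -> retract M P -> projective A M.
Proof.
move=> mM [mP P_lift] [s [r [hs hr rs]]]; split=> // X Y g f mX mY hg hf g_surj.
have [h hh gh] := P_lift X Y g (f *m r) mX mY hg (is_hom_mul hr hf) g_surj.
exists (h *m s); first exact: is_hom_mul.
by rewrite mulmxA gh -mulmxA rs mulmx1.
Qed.

(* A retract has as complement the image of the complementary idempotent. *)
Lemma retract_complement M N : is_module A M -> is_module A N -> retract M N ->
  exists2 C, is_module A C & iso N (dsum M C).
Proof.
move=> mM [NM N1] [s [r [hs hr rs]]]; set e := 1%:M - s *m r.
have ee : e *m e = e.
  rewrite mulmxBl mul1mx mulmxBr mulmx1 mulmxA -(mulmxA s) rs mulmx1.
  by rewrite subrr subr0.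
(* A full-rank factorisation e = c b through the image of [e]. Idempotence forces b c = 1, so [c]
   and [b] are the inclusion and projection of the complement. *)
have [k [c [b [b' [c' [cb bb' c'c]]]]]] : exists k (c : 'M_(rdim N, k))
    (b : 'M_(k, rdim N)) b' c', [/\ c *m b = e, b *m b' = 1%:M & c' *m c = 1%:M].
  have /row_freeP[b' bb'] : row_free (row_base e) := row_base_free e.
  have /row_fullP[c' c'c] : row_full (col_base e) := col_base_full e.
  by exists (\rank e), (col_base e), (row_base e), b', c'; rewrite mulmx_base.
have bc : b *m c = 1%:M.
  have : c' *m (e *m e) *m b' = 1%:M by rewrite ee -cb mulmxA c'c mul1mx bb'.
  by rewrite -cb !mulmxA c'c mul1mx -mulmxA bb' mulmx1.
have he : @is_hom K I N N e by apply: is_homB; [exact: is_hom1|exact: is_hom_mul].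
have be : b *m e = b by rewrite -cb mulmxA bc mul1mx.
pose C := Rep (fun i => b *m ract N i *m c).
have mC : is_module A C.
  split=> [i j|] /=.
    rewrite !mulmxA -(mulmxA _ c b) cb -(mulmxA b) -(he i) !mulmxA be.
    rewrite -!mulmxA (mulmxA (ract N i)) NM mulmx_suml mulmx_sumr.
    by apply: eq_bigr => l _; rewrite -scalemxAl -scalemxAr mulmxA.
  rewrite -bc -[X in _ = X *m _]mulmx1 -N1 mulmx_sumr mulmx_suml.
  by apply: eq_bigr => l _; rewrite /= -scalemxAr -scalemxAl.
exists C => //; exists (col_mx r b), (row_mx s c); split.
- apply: is_hom_col => // i /=; rewrite -[RHS]mulmxA cb -mulmxA -(he i).
  by rewrite mulmxA be.
- by rewrite mul_row_col cb addrC subrK.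
rewrite mul_col_row rs bc; have -> : r *m c = 0.
  have : r *m e *m b' = 0 by rewrite mulmxBr mulmx1 mulmxA rs mul1mx subrr mul0mx.
  by rewrite -cb -!mulmxA bb' mulmx1.
have -> : b *m s = 0.
  have : c' *m (e *m s) = 0.
    by rewrite mulmxBl mul1mx -mulmxA rs mulmx1 subrr mulmx0.
  by rewrite -cb !mulmxA c'c mul1mx.
by rewrite -scalar_mx_block.
Qed.

End Homs.

Section Thick.
Variables (K : fieldType) (I : finType).
Implicit Types M N P Q : rep K I.

Lemma l1_block_diag m n (c : I -> K) (a : I -> 'M_m) (b : I -> 'M_n) :
  l1 c (fun k => block_mx (a k) 0 0 (b k)) = block_mx (l1 c a) 0 0 (l1 c b).
Proof.
rewrite /l1; elim/big_rec3: _ => [|k x y z _ ->]; first by rewrite block_mx0.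
by rewrite scale_block_mx add_block_mx !scaler0 !addr0.
Qed.

Lemma dsum_module (A : algebra K I) M N :
  is_module A M -> is_module A N -> is_module A (dsum M N).
Proof.
move=> [MM M1] [NM N1]; split=> [i j|] /=.
  rewrite mulmx_block !mulmx0 !mul0mx !addr0 !add0r MM NM.
  by rewrite [RHS]l1_block_diag.
by rewrite [LHS]l1_block_diag [l1 _ _]M1 [l1 _ _]N1 -scalar_mx_block.
Qed.

(** Closure under summands speaks of literal block sums only; the complement of a retract produces
    such a sum up to isomorphism. *)
Lemma thick_retract (H : hopf K I) (P : set (rep K I)) M N :
  triangulated_subcat H P ->
  (forall M N, is_module H M -> is_module H N -> P (dsum M N) -> P M /\ P N) ->
  is_module H M -> retract M N -> P N -> P M.
Proof.
move=> tP P_summand mM rMN PN; have mN := tri_module tP PN.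
have [C mC [f [g [hf gf fg]]]] := retract_complement mM mN rMN.
have mD : is_module H (dsum M C).
  split=> [i j|].
    have e : f *m (ract N i *m ract N j) *m g =
        ract (dsum M C) i *m ract (dsum M C) j.
      by rewrite mulmxA hf -!mulmxA (mulmxA f) hf -mulmxA fg mulmx1.
    rewrite -e mN.1 mulmx_sumr mulmx_suml; apply: eq_bigr => k _.
    by rewrite -scalemxAr -scalemxAl hf -mulmxA fg mulmx1.
  rewrite -fg -[f in RHS]mulmx1 -mN.2 mulmx_sumr mulmx_suml.
  apply: eq_bigr => k _; rewrite -scalemxAr -scalemxAl hf -mulmxA fg.
  by rewrite mulmx1.
have PD : P (dsum M C).
  apply: (tri_iso tP mD _ PN); apply: iso_stable; exists f, g; split=> //.
by have [] := P_summand _ _ mM mC PD.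
Qed.

End Thick.

(** [fmap] acts on all linear maps, not only on module maps. Linear splittings are then carried
    along, and exactness is automatic. *)
Record exact_functor (K : fieldType) (I J : finType) (A : algebra K I)
    (B : algebra K J) := ExactFunctor {
  fobj :> rep K I -> rep K J;
  fmap : forall M N, 'M[K]_(rdim N, rdim M) -> 'M[K]_(rdim (fobj N), rdim (fobj M));
  fmap1 : forall M, @fmap M M 1%:M = 1%:M;
  fmapM : forall M N P (f : 'M_(rdim N, rdim M)) (g : 'M_(rdim P, rdim N)),
    fmap (g *m f) = fmap g *m fmap f;
  fmapB : forall M N (f g : 'M_(rdim N, rdim M)), fmap (f - g) = fmap f - fmap g;
  fmap_hom : forall M N (f : 'M_(rdim N, rdim M)), is_hom f -> is_hom (fmap f);
  fobj_module : forall M, is_module A M -> is_module B (fobj M);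
  fobj_projective : forall M, projective A M -> projective B (fobj M)
}.

(** A thick ideal without its tensor condition: preimages under Ind or under tensoring are at first
    only known to be of this kind. *)
Record thick_subcat (K : fieldType) (I : finType) (H : hopf K I)
    (P : set (rep K I)) : Prop := ThickSubcat {
  subcat_tri : triangulated_subcat H P;
  subcat_summand : forall M N, is_module H M -> is_module H N ->
    P (dsum M N) -> P M /\ P N
}.

Section ExactFunctors.
Variables (K : fieldType) (I J : finType) (H : hopf K I) (H' : hopf K J).
Variable F : exact_functor H H'.
Implicit Types M N : rep K I.

Lemma fmap0 M N : fmap F (0 : 'M_(rdim N, rdim M)) = 0.
Proof. by rewrite -(subrr 0) fmapB subrr. Qed.

Lemma fmapN M N (f : 'M_(rdim N, rdim M)) : fmap F (- f) = - fmap F f.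
Proof. by rewrite -sub0r fmapB fmap0 sub0r. Qed.

Lemma fmapD M N (f g : 'M_(rdim N, rdim M)) : fmap F (f + g) = fmap F f + fmap F g.
Proof. by rewrite -{1}[g]opprK fmapB fmapN opprK. Qed.

Lemma retract_fobj M N : retract M N -> retract (F M) (F N).
Proof.
move=> [s [r [hs hr rs]]]; exists (fmap F s), (fmap F r).
by rewrite -fmapM rs fmap1; split=> //; apply: fmap_hom.
Qed.

Lemma iso_fobj M N : iso M N -> iso (F M) (F N).
Proof.
move=> [f [g [hf gf fg]]]; exists (fmap F f), (fmap F g).
by rewrite -!fmapM gf fg !fmap1; split=> //; apply: fmap_hom.
Qed.

Lemma short_exact_fobj M N P (f : 'M_(rdim N, rdim M)) (g : 'M_(rdim P, rdim N)) :
  short_exact f g -> short_exact (fmap F f) (fmap F g).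
Proof.
move=> /short_exactP[hf hg [r [s [rf gs frsg]]]]; apply/short_exactP.
split; try exact: fmap_hom.
exists (fmap F r), (fmap F s).
by rewrite -!fmapM -fmapD rf gs frsg !fmap1.
Qed.

Definition dsum_fobj M N : 'M_(rdim (dsum (F M) (F N)), rdim (F (dsum M N))) :=
  col_mx (fmap F (row_mx 1%:M 0 : 'M_(rdim M, rdim (dsum M N))))
         (fmap F (row_mx 0 1%:M : 'M_(rdim N, rdim (dsum M N)))).

Definition fobj_dsum M N : 'M_(rdim (F (dsum M N)), rdim (dsum (F M) (F N))) :=
  row_mx (fmap F (col_mx 1%:M 0 : 'M_(rdim (dsum M N), rdim M)))
         (fmap F (col_mx 0 1%:M : 'M_(rdim (dsum M N), rdim N))).

Lemma dsum_fobjK M N : fobj_dsum M N *m dsum_fobj M N = 1%:M.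
Proof.
rewrite mul_row_col -!fmapM -fmapD !mul_col_row !mulmx0 !mul0mx !mulmx1.
rewrite add_block_mx !addr0 !add0r -[RHS]fmap1; congr fmap.
by rewrite -scalar_mx_block.
Qed.

Lemma fobj_dsumK M N : dsum_fobj M N *m fobj_dsum M N = 1%:M.
Proof.
rewrite mul_col_row -!fmapM !mul_row_col !mulmx0 !mul0mx !mulmx1 !addr0 !add0r.
by rewrite !fmap0 !fmap1 -scalar_mx_block.
Qed.

Lemma dsum_fobj_hom M N : is_hom (dsum_fobj M N).
Proof.
apply: is_hom_col; apply: fmap_hom; apply: is_hom_row;
  by [exact: is_hom1|exact: is_hom0].
Qed.

Lemma fobj_dsum_iso M N : iso (F (dsum M N)) (dsum (F M) (F N)).
Proof.
exists (dsum_fobj M N), (fobj_dsum M N).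
by rewrite dsum_fobjK fobj_dsumK; split=> //; exact: dsum_fobj_hom.
Qed.

Variable P : set (rep K J).
Hypothesis thP : thick_subcat H' P.
Let tP := subcat_tri thP.
Let P_retract (M N : rep K J) : is_module H' M -> retract M N -> P N -> P M.
Proof. by apply: thick_retract => //; exact: subcat_summand thP. Qed.

Lemma fobj_stable_eq M N (f g : 'M_(rdim N, rdim M)) :
  stable_eq H f g -> stable_eq H' (fmap F f) (fmap F g).
Proof.
move=> [Q [a [b [pQ ha hb fg]]]]; exists (F Q), (fmap F a), (fmap F b).
rewrite -fmapB fg fmapM; split=> //; try exact: fmap_hom.
exact: fobj_projective.
Qed.

Lemma fobj_suspension M Q S (i : 'M[K]_(rdim Q, rdim M)) (q : 'M[K]_(rdim S, rdim Q)) :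
  suspension H i q -> suspension H' (fmap F i) (fmap F q).
Proof.
move=> [mM pQ mS ex]; split; try exact: fobj_module.
  exact: fobj_projective.
exact: short_exact_fobj.
Qed.

(** The functor sends the cokernel sequence of (i, f) to a sequence through F(Q (+) N). Conjugating
    by the canonical isomorphism with FQ (+) FN gives the sequence that defines the image
    triangle. *)
Lemma fobj_triangle M N C S (f : 'M[K]_(rdim N, rdim M))
    (g : 'M[K]_(rdim C, rdim N)) (h : 'M[K]_(rdim S, rdim C)) :
  standard_triangle H f g h ->
  standard_triangle H' (fmap F f) (fmap F g) (fmap F h).
Proof.
move=> [Q [i [q [j [susp [mN mC] hh ex [hj hg]]]]]].
exists (F Q), (fmap F i), (fmap F q), (fmap F j); split.
- exact: fobj_suspension.
- by split; apply: fobj_module.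
- exact: fmap_hom.
- have /short_exactP[he hr [r [s [r1 s1 rs]]]] := short_exact_fobj ex.
  have e1 : col_mx (fmap F i) (fmap F f) = dsum_fobj Q N *m fmap F (col_mx i f : 'M_(rdim (dsum Q N), _)).
    rewrite mul_col_mx -!fmapM !mul_row_col.
    by rewrite !mul1mx !mul0mx addr0 add0r.
  have e2 : row_mx (fmap F j) (- fmap F g) = fmap F (row_mx j (- g) : 'M_(_, rdim (dsum Q N))) *m fobj_dsum Q N.
    rewrite mul_mx_row -!fmapM !mul_row_col.
    by rewrite !mulmx1 !mulmx0 addr0 add0r fmapN.
  apply/short_exactP; rewrite e1 e2; split.
  - apply: is_hom_mul => //; exact: dsum_fobj_hom.
  - apply: is_hom_mul => //.
    exact: is_hom_inv (dsum_fobj_hom _ _) (dsum_fobjK _ _) (fobj_dsumK _ _).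
  exists (r *m fobj_dsum Q N), (dsum_fobj Q N *m s); split.
  - by rewrite mulmxA -(mulmxA r) dsum_fobjK mulmx1.
  - by rewrite mulmxA -(mulmxA _ (fobj_dsum Q N)) dsum_fobjK mulmx1.
  - rewrite -!mulmxA -mulmxDr !mulmxA -mulmxDl rs mul1mx.
    exact: fobj_dsumK.
- by rewrite -!fmapM hj hg fmap0.
Qed.

(** Exactness and preservation of projectives make F commute with cosyzygies, cones and stable
    isomorphisms. Zero and direct sums are preserved only up to isomorphism, whence the appeals to
    closure under retracts. *)
Lemma preimage_thick_subcat :
  thick_subcat H [set M | is_module H M /\ P (F M)]%classic.
Proof.
split; first split.
- by move=> M [].
- move=> M N mN [f [g [hf hg gf fg]]] [mM PM]; split=> //.
  apply: (tri_iso tP _ _ PM); first exact: fobj_module.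
  exists (fmap F f), (fmap F g); split; try exact: fmap_hom.
    by rewrite -fmapM -(fmap1 F); exact: fobj_stable_eq.
  by rewrite -fmapM -(fmap1 F); exact: fobj_stable_eq.
- split; first exact: rep0_module.
  apply: P_retract (tri_zero tP); first exact/fobj_module/rep0_module.
  exists 0, 0; split; try exact: is_hom0.
  rewrite mulmx0 -[RHS]fmap1 -[LHS](fmap0 (rep0 K I) (rep0 K I)); congr fmap.
  by apply/matrixP => -[].
- move=> M N [mM PM] [mN PN]; split.
    exact: dsum_module.
  apply: P_retract (tri_dsum tP PM PN); last exact/iso_retract/fobj_dsum_iso.
  exact/fobj_module/dsum_module.
- move=> M Q S i q susp; have [mM _ mS _] := susp.
  have := tri_shift tP (fobj_suspension susp).
  by split=> -[_ ?]; split=> //; tauto.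
- move=> M N C S f g h tri [mM PM] [mN PN].
  split; first by have [? [? [? [? [_ []]]]]] := tri.
  exact: (tri_cone tP (fobj_triangle tri)).
move=> M N mM mN [mMN PMN]; split; split=> //.
  apply: P_retract PMN; first exact: fobj_module.
  apply: retract_fobj; exists (col_mx 1%:M 0), (row_mx 1%:M 0).
  rewrite mul_row_col mulmx1 mulmx0 addr0; split=> //.
    by apply: is_hom_col; [exact: is_hom1|exact: is_hom0].
  by apply: is_hom_row; [exact: is_hom1|exact: is_hom0].
apply: P_retract PMN; first exact: fobj_module.
apply: retract_fobj; exists (col_mx 0 1%:M), (row_mx 0 1%:M).
rewrite mul_row_col mulmx1 mulmx0 add0r; split=> //.
  by apply: is_hom_col; [exact: is_hom0|exact: is_hom1].
by apply: is_hom_row; [exact: is_hom0|exact: is_hom1].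
Qed.

End ExactFunctors.

(** * Projective modules and tensor products *)

Section BlockVectors.
Variables (K : fieldType) (I : finType).

(** The space K^I (x) V is a sum of copies of V indexed by [I]. [bcol] assembles a map into it from
    its components, [brow] a map out of it; [bin] and [bpr] below are the inclusions and projections
    of the copies. *)
Definition bcol m n (A : I -> 'M[K]_(m, n)) : 'M_(#|I| * m, n) :=
  \matrix_(p, q) A (enum_val (mxtens_unindex p).1) (mxtens_unindex p).2 q.

Definition brow m n (A : I -> 'M[K]_(m, n)) : 'M_(m, #|I| * n) :=
  \matrix_(p, q) A (enum_val (mxtens_unindex q).1) p (mxtens_unindex q).2.

Lemma eq_bcol m n (A B : I -> 'M[K]_(m, n)) : (forall i, A i = B i) -> bcol A = bcol B.
Proof. by move=> AB; apply/matrixP => p q; rewrite !mxE AB. Qed.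

Lemma eq_brow m n (A B : I -> 'M[K]_(m, n)) : (forall i, A i = B i) -> brow A = brow B.
Proof. by move=> AB; apply/matrixP => p q; rewrite !mxE AB. Qed.

Lemma mul_brow m n p (C : 'M_(p, m)) (A : I -> 'M[K]_(m, n)) :
  C *m brow A = brow (fun i => C *m A i).
Proof. by apply/matrixP => i j; rewrite !mxE; apply: eq_bigr => k _; rewrite !mxE. Qed.

Lemma bcol_mul m n p (C : 'M_(n, p)) (A : I -> 'M[K]_(m, n)) :
  bcol A *m C = bcol (fun i => A i *m C).
Proof. by apply/matrixP => i j; rewrite !mxE; apply: eq_bigr => k _; rewrite !mxE. Qed.

Lemma brow_bcol m n p (A : I -> 'M[K]_(m, n)) (B : I -> 'M[K]_(n, p)) :
  brow A *m bcol B = \sum_i A i *m B i.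
Proof.
apply/matrixP => i j; rewrite !mxE summxE.
transitivity (\sum_(a < #|I|) \sum_k A (enum_val a) i k * B (enum_val a) k j).
  rewrite pair_bigA (reindex (@mxtens_index _ _)) /=.
    by apply: eq_bigr => -[a k] _; rewrite !mxE !mxtens_indexK.
  by exists (@mxtens_unindex _ _) => x _; rewrite (mxtens_indexK, mxtens_unindexK).
rewrite [RHS](reindex (@enum_val I predT)) /=.
  by apply: eq_bigr => a _; rewrite !mxE.
by exists enum_rank => x _; rewrite (enum_rankK, enum_valK).
Qed.

Lemma tens_bcol_brow m n f (C : 'M[K]_(m, n)) :
  mxI f *t C = bcol (fun k => brow (fun j => f k j *: C)).
Proof. by apply/matrixP => i j; rewrite !mxE. Qed.

Lemma brow_tens m n p f (A : I -> 'M[K]_(p, m)) (C : 'M[K]_(m, n)) :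
  brow A *m (mxI f *t C) = brow (fun j => l1 (f^~ j) (fun k => A k *m C)).
Proof.
rewrite tens_bcol_brow brow_bcol; apply/matrixP => i j.
rewrite summxE mxE /l1 summxE; apply: eq_bigr => k _.
by rewrite mul_brow !mxE mulr_sumr; apply: eq_bigr => l _; rewrite !mxE mulrCA.
Qed.

Lemma tens_bcol m n p f (A : I -> 'M[K]_(n, p)) (C : 'M[K]_(m, n)) :
  (mxI f *t C) *m bcol A = bcol (fun k => l1 (f k) (fun j => C *m A j)).
Proof.
rewrite tens_bcol_brow bcol_mul; apply: eq_bcol => k.
by rewrite brow_bcol; apply: eq_bigr => j _; rewrite -scalemxAl.
Qed.

Lemma brow_l1 m n (A : finType) (c : A -> K) (F : A -> I -> 'M[K]_(m, n)) :
  brow (fun i => l1 c (F^~ i)) = l1 c (fun a => brow (F a)).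
Proof.
by apply/matrixP => i j; rewrite mxE /l1 !summxE; apply: eq_bigr => a _; rewrite !mxE.
Qed.

Lemma bcol_l1 m n (A : finType) (c : A -> K) (F : A -> I -> 'M[K]_(m, n)) :
  bcol (fun i => l1 c (F^~ i)) = l1 c (fun a => bcol (F a)).
Proof.
by apply/matrixP => i j; rewrite mxE /l1 !summxE; apply: eq_bigr => a _; rewrite !mxE.
Qed.

Lemma brow_l2 m n (A B : finType) (c : A -> B -> K) (F : A -> B -> I -> 'M[K]_(m, n)) :
  brow (fun i => l2 c (fun a b => F a b i)) = l2 c (fun a b => brow (F a b)).
Proof.
rewrite l2E -brow_l1; apply: eq_brow => i; exact: l2E.
Qed.

Lemma bcol_l2 m n (A B : finType) (c : A -> B -> K) (F : A -> B -> I -> 'M[K]_(m, n)) :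
  bcol (fun i => l2 c (fun a b => F a b i)) = l2 c (fun a b => bcol (F a b)).
Proof.
rewrite l2E -bcol_l1; apply: eq_bcol => i; exact: l2E.
Qed.

Definition bpr m k : 'M_(m, #|I| * m) := brow (fun j => (k == j)%:R *: 1%:M).
Definition bin m k : 'M_(#|I| * m, m) := bcol (fun j => (k == j)%:R *: 1%:M).

Lemma bpr_bcol m n k (A : I -> 'M[K]_(m, n)) : bpr m k *m bcol A = A k.
Proof.
rewrite brow_bcol -[RHS](l1_delta k); apply: eq_bigr => j _.
by rewrite -scalemxAl mul1mx.
Qed.

Lemma mxI1 : mxI (fun i j : I => (i == j)%:R) = 1%:M :> 'M[K]_#|I|.
Proof. by apply/matrixP => i j; rewrite !mxE (inj_eq enum_val_inj). Qed.

Lemma browE m n (A : I -> 'M[K]_(m, n)) : brow A = \sum_k A k *m bpr n k.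
Proof.
rewrite -[LHS]mulmx1 -tensmx11 -mxI1 tens_bcol_brow brow_bcol.
by apply: eq_bigr => k _.
Qed.

End BlockVectors.

(** * Projectivity through sections of the action map *)

Section ProjectiveBasis.
Variables (K : fieldType) (I : finType) (A : algebra K I).
Implicit Types M N : rep K I.

Definition free_rep m : rep K I := Rep (fun i => regL A i *t (1%:M : 'M_m)).

Lemma free_rep_module m : is_algebra A -> is_module A (free_rep m).
Proof.
move=> A_alg; split=> [i j|] /=.
  by rewrite tensmx_mul mulmx1 (regLM A_alg) l1_tensl.
by rewrite -[LHS](l1_tensl _ (regL A)) (regL1 A_alg) tensmx11.
Qed.

(** The [s i] are the components of a map M -> A (x) M, m |-> sum of e_i (x) s_i(m). The first
    condition is its A-linearity, tested on functionals, and the second says that it is a section of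
    the action map. *)
Definition is_proj_basis M (s : I -> 'M_(rdim M)) : Prop :=
  (forall F j, l1 F s *m ract M j = l1 (fun i => l1 (amul A j i) (F : I -> K^o)) s) /\
  \sum_i ract M i *m s i = 1%:M.

Arguments is_proj_basis M s : clear implicits.

(** A linear section [t] of [g] is averaged: the sum of the e_i t f s_i is A-linear and still lifts
    [f]. *)
Lemma proj_basis_projective M s :
  is_module A M -> is_proj_basis M s -> projective A M.
Proof.
move=> mM [s_lin s1]; split=> // X Y g f mX mY hg hf /mx_surjP[t gt].
have s_lin' k j : s k *m ract M j = l1 (fun i => amul A j i k) s.
  rewrite -[s k](l1_delta k s) s_lin; apply: eq_bigr => i _; congr (_ *: _).
  rewrite -[RHS](l1_deltar _ k); apply: eq_bigr => x _.
  by rewrite eq_sym.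
exists (\sum_i ract X i *m t *m f *m s i) => [j|].
  rewrite mulmx_suml mulmx_sumr.
  transitivity (\sum_i \sum_k amul A j k i *: (ract X i *m t *m f *m s k)).
    apply: eq_bigr => i _; rewrite -mulmxA s_lin' mulmx_sumr.
    by apply: eq_bigr => k _; rewrite -scalemxAr.
  rewrite exchange_big; apply: eq_bigr => k _.
  rewrite !mulmxA mX.1 !mulmx_suml; apply: eq_bigr => i _.
  by rewrite !scalemxAl.
rewrite mulmx_sumr -[RHS]mulmx1 -s1 mulmx_sumr; apply: eq_bigr => i _.
by rewrite !mulmxA hg -(mulmxA _ g) gt mulmx1 hf.
Qed.

Lemma free_rep_cover M : is_module A M ->
  @is_hom K I (free_rep (rdim M)) M (brow (ract M)) /\ mx_surj (brow (ract M)).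
Proof.
move=> mM; split=> [i|].
  rewrite brow_tens mul_brow; apply: eq_brow => j.
  by rewrite mM.1; apply: eq_bigr => k _; rewrite mulmx1.
apply/mx_surjP; exists (bcol (fun a => aone A a *: 1%:M)).
rewrite brow_bcol -[RHS]mM.2; apply: eq_bigr => a _.
by rewrite -scalemxAr mulmx1.
Qed.

(** Lift the identity of [M] through the action map from the free module A (x) M. *)
Lemma projective_proj_basis M : is_algebra A -> projective A M ->
  exists s : I -> 'M_(rdim M), is_proj_basis M s.
Proof.
move=> A_alg [mM M_lift]; have [hc c_surj] := free_rep_cover mM.
have [sec hsec csec] := M_lift _ _ _ 1%:M (free_rep_module _ A_alg) mM hc (@is_hom1 _ _ M) c_surj.
exists (fun k => bpr K _ k *m sec); split=> [F j|]; last first.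
  rewrite -csec browE mulmx_suml; apply: eq_bigr => i _; exact: mulmxA.
have e1 G : l1 G (@bpr K I (rdim M)) = brow (fun k => G k *: 1%:M).
  rewrite -brow_l1; apply: eq_brow => k.
  by rewrite -[G k](l1_deltar G k) l1_scal.
have e G : l1 G (fun k => bpr K _ k *m sec) = brow (fun k => G k *: 1%:M) *m sec.
  by rewrite -e1 l1_mulmxl.
rewrite e [RHS]e -mulmxA (hsec j) mulmxA; congr (_ *m _).
rewrite brow_tens; apply: eq_brow => k; rewrite l1_scal.
by apply: eq_l1 => a; rewrite mulmx1.
Qed.

End ProjectiveBasis.

Arguments is_proj_basis {K I} A M s.

(** * Twists by two commuting actions *)

Section Twist.
Variables (K : fieldType) (I : finType) (H : hopf K I).
Hypothesis H_hopf : is_hopf H.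
Let H_bi := hopf_bialgebra H_hopf.
Let H_alg : is_algebra H. Proof. by case: H_bi. Qed.
Let H_coalg : is_coalgebra H. Proof. by case: H_bi. Qed.

(* h acts on V (x) M by l(h_1) r(h_3) (x) h_2. *)
Definition twist d (l r : I -> 'M[K]_d) (M : rep K I) : rep K I :=
  Rep (fun i => l2 (comul H i) (fun a c => l2 (comul H a) (fun p q =>
    (l p *m r c) *t ract M q))).

Variables (d : nat) (l r : I -> 'M[K]_d).
Hypotheses (l_mod : is_module H (Rep l)) (r_mod : is_module H (Rep r)).
Hypothesis lr : forall i j, r j *m l i = l i *m r j.

Let lM i j : l i *m l j = l1 (amul H i j) l. Proof. exact: l_mod.1. Qed.
Let rM i j : r i *m r j = l1 (amul H i j) r. Proof. exact: r_mod.1. Qed.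
Let l_1 : l1 (aone H) l = 1%:M. Proof. exact: l_mod.2. Qed.
Let r_1 : l1 (aone H) r = 1%:M. Proof. exact: r_mod.2. Qed.

Variable M : rep K I.

(** As [l] and [r] commute, l(h_1) r(h_3) l(h'_1) r(h'_3) regroups into l(h_1 h'_1) r(h_3 h'_3). *)
Lemma twist_module : is_module H M -> is_module H (twist l r M).
Proof.
move=> mM.
pose rho := ract M.
have rhoM i j : rho i *m rho j = l1 (amul H i j) rho by exact: mM.1.
split=> [i j|]; last first.
  rewrite -[LHS]/(l1 _ _) /= (comul1 H_bi) l11C.
  under eq_l1 => b do rewrite (comul1 H_bi).
  transitivity (l1 (aone H) (fun c => l1 (aone H) (fun q => (l1 (aone H) l *m r c) *t rho q))).
    apply: eq_l1 => c; rewrite l11C; apply: eq_l1 => q.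
    by rewrite l1_mulmxl l1_tensl.
  transitivity (l1 (aone H) (fun c => (1%:M *m r c) *t l1 (aone H) rho)).
    by apply: eq_l1 => c; rewrite l1_tensr l_1.
  rewrite -l1_tensl -l1_mulmxr r_1 mulmx1.
  by rewrite (_ : l1 _ rho = 1%:M) ?tensmx11 //; exact: mM.2.
rewrite /= -[RHS]/(l1 _ _) /= (comulM H_bi) l2_mulmxl; apply: eq_l2 => a c.
rewrite l2_mulmxr; apply: eq_l2 => a' c'.
rewrite l11C.
under [RHS]eq_l1 => y do rewrite (comulM H_bi a a').
rewrite -l21C l2_mulmxl; apply: eq_l2 => p q.
rewrite -l21C l2_mulmxr; apply: eq_l2 => p' q'.
transitivity (l1 (amul H c c') (fun y => (l p *m l p' *m r y) *t (rho q *m rho q'))).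
  have e : (l p *m r c) *m (l p' *m r c') = l p *m l p' *m (r c *m r c').
    by rewrite mulmxA -(mulmxA (l p)) lr !mulmxA.
  by rewrite tensmx_mul e rM l1_mulmxr l1_tensl.
apply: eq_l1 => y; rewrite lM l1_mulmxl l1_tensl; apply: eq_l1 => x.
by rewrite rhoM l1_tensr.
Qed.

Hypothesis S_unit :
  (\matrix_(a < #|I|, b < #|I|) antipode H (enum_val a) (enum_val b)) \in unitmx.

Let tl i := l1 (antipodeV H i) l.
Let sr i := l1 (antipode H i) r.

Let tlM i j : l1 (amul H i j) tl = tl j *m tl i.
Proof.
rewrite (antipodeVM H_hopf S_unit) l1_mulmxl; apply: eq_l1 => a.
by rewrite l1_mulmxr; apply: eq_l1 => b; rewrite lM.
Qed.

Let srM i j : l1 (amul H i j) sr = sr j *m sr i.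
Proof.
rewrite (antipodeM H_hopf) l1_mulmxl; apply: eq_l1 => a.
by rewrite l1_mulmxr; apply: eq_l1 => b; rewrite rM.
Qed.

Let tll i : l2 (comul H i) (fun a b => tl b *m l a) = counit H i *: 1%:M.
Proof.
rewrite -l_1 -(antipodeVL H_hopf S_unit); apply: eq_l2 => a b.
by rewrite l1_mulmxl; apply: eq_l1 => x; rewrite lM.
Qed.

Let srr i : l2 (comul H i) (fun a b => sr a *m r b) = counit H i *: 1%:M.
Proof.
rewrite -r_1 -(antipodeL H_hopf); apply: eq_l2 => a b.
by rewrite l1_mulmxl; apply: eq_l1 => x; rewrite rM.
Qed.

Let ltl i : l2 (comul H i) (fun a b => l b *m tl a) = counit H i *: 1%:M.
Proof.
rewrite -l_1 -(antipodeVR H_hopf S_unit); apply: eq_l2 => a b.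
by rewrite l1_mulmxr; apply: eq_l1 => x; rewrite lM.
Qed.

Let rsr i : l2 (comul H i) (fun a b => r a *m sr b) = counit H i *: 1%:M.
Proof.
rewrite -r_1 -(antipodeR H_hopf); apply: eq_l2 => a b.
by rewrite l1_mulmxr; apply: eq_l1 => x; rewrite rM.
Qed.

Let lsr i j : sr j *m l i = l i *m sr j.
Proof. by rewrite l1_mulmxl l1_mulmxr; apply: eq_l1 => x; rewrite lr. Qed.

Let tlsr i j : sr j *m tl i = tl i *m sr j.
Proof.
rewrite (l1_mulmxr _ _ (sr j)) (l1_mulmxl _ _ (sr j)).
by apply: eq_l1 => x; rewrite lsr.
Qed.

Let rtl i j : r j *m tl i = tl i *m r j.
Proof. by rewrite l1_mulmxl l1_mulmxr; apply: eq_l1 => x; rewrite lr. Qed.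

(** With the five legs of e_j in order, [A] takes the first two, [g] the middle one and [B] the last
    two. Coassociativity brings each outer pair together, and both contract to counits. *)
Let collapse m n (A B : I -> I -> 'M[K]_d) (g : I -> 'M[K]_(m, n)) j :
  (forall i, l2 (comul H i) A = counit H i *: 1%:M) ->
  (forall i, l2 (comul H i) B = counit H i *: 1%:M) ->
  l2 (comul H j) (fun a' c' => l2 (comul H a') (fun p' q' =>
    l2 (comul H q') (fun a1 c1 => l2 (comul H a1) (fun p1 q1 =>
      (A p' p1 *m B c1 c') *t g q1)))) = 1%:M *t g j.
Proof.
move=> A1 B1.
transitivity (l2 (comul H j) (fun a' c' => l2 (comul H a') (fun q1 c1 =>
    B c1 c' *t g q1))).
  apply: eq_l2 => a' c'.
  under eq_l2 => p' q' do rewrite (comulA H_coalg).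
  rewrite -(comulA H_coalg a' (fun p' p1 w => l2 (comul H w) (fun q1 c1 =>
     (A p' p1 *m B c1 c') *t g q1))).
  transitivity (l2 (comul H a') (fun v w => counit H v *: l2 (comul H w) (fun q1 c1 =>
     B c1 c' *t g q1))).
    apply: eq_l2 => v w; rewrite l22C l2Z; apply: eq_l2 => q1 c1.
    by rewrite -l2_tensl -l2_mulmxl A1 -scalemxAl mul1mx tensmxZl.
  by rewrite (comul1l H_coalg a' (fun w => l2 (comul H w) _)).
rewrite (comulA H_coalg j (fun q1 c1 c' => B c1 c' *t g q1)).
under eq_l2 => q w do rewrite -l2_tensl B1 tensmxZl.
by rewrite (comul1r H_coalg).
Qed.

(** If M has the section m |-> sum of e_i (x) s_i(m), the twist has v (x) m |-> sum of h_2 (x)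
    l(S^-1(h_1)) r(S(h_3)) v (x) s_i(m) with h = e_i: the inverse antipode and the antipode undo the
    two actions on V. *)
Definition twist_basis (s : I -> 'M_(rdim M)) k : 'M_(rdim (twist l r M)) :=
  \sum_i l2 (comul H i) (fun a c => l2 (comul H a) (fun p q =>
    (q == k)%:R *: ((tl p *m sr c) *t s i))).

Let sum1 (A : finType) (V : lmodType K) (F : A -> V) : \sum_a F a = l1 (fun _ => 1) F.
Proof. by apply: eq_bigr => a _; rewrite scale1r. Qed.

Let twist_basisE s (F : I -> K) : l1 F (twist_basis s) =
  \sum_i l2 (comul H i) (fun a c => l2 (comul H a) (fun p q =>
    F q *: ((tl p *m sr c) *t s i))).
Proof.
rewrite sum1 /twist_basis; under eq_l1 do rewrite sum1.
rewrite l11C; apply: eq_l1 => i; rewrite l12C; apply: eq_l2 => a c.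
rewrite l12C; apply: eq_l2 => p q.
rewrite -l1_scal; congr (_ *: _); rewrite -[RHS]l1_deltar.
by apply: eq_bigr => k _; rewrite eq_sym.
Qed.

Lemma twist_proj_basis s : is_module H M -> is_proj_basis H M s ->
  is_proj_basis H (twist l r M) (twist_basis s).
Proof.
move=> mM [s_lin s1]; pose rho := ract M.
have s_lin' k j : s k *m rho j = l1 (fun i => amul H j i k) s.
  rewrite -[s k](l1_delta k s) s_lin; apply: eq_bigr => i _; congr (_ *: _).
  rewrite -[RHS](l1_deltar _ k); apply: eq_bigr => x _.
  by rewrite eq_sym.
split=> [F j|].
  rewrite twist_basisE.
  transitivity (l2 (comul H j) (fun a' c' => l2 (comul H a') (fun p' q' =>
     \sum_i l2 (comul H i) (fun a c => l2 (comul H a) (fun p q =>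
       F q *: ((tl p *m sr c *m l p' *m r c') *t (s i *m rho q'))))))).
    rewrite /= l2_mulmxr; apply: eq_l2 => a' c'.
    rewrite l2_mulmxr; apply: eq_l2 => p' q'.
    rewrite mulmx_suml; apply: eq_bigr => i _.
    rewrite l2_mulmxl; apply: eq_l2 => a c.
    rewrite l2_mulmxl; apply: eq_l2 => p q.
    by rewrite -scalemxAl tensmx_mul mulmxA.
  transitivity (l2 (comul H j) (fun a' c' => l2 (comul H a') (fun p' q' =>
     \sum_x l1 (amul H q' x) (fun i => l2 (comul H i) (fun a c => l2 (comul H a) (fun p q =>
       F q *: ((tl p *m sr c *m l p' *m r c') *t s x))))))).
    apply: eq_l2 => a' c'; apply: eq_l2 => p' q'.
    rewrite /l1 [RHS]exchange_big /= -/l1; apply: eq_bigr => i _.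
    under eq_l2 => a c do under eq_l2 => p q do rewrite s_lin' l1_tensr l1Z.
    under eq_l2 => a c do rewrite l21C.
    by rewrite l21C.
  under eq_l2 => a' c' do under eq_l2 => p' q' do rewrite sum1.
  under eq_l2 => a' c' do rewrite l21C.
  rewrite l21C; apply: etrans (esym (twist_basisE s (fun i => l1 (amul H j i) (F : I -> K^o)))).
  rewrite sum1; apply: eq_l1 => x.
  (* The left factor involves only legs of e_x, so it can be pulled out; the legs of e_j that remain
     have the shape required by [collapse]. *)
  pose W p' c' p1 q1 c1 p2 q2 c2 := ((tl p2 *m sr c2) *t 1%:M) *m
    ((tl p1 *m l p' *m (sr c1 *m r c')) *t (l1 (amul H q1 q2) (F : I -> K^o) *: s x)).
  transitivity (l2 (comul H j) (fun a' c' => l2 (comul H a') (fun p' q' =>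
      l2 (comul H x) (fun a2 c2 => l2 (comul H a2) (fun p2 q2 =>
       l2 (comul H q') (fun a1 c1 => l2 (comul H a1) (fun p1 q1 =>
        W p' c' p1 q1 c1 p2 q2 c2))))))).
    apply: eq_l2 => a' c'; apply: eq_l2 => p' q'.
    rewrite (comulM H_bi).
    under [RHS]eq_l2 => a2 c2 do rewrite l22C.
    rewrite l22C; apply: eq_l2 => a2 c2; apply: eq_l2 => a1 c1.
    rewrite l11C; under eq_l1 => c do rewrite (comulM H_bi).
    rewrite -l21C [RHS]l22C; apply: eq_l2 => p1 q1.
    rewrite -l21C; apply: eq_l2 => p2 q2.
    transitivity (l1 (amul H c1 c2) (fun c => l1 (amul H q1 q2) (F : I -> K^o) *:
        ((tl p2 *m tl p1 *m sr c *m l p' *m r c') *t s x))).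
      apply: eq_l1 => c; rewrite l11C l1_scal; apply: eq_l1 => q.
      by rewrite -tlM -l1Z !l1_mulmxl l1_tensl.
    rewrite /W tensmx_mul mul1mx -l1Z tensmxZr; congr (_ *: _).
    rewrite -l1_tensl; congr (_ *t _).
    rewrite -l1_mulmxl -l1_mulmxl -l1_mulmxr srM -!mulmxA; congr (_ *m _).
    rewrite (mulmxA (sr c1) (l p')) lsr -(mulmxA (l p')).
    by rewrite [RHS](mulmxA (sr c2) (tl p1)) tlsr -[RHS](mulmxA (tl p1)).
  under eq_l2 => a' c' do rewrite l22C.
  rewrite l22C; apply: eq_l2 => a2 c2.
  under eq_l2 => a' c' do rewrite l22C.
  rewrite l22C; apply: eq_l2 => p2 q2.
  under eq_l2 => a' c' do under eq_l2 => p' q' do under eq_l2 => a1 c1 do rewrite -l2_mulmxr.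
  under eq_l2 => a' c' do under eq_l2 => p' q' do rewrite -l2_mulmxr.
  under eq_l2 => a' c' do rewrite -l2_mulmxr.
  rewrite -l2_mulmxr (collapse (fun q1 => l1 (amul H q1 q2) (F : I -> K^o) *: s x) j tll srr).
  by rewrite tensmx_mul mul1mx mulmx1 tensmxZr.
transitivity (\sum_i (1%:M : 'M_d) *t (rho i *m s i)); last first.
  by rewrite -(linear_sum (tensmx _)) s1; exact: tensmx11.
rewrite sum1; under eq_l1 do rewrite mulmx_sumr sum1.
rewrite l11C [RHS]sum1; apply: eq_l1 => i.
rewrite -(collapse (fun q => rho q *m s i) i ltl rsr).
under eq_l1 do rewrite l2_mulmxr.
rewrite l12C; apply: eq_l2 => a c.
under eq_l1 do rewrite l2_mulmxr.
rewrite l12C; apply: eq_l2 => p q.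
transitivity (ract (twist l r M) q *m ((tl p *m sr c) *t s i)).
  rewrite -[RHS](l1_delta q (fun q => ract (twist l r M) q *m ((tl p *m sr c) *t s i))).
  by apply: eq_bigr => k _; rewrite scale1r -scalemxAr.
rewrite l2_mulmxl; apply: eq_l2 => a' c'.
rewrite l2_mulmxl; apply: eq_l2 => p' q'.
rewrite tensmx_mul -!mulmxA; congr ((_ *m _) *t _).
by rewrite (mulmxA (r c')) rtl -mulmxA.
Qed.

End Twist.

(** * Flip, associativity and unit for Kronecker products *)

Section Flip.
Variable K : fieldType.

Definition flip_idx m n (i : 'I_(m * n)) : 'I_(n * m) :=
  mxtens_index ((mxtens_unindex i).2, (mxtens_unindex i).1).

Lemma flip_idxK m n : cancel (@flip_idx m n) (@flip_idx n m).
Proof.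
by move=> i; rewrite /flip_idx mxtens_indexK -[RHS]mxtens_unindexK.

Qed.

Definition flip_mx m n : 'M[K]_(m * n, n * m) :=
  \matrix_(i, j) (j == flip_idx i)%:R.

Lemma flip_mxl m n p (X : 'M[K]_(n * m, p)) i j :
  (flip_mx m n *m X) i j = X (flip_idx i) j.
Proof.
rewrite mxE (bigD1 (flip_idx i)) //= mxE eqxx mul1r big1 ?addr0 // => k ki.
by rewrite mxE (negbTE ki) mul0r.
Qed.

Lemma flip_mxr m n p (X : 'M[K]_(p, m * n)) i j :
  (X *m flip_mx m n) i j = X i (flip_idx j).
Proof.
rewrite mxE (bigD1 (flip_idx j)) //= mxE flip_idxK eqxx mulr1 big1 ?addr0 // => k.
rewrite mxE; case: (j =P flip_idx k) => [->|_ _]; last by rewrite mulr0.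
by rewrite flip_idxK eqxx.
Qed.

Lemma flip_mxK m n : flip_mx m n *m flip_mx n m = 1%:M.
Proof. by apply/matrixP => i j; rewrite flip_mxl !mxE flip_idxK eq_sym. Qed.

Lemma flip_tens m n p q (A : 'M[K]_(m, p)) (B : 'M[K]_(n, q)) :
  flip_mx n m *m (A *t B) = (B *t A) *m flip_mx q p.
Proof.
apply/matrixP => i j; rewrite flip_mxl flip_mxr !mxE !mxtens_indexK /=.
exact: mulrC.
Qed.

Lemma castmx_conj m n (e : m = n) : exists (P : 'M[K]_(n, m)) (Q : 'M[K]_(m, n)),
  [/\ P *m Q = 1%:M, Q *m P = 1%:M & forall A, castmx (e, e) A = P *m A *m Q].
Proof.
by case: n / e; exists 1%:M, 1%:M; split; rewrite ?mulmx1 // => A; rewrite mul1mx mulmx1.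
Qed.

(** The two bracketings differ by a cast of dimensions. One invertible matrix that serves for all A,
    B, C at once yields a module isomorphism by linearity. *)
Lemma tensA_conj m n p : exists (P : 'M[K]_(m * (n * p), m * n * p)) Q,
  [/\ P *m Q = 1%:M, Q *m P = 1%:M &
    forall (A : 'M_m) (B : 'M_n) (C : 'M_p), P *m (A *t B *t C) = (A *t (B *t C)) *m P].
Proof.
have [P [Q [PQ QP PE]]] := castmx_conj (esym (mulnA m n p)).
exists P, Q; split=> // A B C.
have -> : A *t (B *t C) = castmx (esym (mulnA m n p), esym (mulnA m n p)) (A *t B *t C).
  apply/matrixP => i j; rewrite castmxE.
  case: (mxtens_indexP i) => i1 i23; case: (mxtens_indexP i23) => i2 i3.
  case: (mxtens_indexP j) => j1 j23; case: (mxtens_indexP j23) => j2 j3.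
  have e k1 (k2 : 'I_n) (k3 : 'I_p) : cast_ord (esym (esym (mulnA m n p)))
      (mxtens_index (k1, mxtens_index (k2, k3))) =
      mxtens_index (mxtens_index (k1, k2), k3).
    by apply: val_inj; rewrite /= mulnA mulnDl addnA.
  by rewrite !e !tensmxE mulrA.
by rewrite PE -[RHS]mulmxA QP mulmx1.
Qed.

Lemma tens1_conj m : exists (P : 'M[K]_(m, m * 1)) Q,
  [/\ P *m Q = 1%:M, Q *m P = 1%:M &
    forall (A : 'M_m), P *m (A *t (1%:M : 'M_1)) = A *m P].
Proof.
have [P [Q [PQ QP PE]]] := castmx_conj (muln1 m).
exists P, Q; split=> // A.
have -> : P *m (A *t (1%:M : 'M_1)) = P *m (A *t 1%:M) *m Q *m P.
  by rewrite -mulmxA QP mulmx1.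
rewrite -PE; congr (_ *m _).
by rewrite tens_mx_scalar scale1r castmx_comp castmx_id.
Qed.

End Flip.

Section TensUnit.
Variables (K : fieldType) (I : finType) (H : hopf K I).

Definition triv_rep d : rep K I := Rep (fun i => counit H i *: 1%:M : 'M_d).

Lemma tens_unit_iso M :
  (forall i j, \sum_k comul H i j k * counit H k = (i == j)%:R) ->
  iso (tens H M (triv_rep 1)) M.
Proof.
move=> c1; have [P [Q [PQ QP PE]]] := tens1_conj K (rdim M).
exists P, Q; split=> // i; rewrite -PE; congr (_ *m _) => /=.
rewrite -[ract M i](l1_delta i) l1_tensl; apply: eq_bigr => j _.
rewrite -c1 scaler_suml; apply: eq_bigr => k _.
by rewrite -scalerA tensmxZr.
Qed.

End TensUnit.

Section Tens.
Variables (K : fieldType) (I : finType) (H : hopf K I).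
Hypothesis H_hopf : is_hopf H.
Let H_bi := hopf_bialgebra H_hopf.
Let H_alg : is_algebra H. Proof. by case: H_bi. Qed.
Let H_coalg : is_coalgebra H. Proof. by case: H_bi. Qed.
Implicit Types M N X : rep K I.

Lemma tensE M N : ract (tens H M N) = fun i => l2 (comul H i) (fun j k => ract M j *t ract N k).
Proof. by []. Qed.

Lemma triv_rep_module d : is_module H (triv_rep H d).
Proof.
split=> [i j|] /=.
  rewrite -scalemxAl mul1mx scalerA -(counitM H_bi).
  exact: l1_scal.
rewrite -[RHS]scale1r -(counit1 H_bi); exact/esym/l1_scal.
Qed.

(** A trivial second action absorbs h_3, so tensoring on the left is a twist. With the actions
    exchanged, and after a flip, so is tensoring on the right. *)
Lemma tens_twistl X M : tens H X M = twist H (ract X) (ract (triv_rep H (rdim X))) M.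
Proof.
congr Rep; apply/funext => i; rewrite -/(l2 _ _) (comulA H_coalg i (fun p q c =>
  ract X p *m ract (triv_rep H (rdim X)) c *t ract M q)).
apply: eq_l2 => p w /=.
transitivity (l2 (comul H w) (fun q c => counit H c *: (ract X p *t ract M q))).
  by rewrite (comul1r H_coalg).
by apply: eq_l2 => q c; rewrite -scalemxAr mulmx1 tensmxZl.
Qed.

Lemma tens_twistr X M :
  iso (tens H M X) (twist H (ract (triv_rep H (rdim X))) (ract X) M).
Proof.
exists (flip_mx K _ _), (flip_mx K _ _); rewrite !flip_mxK; split=> // i /=.
rewrite -/(l2 _ _) l2_mulmxr l2_mulmxl; apply: eq_l2 => a c.
rewrite flip_tens; congr (_ *m _).
transitivity (l2 (comul H a) (fun p q => counit H p *: (ract X c *t ract M q))).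
  by rewrite (comul1l H_coalg a (fun q => ract X c *t ract M q)).
by apply: eq_l2 => p q; rewrite -scalemxAl mul1mx tensmxZl.
Qed.

Lemma tens_module M N : is_module H M -> is_module H N -> is_module H (tens H M N).
Proof.
move=> mM mN; rewrite tens_twistl; apply: twist_module => //.
  exact: triv_rep_module.
by move=> i j; rewrite /= -scalemxAl mul1mx -scalemxAr mulmx1.
Qed.

Lemma tens_hom M N M' N' f g : @is_hom K I M M' f -> @is_hom K I N N' g ->
  @is_hom K I (tens H M N) (tens H M' N') (f *t g).
Proof.
move=> hf hg i; rewrite !tensE l2_mulmxr l2_mulmxl; apply: eq_l2 => j k.
by rewrite !tensmx_mul hf hg.
Qed.

Lemma tens_iso M N M' N' : iso M M' -> iso N N' -> iso (tens H M N) (tens H M' N').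
Proof.
move=> [f [f' [hf ff' f'f]]] [g [g' [hg gg' g'g]]].
exists (f *t g), (f' *t g'); rewrite !tensmx_mul ff' f'f gg' g'g !tensmx11.
by split=> //; apply: tens_hom.
Qed.

Lemma tens_retract M N M' N' : retract M M' -> retract N N' ->
  retract (tens H M N) (tens H M' N').
Proof.
move=> [f [f' [hf hf' ff']]] [g [g' [hg hg' gg']]].
exists (f *t g), (f' *t g'); rewrite !tensmx_mul ff' gg' tensmx11.
by split=> //; apply: tens_hom.
Qed.

Lemma tensA M N X : iso (tens H (tens H M N) X) (tens H M (tens H N X)).
Proof.
have [P [Q [PQ QP PE]]] := tensA_conj K (rdim M) (rdim N) (rdim X).
exists P, Q; split=> // i; rewrite !tensE.
transitivity (P *m l2 (comul H i) (fun j c => l2 (comul H j) (fun a b =>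
    ract M a *t ract N b *t ract X c))).
  by congr (_ *m _); apply: eq_l2 => j c; rewrite l2_tensl.
rewrite (comulA H_coalg i (fun a b c => ract M a *t ract N b *t ract X c)).
rewrite l2_mulmxr l2_mulmxl; apply: eq_l2 => a j.
rewrite l2_mulmxr l2_tensr l2_mulmxl; apply: eq_l2 => b c.
exact: PE.
Qed.

Hypothesis S_unit :
  (\matrix_(a < #|I|, b < #|I|) antipode H (enum_val a) (enum_val b)) \in unitmx.

Lemma twist_projective d (l r : I -> 'M[K]_d) M :
  is_module H (Rep l) -> is_module H (Rep r) ->
  (forall i j, r j *m l i = l i *m r j) ->
  projective H M -> projective H (twist H l r M).
Proof.
move=> mL mR lr pM; have [s sP] := projective_proj_basis H_alg pM.
have mM := pM.1; apply: (proj_basis_projective (twist_module H_hopf mL mR lr mM)).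
exact: (twist_proj_basis H_hopf mL mR lr S_unit mM sP).
Qed.

Lemma tensl_projective X M : is_module H X -> projective H M -> projective H (tens H X M).
Proof.
move=> mX pM; rewrite tens_twistl; apply: twist_projective => //.
  exact: triv_rep_module.
by move=> i j; rewrite /= -scalemxAl mul1mx -scalemxAr mulmx1.
Qed.

Lemma tensr_projective X M : is_module H X -> projective H M -> projective H (tens H M X).
Proof.
move=> mX pM; apply: retract_projective (iso_retract (tens_twistr X M)).
  by apply: tens_module => //; exact: pM.1.
apply: twist_projective => //.
  exact: triv_rep_module.
by move=> i j; rewrite /= -scalemxAl mul1mx -scalemxAr mulmx1.
Qed.

Definition tensl X (mX : is_module H X) : exact_functor H H.
Proof.
exists (tens H X) (fun M N f => 1%:M *t f).
- by move=> M; rewrite tensmx11.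
- by move=> M N P f g; rewrite tensmx_mul mulmx1.
- by move=> M N f g; exact: (linearB (tensmx _)).
- by move=> M N f hf; apply: tens_hom => //; exact: is_hom1.
- by move=> M; exact: tens_module.
- by move=> M; exact: tensl_projective.
Defined.

Definition tensr X (mX : is_module H X) : exact_functor H H.
Proof.
exists (fun M => tens H M X) (fun M N f => f *t 1%:M).
- by move=> M; rewrite tensmx11.
- by move=> M N P f g; rewrite tensmx_mul mulmx1.
- by move=> M N f g; exact: (linearB (rtensmx _)).
- by move=> M N f hf; apply: tens_hom => //; exact: is_hom1.
- by move=> M mM; exact: tens_module.
- by move=> M; exact: tensr_projective.
Defined.

End Tens.

(** * Modules over the double *)

Section DualAlgebra.
Variables (K : fieldType) (I : finType) (H : hopf K I).
Hypothesis H_coalg : is_coalgebra H.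

Lemma dual_is_algebra : is_algebra (dual_algebra H).
Proof.
have [cA c1l c1r] := H_coalg.
split=> [x y z|x|x]; apply/ffunP => k; rewrite !elt_mulE.
- under eq_l1 do rewrite l1_elt_mul.
  rewrite l1_elt_mul; apply: (eq_l1 (V := K^o)) => i.
  apply: (eq_l1 (V := K^o)) => j.
  rewrite l11C; apply: (eq_l1 (V := K^o)) => l; symmetry.
  transitivity (\sum_a comul H k a l * comul H a i j).
    by apply: eq_bigr => a _; exact: mulrC.
  rewrite cA; apply: eq_bigr => a _; exact: mulrC.
- rewrite l1_elt_one l11C -[RHS](l1_deltar x k).
  apply: (eq_l1 (V := K^o)) => i; rewrite eq_sym -c1l; exact: eq_bigr.
- rewrite -[RHS](l1_deltar x k); apply: (eq_l1 (V := K^o)) => i.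
  rewrite l1_elt_one eq_sym -c1r; apply: eq_bigr => j _; exact: mulrC.
Qed.

End DualAlgebra.

Section Double.
Variables (K : fieldType) (I : finType) (H : hopf K I).
Hypothesis H_hopf : is_hopf H.
Let H_bi := hopf_bialgebra H_hopf.
Let H_alg : is_algebra H. Proof. by case: H_bi. Qed.
Let H_coalg : is_coalgebra H. Proof. by case: H_bi. Qed.
Let dH_alg : is_algebra (dual_algebra H) := dual_is_algebra H_coalg.
Hypothesis S_unit :
  (\matrix_(a < #|I|, b < #|I|) antipode H (enum_val a) (enum_val b)) \in unitmx.

(* The Yetter-Drinfeld condition h_1 (f <- h_2) = (h_1 -> f) h_2, where        *)
(* (f <- h)(x) = f(hx) and (h -> f)(x) = f(xh); it is equivalent to the        *)
(* commutation relation of D(H) and does not mention the antipode.             *)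
Definition yetter_drinfeld n (rho phi : I -> 'M[K]_n) : Prop := forall i (F : I -> K^o),
  l2 (comul H i) (fun j k => l1 (fun x => l1 (amul H k x) F) (fun x => rho j *m phi x)) =
  l2 (comul H i) (fun j k => l1 (fun x => l1 (amul H x j) F) (fun x => phi x *m rho k)).

(** This is F(S^-1(e_r) e_x e_p), the value at e_x of the functional F(S^-1(h_3) ? h_1) in the
    product of the double. *)
Definition double_coef (F : I -> K^o) (x p r : I) : K :=
  l1 (antipodeV H r) (fun s => l1 (amul H s x) (fun t => l1 (amul H t p) F)).

Definition double_comm n (rho phi : I -> 'M[K]_n) : Prop := forall i (F : I -> K^o),
  rho i *m l1 F phi = l2 (comul H i) (fun p t => l2 (comul H t) (fun q r =>
    l1 (fun x => double_coef F x p r) (fun x => phi x *m rho q))).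

(** Moving S^-1 across the relation: from left to right the Yetter-Drinfeld condition is applied to
    the functional F(S^-1(h_3) ?) and S^-1(h_3) h_2 cancels; in the other direction h_4 S^-1(h_3)
    cancels. *)
Lemma yetter_drinfeldP n (rho phi : I -> 'M[K]_n) :
  yetter_drinfeld rho phi <-> double_comm rho phi.
Proof.
split=> [yd|dc] i F.
- pose G r t := l1 (antipodeV H r) (fun s => l1 (amul H s t) F).
  have e x p r : double_coef F x p r = l1 (amul H x p) (G r).
    rewrite /double_coef l11C; apply: (eq_l1 (V := K^o)) => s.
    by rewrite (amulA H_alg).
  under [RHS]eq_l2 => p t do under eq_l2 => q r do under [X in l1 X]funext => x do rewrite e.
  rewrite -(comulA H_coalg i (fun p q r => l1 (fun x => l1 (amul H x p) (G r))
    (fun x => phi x *m rho q))).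
  under eq_l2 => m r do rewrite -yd.
  rewrite (comulA H_coalg i (fun j k r => l1 (fun x => l1 (amul H k x) (G r))
    (fun x => rho j *m phi x))).
  transitivity (l2 (comul H i) (fun j m => counit H m *: (rho j *m l1 F phi))).
    by rewrite (comul1r H_coalg i (fun j => rho j *m l1 F phi)).
  apply: eq_l2 => j m.
  rewrite -l2_comp l1_mulmxr l1Z; apply: eq_bigr => x _; rewrite scalerA mulrC.
  congr (_ *: _); rewrite mulrC.
  under eq_l2 => k r do rewrite l11C.
  under eq_l2 => k r do under eq_l1 => s do rewrite -(amulA H_alg).
  rewrite (antipodeVL H_hopf S_unit m (fun y => l1 (amul H y x) F)).
  by rewrite (amul1l H_alg) mulrC.
- pose G k x := l1 (amul H k x) F.
  transitivity (l2 (comul H i) (fun j k => rho j *m l1 (G k) phi)).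
    by apply: eq_l2 => j k; rewrite l1_mulmxr.
  under eq_l2 => j k do rewrite dc.
  rewrite (comulA H_coalg i (fun p t k => l2 (comul H t) (fun q r =>
    l1 (fun x => double_coef (G k) x p r) (fun x => phi x *m rho q)))).
  apply: eq_l2 => p m.
  rewrite (comulA H_coalg m (fun q r k =>
    l1 (fun x => double_coef (G k) x p r) (fun x => phi x *m rho q))).
  under eq_l2 => q w do rewrite -l2_comp.
  transitivity (l2 (comul H m) (fun q w => counit H w *:
     l1 (fun x => l1 (amul H x p) F) (fun x => phi x *m rho q))).
    apply: eq_l2 => q w; rewrite l1Z; apply: eq_bigr => x _; rewrite scalerA mulrC.
    congr (_ *: _).
    transitivity (l2 (comul H w) (fun r k => l1 (antipodeV H r) (fun s =>
      l1 (amul H k s) (fun z => l1 (amul H x p) (fun y => l1 (amul H z y) F))))).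
      apply: (eq_l2 (V := K^o)) => r k; apply: (eq_l1 (V := K^o)) => s.
      rewrite (amulA H_alg) [RHS]l11C; apply: (eq_l1 (V := K^o)) => y.
      by rewrite [RHS](amulA H_alg).
    rewrite (antipodeVR H_hopf S_unit); congr (_ * _).
    rewrite l11C; apply: (eq_l1 (V := K^o)) => y; exact: amul1l.
  by rewrite (comul1r H_coalg m (fun q => l1 _ (fun x => phi x *m rho q))).
Qed.

Lemma comul3E (V : lmodType K) i (F : I -> I -> I -> V) :
  \sum_p \sum_q \sum_r comul3 H i p q r *: F p q r =
  l2 (comul H i) (fun p t => l2 (comul H t) (fun q r => F p q r)).
Proof.
apply: eq_bigr => p _; rewrite /comul3.
under eq_bigr do under eq_bigr do rewrite scaler_suml.
under eq_bigr do rewrite exchange_big; rewrite exchange_big.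
apply: eq_bigr => t _; rewrite /l2 scaler_sumr; apply: eq_bigr => q _.
by rewrite scaler_sumr; apply: eq_bigr => r _; rewrite scalerA.
Qed.

Lemma double_coefE b x p r :
  \sum_s antipodeV H r s * amul3 H s x p b =
  double_coef (fun k => (k == b)%:R) x p r.
Proof.
apply: eq_bigr => s _; congr (_ * _); apply: eq_bigr => t _; congr (_ * _).
by rewrite l1_deltar.
Qed.

Lemma l1_double_mul (V : lmodType K) u v (G : I -> I -> V) :
  l1 (amul (double_algebra H) u v) (fun w => G w.1 w.2) =
  l2 (comul H u.2) (fun p t => l2 (comul H t) (fun q r =>
    l1 (fun x => double_coef (fun k => (k == v.1)%:R) x p r) (fun x =>
      l1 (amul (dual_algebra H) u.1 x) (fun a => l1 (amul H q v.2) (G a))))).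
Proof.
rewrite -comul3E.
transitivity (\sum_a \sum_j \sum_p \sum_q \sum_r \sum_x
   (comul H a u.1 x * (comul3 H u.2 p q r * double_coef (fun k => (k == v.1)%:R) x p r
     * amul H q v.2 j)) *: G a j).
  rewrite /l1 -(pair_bigA _ (fun a j => amul (double_algebra H) u v (a, j) *: G a j)) /=.
  apply: eq_bigr => a _; apply: eq_bigr => j _.
  rewrite scaler_suml.
  under [RHS]eq_bigr do under eq_bigr do rewrite exchange_big /=.
  under [RHS]eq_bigr do rewrite exchange_big /=.
  rewrite [RHS]exchange_big /=; apply: eq_bigr => x _.
  rewrite mulr_sumr scaler_suml; apply: eq_bigr => p _.
  rewrite mulr_sumr scaler_suml; apply: eq_bigr => q _.
  rewrite mulr_sumr scaler_suml; apply: eq_bigr => r _.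
  by rewrite double_coefE.
under eq_bigr do rewrite exchange_big /=.
rewrite exchange_big /=; apply: eq_bigr => p _.
under eq_bigr do rewrite exchange_big /=.
rewrite exchange_big /=; apply: eq_bigr => q _.
under eq_bigr do rewrite exchange_big /=.
rewrite exchange_big /=; apply: eq_bigr => r _.
under eq_bigr do rewrite exchange_big /=.
rewrite exchange_big /= scaler_sumr; apply: eq_bigr => x _.
rewrite scalerA scaler_sumr; apply: eq_bigr => a _.
rewrite scalerA scaler_sumr; apply: eq_bigr => j _.
rewrite scalerA; congr (_ *: _); ring.
Qed.

Definition drep n (rho phi : I -> 'M[K]_n) : rep K (I * I)%type :=
  Rep (fun u => phi u.1 *m rho u.2).

Definition dact (X : rep K (I * I)%type) (a : I) : 'M[K]_(rdim X) :=
  l1 (aone H) (fun i => ract X (a, i)).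

(** A module over the double amounts to actions of H and H^* on one space subject to the commutation
    relation. [ract_double], [res_module], [dact_module] and [double_yetter_drinfeld] give the
    converse. *)
Lemma drep_module n (rho phi : I -> 'M[K]_n) :
  is_module H (Rep rho) -> is_module (dual_algebra H) (Rep phi) ->
  yetter_drinfeld rho phi -> is_module (double H) (drep rho phi).
Proof.
move=> [rhoM rho1] [phiM phi1] /yetter_drinfeldP dc; split=> [u v|] /=.
  rewrite -[RHS]/(l1 _ (fun w => phi w.1 *m rho w.2)) (l1_double_mul _ _ (fun a j => phi a *m rho j)).
  have e : rho u.2 *m phi v.1 = l2 (comul H u.2) (fun p t => l2 (comul H t) (fun q r =>
    l1 (fun x => double_coef (fun k => (k == v.1)%:R) x p r) (fun x => phi x *m rho q))).
    rewrite -dc; congr (_ *m _); rewrite -[LHS](l1_delta v.1); apply: eq_bigr => k _.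
    by rewrite eq_sym.
  rewrite mulmxA -(mulmxA (phi u.1)) e l2_mulmxr l2_mulmxl; apply: eq_l2 => p t.
  rewrite l2_mulmxr l2_mulmxl; apply: eq_l2 => q r.
  rewrite l1_mulmxr l1_mulmxl; apply: eq_l1 => x.
  rewrite mulmxA -mulmxA [X in X *m _]phiM [X in _ *m X]rhoM -!/(l1 _ _).
  by rewrite l1_mulmxl; apply: eq_l1 => a; rewrite l1_mulmxr.
transitivity (l2 (fun a i => counit H a * aone H i) (fun a i => phi a *m rho i)).
  by rewrite l2E.
have phi1' : l1 (counit H) phi = 1%:M := phi1.
have rho1' : l1 (aone H) rho = 1%:M := rho1.
rewrite -[1%:M]mulmx1 -{1}phi1' -rho1' l1_mulmxl; apply: eq_bigr => a _.
rewrite l1_mulmxr scaler_sumr; apply: eq_bigr => i _.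
by rewrite scalerA.
Qed.

Lemma ract_res_drep n (rho phi : I -> 'M[K]_n) i :
  is_module (dual_algebra H) (Rep phi) -> ract (res H (drep rho phi)) i = rho i.
Proof.
move=> [_ phi1]; have phi1' : l1 (counit H) phi = 1%:M := phi1.
by rewrite -[RHS]mul1mx -phi1' l1_mulmxl.
Qed.

Lemma res_drep n (rho phi : I -> 'M[K]_n) :
  is_module (dual_algebra H) (Rep phi) -> res H (drep rho phi) = Rep rho.
Proof.
by move=> mphi; congr Rep; apply/funext => i; exact: ract_res_drep.
Qed.

Lemma dact_drep n (rho phi : I -> 'M[K]_n) a :
  is_module H (Rep rho) -> dact (drep rho phi) a = phi a.
Proof.
move=> [_ rho1]; rewrite /dact /= -l1_mulmxr.
by rewrite [l1 _ _]rho1 mulmx1.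
Qed.

Lemma double_coef_counit x p r :
  double_coef (counit H) x p r = (counit H p * counit H r) * counit H x.
Proof.
transitivity (l1 (antipodeV H r) (fun s => counit H p * (counit H x * counit H s) : K^o)).
  apply: (eq_l1 (V := K^o)) => s.
  transitivity (l1 (amul H s x) (fun t => counit H p * counit H t : K^o)).
    by apply: (eq_l1 (V := K^o)) => y; rewrite (counitM H_bi) mulrC.
  by rewrite -(l1Z (V := K^o)) (counitM H_bi) [counit H s * _]mulrC.
rewrite -(l1Z (V := K^o)) -(l1Z (V := K^o)) (counit_antipodeV H_hopf S_unit).
by rewrite /GRing.scale /= -mulrA [counit H x * _]mulrC.
Qed.

Lemma double_coef_delta (F : I -> K) x p r :
  l1 F (fun b => double_coef (fun k => (k == b)%:R) x p r : K^o) = double_coef F x p r.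
Proof.
rewrite /double_coef l11C; apply: (eq_l1 (V := K^o)) => s.
rewrite l11C; apply: (eq_l1 (V := K^o)) => y.
rewrite l11C; apply: (eq_l1 (V := K^o)) => z.
rewrite -[RHS](l1_deltar F); apply: (eq_l1 (V := K^o)) => b.
by rewrite eq_sym.
Qed.

Section DoubleModule.
Variable X : rep K (I * I)%type.
Hypothesis mX : is_module (double H) X.

Let rho : I -> 'M[K]_(rdim X) := ract (res H X).
Let phi := dact X.

Let XM u v : ract X u *m ract X v =
  l2 (comul H u.2) (fun p t => l2 (comul H t) (fun q r =>
    l1 (fun x => double_coef (fun k => (k == v.1)%:R) x p r) (fun x =>
      l1 (amul (dual_algebra H) u.1 x) (fun a => l1 (amul H q v.2) (fun j => ract X (a, j)))))).
Proof.
rewrite mX.1 -(l1_double_mul u v (fun a j => ract X (a, j))).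
by apply: eq_bigr => -[].
Qed.

Let rhoE j : rho j = l1 (counit H) (fun a => ract X (a, j)). Proof. by []. Qed.

Let XMF a i (F : I -> K) j : l1 F (fun b => ract X (a, i) *m ract X (b, j)) =
  l2 (comul H i) (fun p t => l2 (comul H t) (fun q r =>
    l1 (fun x => double_coef F x p r) (fun x =>
      l1 (amul (dual_algebra H) a x) (fun w => l1 (amul H q j) (fun y => ract X (w, y)))))).
Proof.
under eq_l1 => b do rewrite XM /=.
rewrite l12C; apply: eq_l2 => p t; rewrite l12C; apply: eq_l2 => q r.
rewrite -[LHS]l1_comp; apply: eq_bigr => x _; congr (_ *: _).
exact: double_coef_delta.
Qed.

Let X_rho a i j : ract X (a, i) *m rho j = l1 (amul H i j) (fun y => ract X (a, y)).
Proof.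
rewrite rhoE l1_mulmxr XMF.
pose Y q := l1 (amul H q j) (fun y => ract X (a, y)).
transitivity (l2 (comul H i) (fun p t => counit H p *: l2 (comul H t) (fun q r =>
  counit H r *: Y q))); last first.
  under eq_l2 => p t do rewrite (comul1r H_coalg).
  by rewrite (comul1l H_coalg).
apply: eq_l2 => p t; rewrite l2Z; apply: eq_l2 => q r.
rewrite scalerA.
transitivity ((counit H p * counit H r) *: l1 (counit H) (fun x =>
   l1 (amul (dual_algebra H) a x) (fun w => l1 (amul H q j) (fun y => ract X (w, y))))).
  rewrite /l1 scaler_sumr; apply: eq_bigr => x _.
  by rewrite double_coef_counit scalerA.
congr (_ *: _); exact: (amul1r dH_alg).
Qed.

Let phi_X a b j : phi a *m ract X (b, j) = l1 (amul (dual_algebra H) a b) (fun w => ract X (w, j)).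
Proof.
rewrite /phi /dact l1_mulmxl.
under eq_l1 => i do rewrite XM /=.
rewrite (comul1 H_bi); under eq_l1 => p do rewrite (comul1 H_bi).
under eq_l1 => p do rewrite l11C.
pose Z x := l1 (amul (dual_algebra H) a x) (fun w => ract X (w, j)).
transitivity (l1 (aone H) (fun p => l1 (aone H) (fun r =>
   l1 (fun x => double_coef (fun k => (k == b)%:R) x p r) Z))).
  apply: eq_l1 => p; apply: eq_l1 => r; rewrite l11C; apply: eq_l1 => x.
  rewrite l11C; apply: eq_l1 => w; exact: (amul1l H_alg).
under eq_l1 do rewrite -l1_comp; rewrite -l1_comp -[RHS](l1_delta b Z).
apply: eq_bigr => x _; congr (_ *: _).
transitivity (l1 (aone H) (fun p => l1 (amul H x p) (fun k => (k == b)%:R : K^o))).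
  apply: (eq_l1 (V := K^o)) => p.
  rewrite /double_coef (antipodeV1 H_hopf S_unit); exact: (amul1l H_alg).
by rewrite (amul1r H_alg) eq_sym.
Qed.

(** In the double, e^a (x) e_i is the product of e^a (x) 1 and eps (x) e_i. *)
Lemma ract_double a i : ract X (a, i) = phi a *m rho i.
Proof.
rewrite /phi /dact l1_mulmxl; under eq_l1 => j do rewrite X_rho.
by rewrite (amul1l H_alg i (fun y => ract X (a, y))).
Qed.

Lemma res_module : is_module H (res H X).
Proof.
split=> [i j|].
  rewrite -[RHS]/(l1 _ rho) -!/(rho _) (rhoE i) l1_mulmxl.
  by under eq_l1 => a do rewrite X_rho; rewrite l11C.
rewrite -[RHS]mX.2 -[LHS]/(l1 _ (fun i => l1 _ _)) l11C.
rewrite -[RHS]/(l1 (fun u => counit H u.1 * aone H u.2) _).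
transitivity (l2 (fun a i => counit H a * aone H i) (fun a i => ract X (a, i))).
  apply: eq_bigr => a _; rewrite scaler_sumr; apply: eq_bigr => i _.
  by rewrite scalerA.
by rewrite l2E; apply: eq_bigr => -[].
Qed.

Lemma dact_module : is_module (dual_algebra H) (Rep phi).
Proof.
split=> [a b|] /=.
  rewrite -[RHS]/(l1 _ phi) [in LHS]/phi {2}/dact l1_mulmxr.
  by under eq_l1 => j do rewrite -/(phi a) phi_X; rewrite l11C.
rewrite -[RHS]mX.2.
rewrite -[RHS]/(l1 (fun u => counit H u.1 * aone H u.2) _).
transitivity (l2 (fun a i => counit H a * aone H i) (fun a i => ract X (a, i))).
  apply: eq_bigr => a _; rewrite scaler_sumr; apply: eq_bigr => i _.
  by rewrite scalerA.
by rewrite l2E; apply: eq_bigr => -[].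
Qed.

Lemma double_yetter_drinfeld : yetter_drinfeld rho phi.
Proof.
apply/yetter_drinfeldP => i F.
rewrite rhoE l1_mulmxl.
transitivity (l1 (counit H) (fun a => l1 (aone H) (fun j =>
   l1 F (fun b => ract X (a, i) *m ract X (b, j))))).
  apply: eq_l1 => a; rewrite l1_mulmxr l11C; apply: eq_l1 => b.
  by rewrite /phi /dact l1_mulmxr.
etransitivity; first by apply: eq_l1 => a; apply: eq_l1 => j; exact: (XMF a i F j).
under eq_l1 => a do rewrite l12C; rewrite l12C; apply: eq_l2 => p t.
under eq_l1 => a do rewrite l12C; rewrite l12C; apply: eq_l2 => q r.
under eq_l1 => a do rewrite l11C; rewrite l11C; apply: eq_l1 => x.
under eq_l1 => a do rewrite l11C.
rewrite (amul1l dH_alg x (fun w => l1 (aone H) (fun j => l1 (amul H q j) _))).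
by rewrite (amul1r H_alg q (fun y => ract X (x, y))) ract_double.
Qed.

End DoubleModule.

End Double.

(** * Tensor products and half-braidings over the double *)

Section DoubleTensor.
Variables (K : fieldType) (I : finType) (H : hopf K I).
Hypothesis H_hopf : is_hopf H.
Let H_bi := hopf_bialgebra H_hopf.
Let H_alg : is_algebra H. Proof. by case: H_bi. Qed.
Let H_coalg : is_coalgebra H. Proof. by case: H_bi. Qed.
Let dH_alg : is_algebra (dual_algebra H) := dual_is_algebra H_coalg.
Hypothesis S_unit :
  (\matrix_(a < #|I|, b < #|I|) antipode H (enum_val a) (enum_val b)) \in unitmx.

Lemma sum_l1 (A : finType) (V : lmodType K) (F : A -> V) :
  \sum_a F a = l1 (fun _ => 1) F.
Proof. by apply: eq_bigr => a _; rewrite scale1r. Qed.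

Lemma l1_sum_scale (A : finType) (V : lmodType K) (c : A -> K) (F : A -> V) :
  l1 c F = l1 (fun _ => 1) (fun a => c a *: F a).
Proof. by apply: eq_bigr => a _; rewrite scale1r. Qed.

Lemma l1_sum_scaleo (A : finType) (V : lmodType K) (c : A -> K^o) (F : A -> V) :
  l1 c F = l1 (fun _ => 1) (fun a => (c a : K) *: F a).
Proof. exact: l1_sum_scale. Qed.

Section Two.
Variables X Y : rep K (I * I)%type.
Hypotheses (mX : is_module (double H) X) (mY : is_module (double H) Y).
Let rX : I -> 'M[K]_(rdim X) := ract (res H X).
Let rY : I -> 'M[K]_(rdim Y) := ract (res H Y).
Let fX := dact H X.
Let fY := dact H Y.

(** The double contains H^* with the opposite coproduct, so e^c acts on X (x) Y by f_2 (x) f_1;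
    hence the exchanged indices in [amul]. *)
Definition tens_dact c : 'M[K]_(rdim X * rdim Y) :=
  l2 (fun a b => amul H b a c) (fun a b => fX a *t fY b).

Let tens_dactE (F : I -> K) : l1 F tens_dact =
  l1 (fun _ => 1) (fun a => l1 (fun b => l1 (amul H b a) (F : I -> K^o))
    (fun b => fX a *t fY b)).
Proof.
transitivity (l1 F (fun c => l1 (fun _ => 1) (fun a => l1 (fun b => amul H b a c)
    (fun b => fX a *t fY b)))).
  by apply: eq_l1 => c; rewrite -sum_l1.
rewrite l11C; apply: eq_l1 => a.
rewrite -(l1_comp F (fun c b => amul H b a c)); apply: eq_bigr => b _.
by congr (_ *: _); apply: eq_bigr => c _; exact: mulrC.
Qed.

Let tens_dactE' (F : I -> K^o) : l1 F tens_dact =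
  l1 (fun _ => 1) (fun a => l1 (fun b => l1 (amul H b a) F) (fun b => fX a *t fY b)).
Proof. exact: tens_dactE. Qed.

Lemma ract_tens_double u : ract (tens (double H) X Y) u =
  tens_dact u.1 *m ract (tens H (res H X) (res H Y)) u.2.
Proof.
have e v : ract X v = fX v.1 *m rX v.2 by rewrite -ract_double //; case: v.
have e' v : ract Y v = fY v.1 *m rY v.2 by rewrite -ract_double //; case: v.
transitivity (l2 (fun v w => amul H w.1 v.1 u.1 * comul H u.2 v.2 w.2)
   (fun v w => (fX v.1 *m rX v.2) *t (fY w.1 *m rY w.2))).
  by apply: eq_l2 => v w; rewrite e e'.
rewrite (l2_pair (fun a b => amul H b a u.1) (comul H u.2)).
rewrite l2_mulmxl; apply: eq_l2 => a b /=.
rewrite [X in _ *m X](_ : _ = l2 (comul H u.2) (fun j k => rX j *t rY k)) //.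
by rewrite l2_mulmxr; apply: eq_l2 => j k; rewrite tensmx_mul.
Qed.

Lemma tens_double : tens (double H) X Y =
  drep (ract (tens H (res H X) (res H Y))) tens_dact.
Proof. by congr Rep; apply/funext => u; exact: ract_tens_double. Qed.

Lemma tens_dact_module : is_module (dual_algebra H) (Rep tens_dact).
Proof.
have fXM : forall a b, fX a *m fX b = l1 (amul (dual_algebra H) a b) fX := (dact_module H_hopf S_unit mX).1.
have fYM : forall a b, fY a *m fY b = l1 (amul (dual_algebra H) a b) fY := (dact_module H_hopf S_unit mY).1.
have fX1 : l1 (counit H) fX = 1%:M := (dact_module H_hopf S_unit mX).2.
have fY1 : l1 (counit H) fY = 1%:M := (dact_module H_hopf S_unit mY).2.
split=> [c d|] /=; last first.
  rewrite -[LHS]/(l1 (counit H) tens_dact) tens_dactE.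
  transitivity (l1 (counit H) (fun a => fX a *t l1 (counit H) fY)).
    rewrite [RHS]l1_sum_scale; apply: eq_l1 => a.
    rewrite -tensmxZl l1_tensr; apply: eq_bigr => b _.
    by rewrite (counitM H_bi) tensmxZl scalerA.
  by rewrite -l1_tensl fX1 fY1 tensmx11.
rewrite -[RHS]/(l1 _ tens_dact) tens_dactE.
pose A a b := amul H b a c; pose B a b := amul H b a d.
transitivity (\sum_x \sum_y (l2 (comul H y) (fun b b' => l2 (comul H x) (fun a a' =>
   A a b * B a' b' : K^o))) *: (fX x *t fY y)).
  rewrite /tens_dact l2_mulmxl.
  transitivity (l2 A (fun a b => l2 B (fun a' b' => \sum_x \sum_y
     (comul H x a a' * comul H y b b') *: (fX x *t fY y)))).
    apply: eq_l2 => a b; rewrite l2_mulmxr; apply: eq_l2 => a' b'.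
    rewrite tensmx_mul fXM fYM l1_tensl; apply: eq_bigr => x _.
    rewrite l1_tensr scaler_sumr; apply: eq_bigr => y _.
    by rewrite scalerA.
  under eq_l2 => a b do under eq_l2 => a' b' do rewrite sum_l1.
  under eq_l2 => a b do rewrite l21C.
  rewrite l21C sum_l1; apply: eq_l1 => x.
  under eq_l2 => a b do under eq_l2 => a' b' do rewrite sum_l1.
  under eq_l2 => a b do rewrite l21C.
  rewrite l21C sum_l1; apply: eq_l1 => y.
  under eq_l2 => a b do rewrite -l2_scal.
  rewrite -l2_scal; congr (_ *: _).
  transitivity (\sum_a \sum_b \sum_a' \sum_b'
      A a b * B a' b' * (comul H x a a' * comul H y b b')).
    apply: eq_bigr => a _; apply: eq_bigr => b _; rewrite scaler_sumr.
    apply: eq_bigr => a' _; rewrite scaler_sumr; apply: eq_bigr => b' _.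
    exact: mulrA.
  rewrite exchange_big; apply: eq_bigr => b _.
  under eq_bigr do rewrite exchange_big; rewrite exchange_big.
  apply: eq_bigr => b' _; rewrite scaler_sumr; apply: eq_bigr => a _.
  rewrite scaler_sumr; apply: eq_bigr => a' _; rewrite /GRing.scale /=; ring.
rewrite -[RHS](@sum_l1 I); apply: eq_bigr => x _; apply: eq_bigr => y _; congr (_ *: _).
have := comulM H_bi y x (fun p q => (p == c)%:R * (q == d)%:R : K^o).
have e k : l2 (comul H k) (fun p q => (p == c)%:R * (q == d)%:R : K^o) = comul H k c d.
  rewrite /l2 (bigD1 c) //= [X in _ + X]big1 ?addr0 => [|p /negbTE pc]; last first.
    by apply: big1 => q _; rewrite pc mul0r scaler0.
  rewrite (bigD1 d) //= [X in _ + X]big1 ?addr0 => [|q /negbTE qd]; last first.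
    by rewrite qd mulr0 scaler0.
  by rewrite !eqxx /GRing.scale /= !mulr1.
under eq_l1 => k do rewrite e.
move=> ->; apply: (eq_l2 (V := K^o)) => b b'; apply: (eq_l2 (V := K^o)) => a a'.
symmetry; transitivity (l1 (amul H b a) (fun p => (p == c)%:R * amul H b' a' d : K^o)).
  apply: (eq_l1 (V := K^o)) => p.
  by rewrite -[in RHS](l1_deltar (amul H b' a') d) [RHS](l1Z (V := K^o)).
by rewrite -(l1_scal (V := K^o)) l1_deltar.
Qed.

(** An element of H is moved first past the H^* action on Y, then past the one on X. Coassociativity
    in H and associativity of its product regroup the legs in between. *)
Lemma tens_yetter_drinfeld :
  yetter_drinfeld H (ract (tens H (res H X) (res H Y)) : I -> 'M_(rdim X * rdim Y)) tens_dact.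
Proof.
have ydX := double_yetter_drinfeld H_hopf S_unit mX.
have ydY := double_yetter_drinfeld H_hopf S_unit mY.
move=> i F.
have rE k : ract (tens H (res H X) (res H Y)) k = l2 (comul H k) (fun p q => rX p *t rY q) by [].
transitivity (l2 (comul H i) (fun j k => l2 (comul H j) (fun j1 j2 =>
   l1 (fun _ => 1) (fun a => (rX j1 *m fX a) *t
     l1 (fun b => l1 (amul H k b) (fun y => l1 (amul H y a) F)) (fun b => rY j2 *m fY b))))).
  apply: eq_l2 => j k; rewrite -l1_mulmxr tens_dactE' rE l2_mulmxl.
  apply: eq_l2 => j1 j2; rewrite l1_mulmxr; apply: eq_l1 => a.
  rewrite l1_mulmxr [RHS]l1_tensr; apply: eq_bigr => b _; rewrite tensmx_mul.
  by rewrite (amulA H_alg).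
rewrite (comulA H_coalg i (fun j1 j2 k =>  l1 (fun _ => 1) (fun a => (rX j1 *m fX a) *t
     l1 (fun b => l1 (amul H k b) (fun y => l1 (amul H y a) F)) (fun b => rY j2 *m fY b)))).
transitivity (l2 (comul H i) (fun j1 m => l2 (comul H m) (fun j2 k =>
   l1 (fun _ => 1) (fun a => (rX j1 *m fX a) *t
     l1 (fun b => l1 (amul H b j2) (fun y => l1 (amul H y a) F)) (fun b => fY b *m rY k))))).
  apply: eq_l2 => j1 m; rewrite !l21C; apply: eq_l1 => a; rewrite -!l2_tensr.
  by rewrite ydY.
rewrite -(comulA H_coalg i (fun j1 j2 k =>
   l1 (fun _ => 1) (fun a => (rX j1 *m fX a) *t
     l1 (fun b => l1 (amul H b j2) (fun y => l1 (amul H y a) F)) (fun b => fY b *m rY k)))).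
transitivity (l2 (comul H i) (fun w k => l2 (comul H w) (fun j1 j2 =>
   l1 (fun _ => 1) (fun b =>
     l1 (fun a => l1 (amul H j2 a) (fun y => l1 (amul H b y) F)) (fun a => rX j1 *m fX a)
     *t (fY b *m rY k))))).
  apply: eq_l2 => w k; apply: eq_l2 => j1 j2.
  transitivity (l1 (fun _ => 1) (fun a => l1 (fun _ => 1) (fun b =>
     l1 (amul H b j2) (fun y => l1 (amul H y a) F) *: ((rX j1 *m fX a) *t (fY b *m rY k))))).
    by apply: eq_l1 => a; rewrite [LHS]l1_tensr [LHS]l1_sum_scale.
  rewrite l11C; apply: eq_l1 => b; rewrite [RHS]l1_tensl [RHS]l1_sum_scale.
  by apply: eq_l1 => a; rewrite (amulA H_alg).
transitivity (l2 (comul H i) (fun w k => l2 (comul H w) (fun j1 j2 =>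
   l1 (fun _ => 1) (fun b =>
     l1 (fun a => l1 (amul H a j1) (fun y => l1 (amul H b y) F)) (fun a => fX a *m rX j2)
     *t (fY b *m rY k))))).
  apply: eq_l2 => w k; rewrite !l21C; apply: eq_l1 => b; rewrite -!l2_tensl.
  by rewrite ydX.
rewrite (comulA H_coalg i (fun j1 j2 k => l1 (fun _ => 1) (fun b =>
     l1 (fun a => l1 (amul H a j1) (fun y => l1 (amul H b y) F)) (fun a => fX a *m rX j2)
     *t (fY b *m rY k)))).
apply: eq_l2 => j m; rewrite -l1_mulmxl tens_dactE' rE l2_mulmxr.
apply: eq_l2 => j2 k.
transitivity (l1 (fun _ => 1) (fun b => l1 (fun _ => 1) (fun a =>
     l1 (amul H a j) (fun y => l1 (amul H b y) F) *: ((fX a *m rX j2) *t (fY b *m rY k))))).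
  by apply: eq_l1 => b; rewrite [LHS]l1_tensl [LHS]l1_sum_scale.
rewrite l11C [RHS]l1_mulmxl; apply: eq_l1 => a; rewrite [RHS]l1_mulmxl [RHS]l1_sum_scale.
apply: eq_l1 => b; rewrite tensmx_mul; congr (_ *: _).
by rewrite (amulA H_alg).
Qed.

Lemma double_tens_module : is_module (double H) (tens (double H) X Y).
Proof.
rewrite tens_double; apply: drep_module => //.
- exact: (tens_module H_hopf (res_module H_hopf S_unit mX) (res_module H_hopf S_unit mY)).
- exact: tens_dact_module.
- exact: tens_yetter_drinfeld.
Qed.

Lemma ract_res_tens i :
  ract (res H (tens (double H) X Y)) i = ract (tens H (res H X) (res H Y)) i.
Proof.
rewrite -[RHS](ract_res_drep (ract (tens H (res H X) (res H Y))) i tens_dact_module).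
by apply: eq_l1 => a; rewrite ract_tens_double.
Qed.

Lemma dact_tens c : dact H (tens (double H) X Y) c = tens_dact c.
Proof.
have mt := tens_module H_hopf (res_module H_hopf S_unit mX) (res_module H_hopf S_unit mY).
apply: etrans _ (dact_drep tens_dact c mt).
by apply: eq_l1 => i; rewrite ract_tens_double.
Qed.

Lemma res_tens : res H (tens (double H) X Y) = tens H (res H X) (res H Y).
Proof. by rewrite tens_double res_drep //; exact: tens_dact_module. Qed.

End Two.

Section HalfBraiding.
Variables (X : rep K (I * I)%type) (N : rep K I).
Hypotheses (mX : is_module (double H) X) (mN : is_module H N).
Let rX : I -> 'M[K]_(rdim X) := ract (res H X).
Let fX := dact H X.
Let sN := ract N.

Let C : 'M[K]_(rdim X * rdim N) := l1 (fun _ => 1) (fun x => fX x *t sN x).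
Let C' : 'M[K]_(rdim X * rdim N) :=
  l1 (fun _ => 1) (fun x => fX x *t l1 (antipode H x) sN).

Let fXM a b : fX a *m fX b = l1 (amul (dual_algebra H) a b) fX.
Proof. exact: (dact_module H_hopf S_unit mX).1. Qed.

Let sNM a b : sN a *m sN b = l1 (amul H a b) sN. Proof. exact: mN.1. Qed.

(** In H^* the product e^x e^y expands with the coefficients of the coproduct, so multiplying two
    sums of canonical-element type contracts [G] along the coproduct of H. *)
Let collapse (G : I -> I -> 'M[K]_(rdim N)) :
  (forall z, l2 (comul H z) G = counit H z *: 1%:M) ->
  l1 (fun _ => 1) (fun x => l1 (fun _ => 1) (fun y => (fX x *m fX y) *t G x y)) = 1%:M.
Proof.
move=> G1.
transitivity (l1 (fun _ => 1) (fun z => fX z *t l2 (comul H z) G)).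
  transitivity (l1 (fun _ => 1) (fun x => l1 (fun _ => 1) (fun y => l1 (fun _ => 1) (fun z =>
      comul H z x y *: (fX z *t G x y))))).
    apply: eq_l1 => x; apply: eq_l1 => y; rewrite fXM l1_tensl.
    by rewrite l1_sum_scale.
  under eq_l1 => x do rewrite l11C; rewrite l11C; apply: eq_l1 => z.
  rewrite l2_tensr /l2 -sum_l1; apply: eq_bigr => x _.
  by rewrite -sum_l1.
transitivity (l1 (counit H) fX *t (1%:M : 'M_(rdim N))).
  rewrite l1_tensl [RHS]l1_sum_scale; apply: eq_l1 => z.
  by rewrite G1 tensmxZr.
have fX1 : l1 (counit H) fX = 1%:M := (dact_module H_hopf S_unit mX).2.
by rewrite fX1 tensmx11.
Qed.

Let CC' : C *m C' = 1%:M.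
Proof.
rewrite -[RHS](collapse (G := fun x y => sN x *m l1 (antipode H y) sN)).
  rewrite l1_mulmxl; apply: eq_l1 => x; rewrite l1_mulmxr; apply: eq_l1 => y.
  by rewrite tensmx_mul.
move=> z; have <- : l1 (aone H) sN = 1%:M := mN.2.
rewrite -(antipodeR H_hopf); apply: eq_l2 => a b.
by rewrite l1_mulmxr; apply: eq_l1 => s; rewrite sNM.
Qed.

Let C'C : C' *m C = 1%:M.
Proof.
rewrite -[RHS](collapse (G := fun x y => l1 (antipode H x) sN *m sN y)).
  rewrite l1_mulmxl; apply: eq_l1 => x; rewrite l1_mulmxr; apply: eq_l1 => y.
  by rewrite tensmx_mul.
move=> z; have <- : l1 (aone H) sN = 1%:M := mN.2.
rewrite -(antipodeL H_hopf); apply: eq_l2 => a b.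
by rewrite l1_mulmxl; apply: eq_l1 => s; rewrite sNM.
Qed.

(** The map n (x) v |-> sum of e^a v (x) e_a n uses only the H^* action on X and the H action on N.
    Its intertwining property is the Yetter-Drinfeld condition, and the antipode gives its inverse
    [C'] up to the flip. *)
Lemma half_braiding : iso (tens H N (res H X)) (tens H (res H X) N).
Proof.
exists (C *m flip_mx K _ _), (flip_mx K _ _ *m C'); split; last first.
- by rewrite mulmxA -(mulmxA C) flip_mxK mulmx1 CC'.
- by rewrite mulmxA -(mulmxA _ C') C'C mulmx1 flip_mxK.
move=> i /=; rewrite -!/(l2 _ _).
have -> : C *m flip_mx K (rdim X) (rdim N) *m l2 (comul H i) (fun j k => sN j *t rX k) =
    C *m l2 (comul H i) (fun j k => rX k *t sN j) *m flip_mx K (rdim X) (rdim N).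
  rewrite -!mulmxA; congr (_ *m _); rewrite l2_mulmxr l2_mulmxl.
  by apply: eq_l2 => j k; rewrite flip_tens.
rewrite [RHS]mulmxA; congr (_ *m _).
(* The coordinate functional of e_b: testing the Yetter-Drinfeld condition on it isolates the
   coefficient of the action of e_b on N. *)
pose d b : I -> K^o := fun k => (k == b)%:R.
have ydX := double_yetter_drinfeld H_hopf S_unit mX.
transitivity (\sum_b (l2 (comul H i) (fun j k => l1 (fun x => l1 (amul H x j) (d b))
   (fun x => fX x *m rX k))) *t sN b).
  rewrite l2_mulmxr sum_l1; under [RHS]eq_l1 do rewrite l2_tensl.
  rewrite l12C; apply: eq_l2 => j k; under [RHS]eq_l1 do rewrite l1_tensl l1_sum_scaleo.
  rewrite l11C l1_mulmxl; apply: eq_l1 => x.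
  rewrite tensmx_mul sNM l1_tensr [LHS]l1_sum_scale; apply: eq_l1 => b.
  by rewrite l1_deltar.
under eq_bigr do rewrite -ydX.
rewrite l2_mulmxl sum_l1; under eq_l1 do rewrite l2_tensl.
rewrite l12C; apply: eq_l2 => j k; under eq_l1 do rewrite l1_tensl l1_sum_scaleo.
rewrite l11C l1_mulmxr; apply: eq_l1 => x.
rewrite tensmx_mul [X in _ = _ *t X]sNM l1_tensr [RHS]l1_sum_scale; apply: eq_l1 => b.
by rewrite l1_deltar.
Qed.

End HalfBraiding.
End DoubleTensor.

(** * Induction to the double *)

Section Induction.
Variables (K : fieldType) (I : finType) (H : hopf K I).
Hypothesis H_hopf : is_hopf H.
Let H_bi := hopf_bialgebra H_hopf.
Let H_alg : is_algebra H. Proof. by case: H_bi. Qed.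
Let H_coalg : is_coalgebra H. Proof. by case: H_bi. Qed.
Let dH_alg : is_algebra (dual_algebra H) := dual_is_algebra H_coalg.
Hypothesis S_unit :
  (\matrix_(a < #|I|, b < #|I|) antipode H (enum_val a) (enum_val b)) \in unitmx.

Lemma mxI_mul (f g : I -> I -> K) :
  mxI f *m mxI g = mxI (fun x b => l1 (f x) (fun y => g y b : K^o)).
Proof.
apply/matrixP => p q; rewrite !mxE /l1 [RHS](reindex (@enum_val I predT)) /=.
  by apply: eq_bigr => k _; rewrite !mxE.
by exists enum_rank => x _; rewrite (enum_rankK, enum_valK).
Qed.

Lemma l1_mxI (A : finType) (c : A -> K) (f : A -> I -> I -> K) :
  l1 c (fun a => mxI (f a)) = mxI (fun x b => l1 c (fun a => f a x b : K^o)).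
Proof.
by apply/matrixP => p q; rewrite mxE /l1 summxE; apply: eq_bigr => a _; rewrite !mxE.
Qed.

Lemma l2_mxI (A B : finType) (c : A -> B -> K) (f : A -> B -> I -> I -> K) :
  l2 c (fun a b => mxI (f a b)) = mxI (fun x y => l2 c (fun a b => f a b x y : K^o)).
Proof.
rewrite l2E (l1_mxI _ (fun u => f u.1 u.2)); apply/matrixP => p q; rewrite !mxE.
by rewrite l2E.
Qed.

Lemma eq_mxI (f g : I -> I -> K) : (forall x y, f x y = g x y) -> mxI f = mxI g.
Proof. by move=> fg; apply/matrixP => p q; rewrite !mxE fg. Qed.

(* Translations of H^*: cotr_r h f = f(? h) and cotr_l h f = f(h ?). *)
Definition cotr_r h : 'M[K]_#|I| := mxI (fun x b => amul H x h b).
Definition cotr_l h : 'M[K]_#|I| := mxI (fun x b => amul H h x b).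
(** This is f |-> f(S^-1(h) ?). Left translation reverses products and S^-1 reverses them again, so
    it is a left action. *)
Definition cotr_T h : 'M[K]_#|I| := l1 (antipodeV H h) cotr_l.
Let mult a : 'M[K]_#|I| := regL (dual_algebra H) a.

Let amul_delta i j b : amul H i j b = l1 (amul H i j) (fun k => (k == b)%:R : K^o).
Proof. by rewrite l1_deltar. Qed.

Let cotr_rM i j : cotr_r i *m cotr_r j = l1 (amul H i j) cotr_r.
Proof.
rewrite mxI_mul (l1_mxI _ (fun h x b => amul H x h b)); apply: eq_mxI => x b.
transitivity (l1 (amul H x i) (fun y => l1 (amul H y j) (fun k => (k == b)%:R : K^o))).
  by apply: (eq_l1 (V := K^o)) => y; rewrite -amul_delta.
by rewrite (amulA H_alg); apply: (eq_l1 (V := K^o)) => y; rewrite -amul_delta.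
Qed.

Let cotr_lM i j : cotr_l i *m cotr_l j = l1 (amul H j i) cotr_l.
Proof.
rewrite mxI_mul (l1_mxI _ (fun h x b => amul H h x b)); apply: eq_mxI => x b.
transitivity (l1 (amul H i x) (fun y => l1 (amul H j y) (fun k => (k == b)%:R : K^o))).
  by apply: (eq_l1 (V := K^o)) => y; rewrite -amul_delta.
by rewrite -(amulA H_alg); apply: (eq_l1 (V := K^o)) => y; rewrite -amul_delta.
Qed.

Let cotr_lr i j : cotr_l i *m cotr_r j = cotr_r j *m cotr_l i.
Proof.
rewrite !mxI_mul; apply: eq_mxI => x b.
transitivity (l1 (amul H i x) (fun y => l1 (amul H y j) (fun k => (k == b)%:R : K^o))).
  by apply: (eq_l1 (V := K^o)) => y; rewrite -amul_delta.
by rewrite (amulA H_alg); apply: (eq_l1 (V := K^o)) => y; rewrite -amul_delta.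
Qed.

Let amul_1r x b : l1 (aone H) (fun h => amul H x h b : K^o) = (x == b)%:R.
Proof.
transitivity (l1 (aone H) (fun h => l1 (amul H x h) (fun k => (k == b)%:R : K^o))).
  by apply: (eq_l1 (V := K^o)) => h; rewrite -amul_delta.
by rewrite (amul1r H_alg).
Qed.

Let amul_1l x b : l1 (aone H) (fun h => amul H h x b : K^o) = (x == b)%:R.
Proof.
transitivity (l1 (aone H) (fun h => l1 (amul H h x) (fun k => (k == b)%:R : K^o))).
  by apply: (eq_l1 (V := K^o)) => h; rewrite -amul_delta.
by rewrite (amul1l H_alg).
Qed.

Lemma cotr_r_module : is_module H (Rep cotr_r).
Proof.
split=> [i j|]; first exact: cotr_rM.
transitivity (l1 (aone H) cotr_r); first by [].
rewrite (l1_mxI _ (fun h x b => amul H x h b)) -mxI1.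
by apply: eq_mxI => x b; rewrite amul_1r.
Qed.

Let cotr_l1 : l1 (aone H) cotr_l = 1%:M.
Proof.
rewrite (l1_mxI _ (fun h x b => amul H h x b)) -mxI1.
by apply: eq_mxI => x b; rewrite amul_1l.
Qed.

Lemma cotr_T_module : is_module H (Rep cotr_T).
Proof.
split=> [i j|] /=.
  rewrite -[RHS]/(l1 _ (fun k => l1 (antipodeV H k) cotr_l)).
  rewrite (antipodeVM H_hopf S_unit) l11C /cotr_T l1_mulmxl; apply: eq_l1 => a.
  by rewrite l1_mulmxr; apply: eq_l1 => b; rewrite cotr_lM.
rewrite -[LHS]/(l1 _ (fun k => l1 (antipodeV H k) cotr_l)).
by rewrite (antipodeV1 H_hopf S_unit) cotr_l1.
Qed.

Lemma cotr_comm i j : cotr_T j *m cotr_r i = cotr_r i *m cotr_T j.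
Proof. by rewrite l1_mulmxl l1_mulmxr; apply: eq_l1 => x; rewrite cotr_lr. Qed.

(** The convolution product is dual to a multiplicative coproduct, so (f f')(? h) = f(? h_1) f'(?
    h_2). The next two lemmas do the same for the other translations. *)
Let cotr_r_mult p (F : I -> K^o) : l1 F (fun x => cotr_r p *m mult x) =
  l2 (comul H p) (fun p1 p2 => l1 (fun y => l1 (amul H y p1) F)
    (fun y => mult y *m cotr_r p2)).
Proof.
transitivity (l2 (comul H p) (fun p1 p2 => l1 F (fun x => l1 (fun y => amul H y p1 x)
    (fun y => mult y *m cotr_r p2)))); last first.
  apply: eq_l2 => p1 p2; rewrite -l1_comp; apply: eq_bigr => y _; congr (_ *: _).
  by apply: eq_bigr => x _; exact: mulrC.
rewrite -l12C; apply: eq_l1 => x.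
pose G p1 p2 z b := l1 (fun y => amul H y p1 x)
   (fun y => l1 (comul H z y) (fun k => amul H k p2 b : K^o) : K^o).
transitivity (l2 (comul H p) (fun p1 p2 => mxI (G p1 p2))).
  rewrite mxI_mul (l2_mxI _ G); apply: eq_mxI => z b /=.
  have := comulM H_bi z p (fun u v => (u == x)%:R * (v == b)%:R : K^o).
  have e k : l2 (comul H k) (fun p q => (p == x)%:R * (q == b)%:R : K^o) = comul H k x b.
    rewrite /l2 (bigD1 x) //= [X in _ + X]big1 ?addr0 => [|p' /negbTE pc]; last first.
      by apply: big1 => q _; rewrite pc mul0r scaler0.
    rewrite (bigD1 b) //= [X in _ + X]big1 ?addr0 => [|q /negbTE qd]; last first.
      by rewrite qd mulr0 scaler0.
    by rewrite !eqxx /GRing.scale /= !mulr1.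
  under eq_l1 => k do rewrite e.
  move=> ->; rewrite l22C; apply: (eq_l2 (V := K^o)) => p1 p2.
  apply: eq_bigr => y _; rewrite /l1 scaler_sumr; apply: eq_bigr => k _.
  transitivity (comul H z y k * (amul H y p1 x * amul H k p2 b)).
    congr (_ * _).
    transitivity (l1 (amul H y p1) (fun u => (u == x)%:R * amul H k p2 b : K^o)).
      apply: (eq_l1 (V := K^o)) => u.
      by rewrite -[in RHS](l1_deltar (amul H k p2) b) [RHS](l1Z (V := K^o)).
    by rewrite -(l1_scal (V := K^o)) l1_deltar.
  by rewrite mulrCA.
apply: eq_l2 => p1 p2; rewrite /G -l1_mxI; apply: eq_l1 => y.
by rewrite mxI_mul; apply: eq_mxI.
Qed.

Let cotr_l_mult p (F : I -> K^o) : l1 F (fun x => cotr_l p *m mult x) =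
  l2 (comul H p) (fun p1 p2 => l1 (fun y => l1 (amul H p1 y) F)
    (fun y => mult y *m cotr_l p2)).
Proof.
transitivity (l2 (comul H p) (fun p1 p2 => l1 F (fun x => l1 (fun y => amul H p1 y x)
    (fun y => mult y *m cotr_l p2)))); last first.
  apply: eq_l2 => p1 p2; rewrite -l1_comp; apply: eq_bigr => y _; congr (_ *: _).
  by apply: eq_bigr => x _; exact: mulrC.
rewrite -l12C; apply: eq_l1 => x.
pose G p1 p2 z b := l1 (fun y => amul H p1 y x)
   (fun y => l1 (comul H z y) (fun k => amul H p2 k b : K^o) : K^o).
transitivity (l2 (comul H p) (fun p1 p2 => mxI (G p1 p2))).
  rewrite mxI_mul (l2_mxI _ G); apply: eq_mxI => z b /=.
  have := comulM H_bi p z (fun u v => (u == x)%:R * (v == b)%:R : K^o).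
  have e k : l2 (comul H k) (fun p q => (p == x)%:R * (q == b)%:R : K^o) = comul H k x b.
    rewrite /l2 (bigD1 x) //= [X in _ + X]big1 ?addr0 => [|p' /negbTE pc]; last first.
      by apply: big1 => q _; rewrite pc mul0r scaler0.
    rewrite (bigD1 b) //= [X in _ + X]big1 ?addr0 => [|q /negbTE qd]; last first.
      by rewrite qd mulr0 scaler0.
    by rewrite !eqxx /GRing.scale /= !mulr1.
  under eq_l1 => k do rewrite e.
  move=> ->; apply: (eq_l2 (V := K^o)) => p1 p2.
  apply: eq_bigr => y _; rewrite /l1 scaler_sumr; apply: eq_bigr => k _.
  transitivity (comul H z y k * (amul H p1 y x * amul H p2 k b)).
    congr (_ * _).
    transitivity (l1 (amul H p1 y) (fun u => (u == x)%:R * amul H p2 k b : K^o)).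
      apply: (eq_l1 (V := K^o)) => u.
      by rewrite -[in RHS](l1_deltar (amul H p2 k) b) [RHS](l1Z (V := K^o)).
    by rewrite -(l1_scal (V := K^o)) l1_deltar.
  by rewrite mulrCA.
apply: eq_l2 => p1 p2; rewrite /G -l1_mxI; apply: eq_l1 => y.
by rewrite mxI_mul; apply: eq_mxI.
Qed.

Let cotr_T_mult p (F : I -> K^o) : l1 F (fun x => cotr_T p *m mult x) =
  l2 (comul H p) (fun u v => l1 (fun y => l1 (antipodeV H v) (fun s => l1 (amul H s y) F))
    (fun y => mult y *m cotr_T u)).
Proof.
transitivity (l1 (antipodeV H p) (fun s => l1 F (fun x => cotr_l s *m mult x))).
  by rewrite l11C; apply: eq_l1 => x; rewrite /cotr_T l1_mulmxl.
under eq_l1 => s do rewrite cotr_l_mult.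
rewrite (antipodeV_comul H_hopf S_unit); apply: eq_l2 => u v.
rewrite [RHS](l1_comp (antipodeV H v) (fun s y => l1 (amul H s y) F)); apply: eq_l1 => s.
rewrite l11C; apply: eq_l1 => y.
by rewrite /cotr_T l1_mulmxr.
Qed.

Section Ind.
Variable M : rep K I.

(** The induced module lives on H^* (x) M: H^* multiplies the first factor and h (f (x) m) =
    f(S^-1(h_3) ? h_1) (x) h_2 m. *)
Definition ind_act : I -> 'M[K]_(#|I| * rdim M) := ract (twist H cotr_r cotr_T M).
Definition ind_dact a : 'M[K]_(#|I| * rdim M) := mult a *t 1%:M.
Definition ind : rep K (I * I)%type := drep ind_act ind_dact.

Lemma ind_dact_module : is_module (dual_algebra H) (Rep ind_dact).
Proof. exact: (free_rep_module (rdim M) dH_alg). Qed.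

(** Both translations distribute over products in H^* along the coproduct. This leaves a factor of
    the form h_2 S^-1(h_1), which cancels. *)
Lemma ind_yetter_drinfeld : yetter_drinfeld H ind_act ind_dact.
Proof.
move=> i F.
have aE k : ind_act k = l2 (comul H k) (fun a c => l2 (comul H a) (fun p q =>
  (cotr_r p *m cotr_T c) *t ract M q)) by [].
pose W u a := l2 (comul H a) (fun p q => l1 F (fun y => cotr_r p *m mult y *m cotr_T u) *t ract M q).
transitivity (l2 (comul H i) (fun a u => W u a)).
  transitivity (l2 (comul H i) (fun j k => l2 (comul H j) (fun a c =>
     l2 (comul H c) (fun u v => l2 (comul H a) (fun p q =>
       l1 (fun y => l1 (antipodeV H v) (fun s => l1 (amul H s y) (fun x => l1 (amul H k x) F)))
        (fun y => cotr_r p *m mult y *m cotr_T u) *t ract M q))))).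
    apply: eq_l2 => j k; rewrite -l1_mulmxr aE l2_mulmxl; apply: eq_l2 => a c.
    rewrite l22C l2_mulmxl; apply: eq_l2 => p q.
    rewrite -l2_tensl l1_mulmxr.
    transitivity ((cotr_r p *m l1 (fun x => l1 (amul H k x) F) (fun x => cotr_T c *m mult x)) *t ract M q).
      rewrite [in RHS]l1_mulmxr [RHS]l1_tensl; apply: eq_l1 => x.
      by rewrite tensmx_mul mulmx1 mulmxA.
    rewrite cotr_T_mult l2_mulmxr; congr (_ *t _); apply: eq_l2 => u v.
    by rewrite l1_mulmxr; apply: eq_l1 => y; rewrite mulmxA.
  rewrite (comulA H_coalg i (fun a c k => l2 (comul H c) (fun u v => l2 (comul H a) (fun p q =>
       l1 (fun y => l1 (antipodeV H v) (fun s => l1 (amul H s y) (fun x => l1 (amul H k x) F)))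
        (fun y => cotr_r p *m mult y *m cotr_T u) *t ract M q)))).
  apply: eq_l2 => a w.
  rewrite (comulA H_coalg w (fun u v k => l2 (comul H a) (fun p q =>
       l1 (fun y => l1 (antipodeV H v) (fun s => l1 (amul H s y) (fun x => l1 (amul H k x) F)))
        (fun y => cotr_r p *m mult y *m cotr_T u) *t ract M q))).
  transitivity (l2 (comul H w) (fun u m => counit H m *: W u a)).
    apply: eq_l2 => u m; rewrite l22C /W l2Z; apply: eq_l2 => p q.
    rewrite -l2_tensl -tensmxZl; congr (_ *t _).
    rewrite -l2_comp l1Z; apply: eq_bigr => y _; rewrite scalerA mulrC.
    congr (_ *: _).
    transitivity (l2 (comul H m) (fun v k => l1 (antipodeV H v) (fun s =>
      l1 (amul H k s) (fun z => l1 (amul H z y) F)))).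
      apply: (eq_l2 (V := K^o)) => v k; apply: (eq_l1 (V := K^o)) => s.
      by rewrite (amulA H_alg).
    rewrite (antipodeVR H_hopf S_unit) (amul1l H_alg); by [].
  by rewrite (comul1r H_coalg w (fun u => W u a)).
transitivity (l2 (comul H i) (fun a u => l2 (comul H a) (fun b q => l2 (comul H b) (fun j p =>
   l1 (fun y => l1 (amul H y j) F) (fun y => mult y *m cotr_r p *m cotr_T u) *t ract M q)))).
  apply: eq_l2 => a u; apply: eq_l2 => p q.
  rewrite -l1_mulmxl cotr_r_mult l2_mulmxl l2_tensl; apply: eq_l2 => p1 p2.
  by rewrite l1_mulmxl.
under eq_l2 => a u do rewrite (comulA H_coalg).
rewrite (comulA H_coalg i (fun j a' u => l2 (comul H a') (fun p q =>
   l1 (fun y => l1 (amul H y j) F) (fun y => mult y *m cotr_r p *m cotr_T u) *t ract M q))).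
apply: eq_l2 => j k; rewrite -l1_mulmxl aE l2_mulmxr; apply: eq_l2 => a c.
rewrite l2_mulmxr; apply: eq_l2 => p q.
rewrite l1_mulmxl l1_tensl; apply: eq_l1 => y.
by rewrite tensmx_mul mul1mx mulmxA.
Qed.

Hypothesis mM : is_module H M.

Lemma ind_act_module : is_module H (Rep ind_act).
Proof. exact: (twist_module H_hopf cotr_r_module cotr_T_module cotr_comm mM). Qed.

Lemma ind_module : is_module (double H) ind.
Proof.
exact: (drep_module H_hopf S_unit ind_act_module ind_dact_module ind_yetter_drinfeld).
Qed.

Lemma res_ind : res H ind = twist H cotr_r cotr_T M.
Proof. exact: (res_drep _ ind_dact_module). Qed.

Lemma dact_ind a : dact H ind a = ind_dact a.
Proof. exact: (dact_drep _ _ ind_act_module). Qed.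

End Ind.
End Induction.

Lemma brow_bin1 (K : fieldType) (I : finType) m : brow (bin K m) = 1%:M :> 'M_(#|I| * m).
Proof.
rewrite -tensmx11 -mxI1 tens_bcol_brow; apply/matrixP => p q.
by rewrite !mxE eq_sym.
Qed.

(** * Free modules, Frobenius reciprocity and the projection formula *)

Section FreeModules.
Variables (K : fieldType) (I : finType) (A : algebra K I).
Hypothesis A_alg : is_algebra A.

Lemma brow_regL_hom m (N : rep K I) (y : 'M_(rdim N, m)) : is_module A N ->
  @is_hom K I (free_rep A m) N (brow (fun i => ract N i *m y)).
Proof.
move=> mN i; rewrite brow_tens mul_brow; apply: eq_brow => j.
rewrite mulmxA mN.1 -/(l1 _ _) l1_mulmxl; apply: eq_bigr => k _.
by rewrite mulmx1.
Qed.

Lemma free_rep_projective m : projective A (free_rep A m).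
Proof.
split=> [|M N g f mM mN hg hf /mx_surjP[t gt]]; first exact: free_rep_module.
(* The generators 1 (x) v; a module map out of the free module is determined by its values there. *)
pose u : 'M[K]_(#|I| * m, m) := bcol (fun k => aone A k *: 1%:M).
exists (brow (fun i => ract M i *m (t *m f *m u))); first exact: brow_regL_hom.
have fE : f = brow (fun i => f *m bin K m i).
  by rewrite -mul_brow brow_bin1 mulmx1.
rewrite mul_brow [RHS]fE; apply: eq_brow => i.
rewrite mulmxA hg -mulmxA [g *m _]mulmxA [g *m (t *m _)]mulmxA gt mul1mx.
rewrite mulmxA -hf -mulmxA; congr (_ *m _).
rewrite tens_bcol; apply: eq_bcol => k.
transitivity (l1 (fun j => amul A i j k) (aone A : I -> K^o) *: (1%:M : 'M[K]_m)).
  by rewrite l1_scal; apply: eq_l1 => j; rewrite mul1mx.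
congr (_ *: _).
transitivity (l1 (aone A) (fun j => l1 (amul A i j) (fun x => (x == k)%:R : K^o))).
  by apply: eq_bigr => j _; rewrite l1_deltar; exact: mulrC.
by rewrite (amul1r A_alg).
Qed.

End FreeModules.

Section InductionRestriction.
Variables (K : fieldType) (I : finType) (H : hopf K I).
Hypothesis H_hopf : is_hopf H.
Let H_bi := hopf_bialgebra H_hopf.
Let H_alg : is_algebra H. Proof. by case: H_bi. Qed.
Let H_coalg : is_coalgebra H. Proof. by case: H_bi. Qed.
Let dH_alg : is_algebra (dual_algebra H) := dual_is_algebra H_coalg.
Hypothesis S_unit :
  (\matrix_(a < #|I|, b < #|I|) antipode H (enum_val a) (enum_val b)) \in unitmx.
Implicit Types (M N : rep K I) (X Y Z : rep K (I * I)%type).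

(** The double is generated by H and H^*, so linearity can be checked on each. *)
Lemma double_hom X Y (f : 'M_(rdim Y, rdim X)) :
  is_module (double H) X -> is_module (double H) Y ->
  @is_hom K I (res H X) (res H Y) f ->
  (forall a, f *m dact H X a = dact H Y a *m f) -> is_hom f.
Proof.
move=> mX mY hf df [a i]; rewrite !(ract_double H_hopf S_unit) //.
by rewrite mulmxA df -mulmxA [f *m _]hf mulmxA.
Qed.

Lemma res_hom X Y (f : 'M_(rdim Y, rdim X)) :
  is_hom f -> @is_hom K I (res H X) (res H Y) f.
Proof.
move=> hf i; rewrite -[ract (res H X) i]/(l1 _ (fun a => _)) l1_mulmxr.
rewrite -[ract (res H Y) i]/(l1 _ (fun a => _)) l1_mulmxl.
by apply: eq_l1 => a; rewrite hf.
Qed.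

Lemma dact_hom X Y (f : 'M_(rdim Y, rdim X)) a :
  is_hom f -> f *m dact H X a = dact H Y a *m f.
Proof. by move=> hf; rewrite l1_mulmxr l1_mulmxl; apply: eq_l1 => i; rewrite hf. Qed.

Lemma cotr_coef p c : cotr_r H p *m cotr_T H c =
  mxI (fun x b => double_coef H (fun k => (k == b)%:R) x p c).
Proof.
rewrite /cotr_T l1_mulmxr.
pose G s x b := l1 (amul H x p) (fun y => l1 (amul H s y) (fun k => (k == b)%:R : K^o)).
transitivity (l1 (antipodeV H c) (fun s => mxI (G s))).
  apply: eq_l1 => s; rewrite mxI_mul; apply: eq_mxI => x b.
  by apply: (eq_l1 (V := K^o)) => y; rewrite l1_deltar.
etransitivity; first exact: (l1_mxI _ G).
apply: eq_mxI => x b; apply: (eq_l1 (V := K^o)) => s.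
by rewrite (amulA H_alg).
Qed.

Lemma ract_res_ind M i : ract (res H (ind H M)) i =
  l2 (comul H i) (fun p t => l2 (comul H t) (fun q r =>
    mxI (fun x b => double_coef H (fun k => (k == b)%:R) x p r) *t ract M q)).
Proof.
rewrite ract_res_drep; last exact: ind_dact_module.
rewrite /ind_act /= (comulA H_coalg i (fun p q c => (cotr_r H p *m cotr_T H c) *t ract M q)).
by apply: eq_l2 => p t; apply: eq_l2 => q r; rewrite cotr_coef.
Qed.

(* Frobenius reciprocity: f (x) m |-> f . g(m) for g : M -> res Z.             *)
Definition ind_adj M Z (g : 'M_(rdim Z, rdim M)) : 'M_(rdim Z, rdim (ind H M)) :=
  brow (fun a => dact H Z a *m g).

Lemma ind_adj_hom M Z (g : 'M_(rdim Z, rdim M)) :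
  is_module H M -> is_module (double H) Z -> @is_hom K I M (res H Z) g ->
  is_hom (ind_adj g).
Proof.
move=> mM mZ hg; have mI := ind_module H_hopf S_unit mM.
apply: double_hom => // [i|a].
  have /yetter_drinfeldP dc := double_yetter_drinfeld H_hopf S_unit mZ.
  rewrite ract_res_ind mul_brow l2_mulmxr.
  transitivity (brow (fun b => l2 (comul H i) (fun p t => l2 (comul H t) (fun q r =>
    l1 (fun x => double_coef H (fun k => (k == b)%:R) x p r) (fun x =>
      dact H Z x *m g *m ract M q))))).
    rewrite (brow_l2 _ (fun p t b => l2 (comul H t) (fun q r =>
      l1 (fun x => double_coef H (fun k => (k == b)%:R) x p r) (fun x =>
      dact H Z x *m g *m ract M q)))); apply: eq_l2 => p t.
    rewrite l2_mulmxr (brow_l2 _ (fun q r b => 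
      l1 (fun x => double_coef H (fun k => (k == b)%:R) x p r) (fun x =>
      dact H Z x *m g *m ract M q))); apply: eq_l2 => q r.
    by rewrite brow_tens.
  apply: eq_brow => b; rewrite mulmxA.
  have -> : dact H Z b = l1 (fun k => (k == b)%:R : K^o) (dact H Z).
    rewrite -[LHS](l1_delta b (dact H Z)); apply: eq_bigr => k _.
    by rewrite eq_sym.
  rewrite dc // l2_mulmxl; apply: eq_l2 => p t; rewrite l2_mulmxl; apply: eq_l2 => q r.
  rewrite l1_mulmxl; apply: eq_l1 => x.
  by rewrite -!mulmxA; congr (_ *m _); exact: hg.
rewrite (dact_ind H_hopf) // mul_brow brow_tens; apply: eq_brow => j.
rewrite mulmxA (dact_module H_hopf S_unit mZ).1 -/(l1 _ _) l1_mulmxl.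
by apply: eq_l1 => k; rewrite mulmx1.
Qed.

(** The counit of H is the unit of H^*, so this is m |-> 1 (x) m, the unit of the adjunction. *)
Definition ind_unit M : 'M_(rdim (ind H M), rdim M) := bcol (fun a => counit H a *: 1%:M).

Lemma ind_unit_hom M : @is_hom K I M (res H (ind H M)) (ind_unit M).
Proof.
move=> i; rewrite ract_res_ind bcol_mul l2_mulmxl.
transitivity (l2 (comul H i) (fun p t => l2 (comul H t) (fun q r =>
  bcol (fun x => (counit H p * counit H r) *: (counit H x *: ract M q))))).
  pose F q : 'M_(#|I| * rdim M, rdim M) := bcol (fun x => counit H x *: ract M q).
  have FE c q : bcol (fun x => c *: (counit H x *: ract M q)) = c *: F q.
    by apply/matrixP => a b; rewrite !mxE.
  transitivity (l2 (comul H i) (fun p t => counit H p *: l2 (comul H t) (fun q r => counit H r *: F q))).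
    under [RHS]eq_l2 => p t do rewrite (comul1r H_coalg t F).
    rewrite (comul1l H_coalg i F); apply: eq_bcol => x.
    by rewrite -scalemxAl mul1mx.
  by apply: eq_l2 => p t; rewrite l2Z; apply: eq_l2 => q r; rewrite FE scalerA.
apply: eq_l2 => p t; rewrite l2_mulmxl; apply: eq_l2 => q r.
rewrite tens_bcol; apply: eq_bcol => x.
rewrite scalerA -(double_coef_counit H_hopf S_unit) -double_coef_delta l1_scal.
apply: eq_bigr => b _; rewrite -scalemxAr mulmx1 !scalerA mulrC.
by [].
Qed.

Lemma ind_dact_unit M a : ind_dact H M a *m ind_unit M = bin K (rdim M) a.
Proof.
have [_ _ c1r] := H_coalg.
rewrite tens_bcol; apply: eq_bcol => k.
transitivity (l1 (comul H k a) (counit H : I -> K^o) *: (1%:M : 'M[K]_(rdim M))).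
  by rewrite l1_scal; apply: eq_l1 => j; rewrite mul1mx.
by rewrite eq_sym -c1r.
Qed.

Lemma ind_adj_unit M Z (g : 'M_(rdim Z, rdim M)) :
  is_module (double H) Z -> ind_adj g *m ind_unit M = g.
Proof.
move=> mZ; rewrite brow_bcol -[RHS]mul1mx.
have <- : l1 (counit H) (dact H Z) = 1%:M := (dact_module H_hopf S_unit mZ).2.
by rewrite l1_mulmxl; apply: eq_bigr => a _; rewrite -scalemxAr mulmx1.
Qed.

Lemma ind_adj_eta M Z (f : 'M_(rdim Z, rdim (ind H M))) : is_module H M ->
  is_hom f -> ind_adj (f *m ind_unit M) = f.
Proof.
move=> mM hf; rewrite -[RHS]mulmx1 -brow_bin1 mul_brow; apply: eq_brow => a.
by rewrite mulmxA -(dact_hom a hf) -mulmxA (dact_ind H_hopf) // ind_dact_unit.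
Qed.

Lemma ind_fmap_hom M N (f : 'M_(rdim N, rdim M)) :
  is_hom f -> @is_hom K _ (ind H M) (ind H N) (1%:M *t f).
Proof.
move=> hf u /=; rewrite mulmxA /ind_dact tensmx_mul mul1mx mulmx1.
rewrite -[in X in X *m _](mul1mx f) -[X in (X *t _) *m _]mulmx1 -tensmx_mul -!mulmxA.
congr (_ *m _); rewrite /ind_act /= l2_mulmxr l2_mulmxl; apply: eq_l2 => a c.
rewrite l2_mulmxr l2_mulmxl; apply: eq_l2 => p q.
by rewrite !tensmx_mul mul1mx mulmx1 hf.
Qed.

(** Ind is left adjoint to Res, and Res keeps surjections: transpose the lifting problem, solve it
    over H and transpose back. *)
Lemma ind_projective P : projective H P -> projective (double H) (ind H P).
Proof.
move=> [mP P_lift]; split=> [|X Y g f mX mY hg hf g_surj]; first exact: ind_module.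
have hf0 : @is_hom K I P (res H Y) (f *m ind_unit P).
  apply: (@is_hom_mul _ _ P (res H (ind H P)) (res H Y)); first exact: ind_unit_hom.
  exact: res_hom.
have [h hh gh] := P_lift (res H X) (res H Y) g _ (res_module H_hopf S_unit mX)
  (res_module H_hopf S_unit mY) (res_hom hg) hf0 g_surj.
exists (ind_adj (h : 'M_(rdim X, _))); first exact: ind_adj_hom.
rewrite -[RHS](ind_adj_eta mP hf) mul_brow; apply: eq_brow => a.
by rewrite mulmxA (dact_hom a hg) -mulmxA gh.
Qed.

Definition ind_functor : exact_functor H (double H).
Proof.
exists (ind H) (fun M N f => 1%:M *t f).
- by move=> M; rewrite tensmx11.
- by move=> M N P f g; rewrite tensmx_mul mulmx1.
- by move=> M N f g; exact: (linearB (tensmx _)).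
- by move=> M N f; exact: ind_fmap_hom.
- by move=> M; exact: ind_module.
- by move=> M; exact: ind_projective.
Defined.

(** Cover Res X by a free module F. The adjoint map Ind F -> X is surjective, hence splits, so Res X
    is a retract of Res Ind F, which is a twist of F. *)
Lemma res_projective X : projective (double H) X -> projective H (res H X).
Proof.
move=> pX; have mX := pX.1; have mrX := res_module H_hopf S_unit mX.
pose F := free_rep H (rdim X); have pF : projective H F := free_rep_projective H_alg _.
have [hc /mx_surjP[s cs]] := free_rep_cover mrX.
pose c : 'M_(rdim X, rdim F) := brow (ract (res H X)).
have hic := ind_adj_hom pF.1 mX (hc : @is_hom K I F (res H X) c).
have c_surj : mx_surj (ind_adj c).
  apply/mx_surjP; exists (ind_unit F *m s); rewrite mulmxA ind_adj_unit //.
have [sec hsec csec] := pX.2 _ _ _ 1%:M (ind_module H_hopf S_unit pF.1) mX hic (@is_hom1 _ _ X) c_surj.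
apply: (@retract_projective _ _ _ _ (res H (ind H F))) => //.
  rewrite (res_ind H_hopf); apply: twist_projective => //.
  - exact: cotr_r_module.
  - exact: cotr_T_module.
  - exact: cotr_comm.
exists sec, (ind_adj c); split=> //; exact: res_hom.
Qed.

Definition res_functor : exact_functor (double H) H.
Proof.
exists (res H) (fun X Y f => f) => //.
- by move=> X Y f; exact: res_hom.
- by move=> X; exact: res_module.
- by move=> X; exact: res_projective.
Defined.

Lemma mulmx1C_eq m n (A : 'M[K]_(m, n)) (B : 'M[K]_(n, m)) :
  m = n -> A *m B = 1%:M -> B *m A = 1%:M.
Proof. by move=> e; case: n / e in A B *; exact: mulmx1C. Qed.

Section IndTens.
Variables (X : rep K (I * I)%type) (N : rep K I).
Hypotheses (mX : is_module (double H) X) (mN : is_module H N).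

Let Z := tens (double H) X (ind H N).
Let M := tens H (res H X) N.
Let fX := dact H X.
Let mI := ind_module H_hopf S_unit mN.
Let mZ : is_module (double H) Z := double_tens_module H_hopf S_unit mX mI.
Let mM : is_module H M := tens_module H_hopf (res_module H_hopf S_unit mX) mN.

Let fXM a b : fX a *m fX b = l1 (amul (dual_algebra H) a b) fX.
Proof. exact: (dact_module H_hopf S_unit mX).1. Qed.

Let g : 'M_(rdim Z, rdim M) := 1%:M *t ind_unit N.

Let g_hom : @is_hom K I M (res H Z) g.
Proof.
move=> i; rewrite (ract_res_tens H_hopf S_unit mX mI).
exact: (@tens_hom _ _ H (res H X) N (res H X) (res H (ind H N)) 1%:M (ind_unit N)
  (@is_hom1 _ _ _) (@ind_unit_hom N)).
Qed.

(** The component at e^c of the inverse v (x) f (x) n |-> f_1 (x) S(f_2) v (x) n, where S(f) = f o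
    S. *)
Let psi c : 'M_(rdim M, rdim Z) := l2 (fun b d => amul H c d b)
  (fun b d => l1 (fun y => antipode H y d) fX *t bpr K (rdim N) b).

Let psi_g c a : psi c *m (dact H Z a *m g) = (c == a)%:R *: 1%:M.
Proof.
rewrite (dact_tens H_hopf S_unit mX mI).
transitivity (psi c *m l2 (fun a' b => amul H b a' a) (fun a' b => fX a' *t bin K (rdim N) b)).
  congr (_ *m _); rewrite l2_mulmxl; apply: eq_l2 => a' b.
  by rewrite tensmx_mul mulmx1 (dact_ind H_hopf) // ind_dact_unit.
transitivity (\sum_b \sum_d \sum_a' (amul H c d b * amul H b a' a) *:
    ((l1 (fun y => antipode H y d) fX *m fX a') *t (1%:M : 'M_(rdim N)))).
  rewrite l2_mulmxl; apply: eq_bigr => b _; apply: eq_bigr => d _.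
  rewrite l2_mulmxr /l2 scaler_sumr; apply: eq_bigr => a' _.
  rewrite -scalerA; congr (_ *: _).
  rewrite -[RHS](l1_delta b (fun b' => amul H b' a' a *: (_ *t _))).
  apply: eq_bigr => b' _; rewrite tensmx_mul bpr_bcol tensmxZr !scalerA.
  by rewrite mulrC eq_sym.
transitivity (\sum_z (l2 (comul H z) (fun y a' => l1 (antipode H y) (fun d =>
    l1 (amul H c d) (fun b => amul H b a' a : K^o)))) *: (fX z *t (1%:M : 'M_(rdim N)))).
  transitivity (\sum_b \sum_d \sum_a' \sum_y \sum_z
     (amul H c d b * amul H b a' a * antipode H y d * comul H z y a') *:
     (fX z *t (1%:M : 'M_(rdim N)))).
    apply: eq_bigr => b _; apply: eq_bigr => d _; apply: eq_bigr => a' _.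
    rewrite l1_mulmxl l1_tensl scaler_sumr; apply: eq_bigr => y _.
    rewrite fXM l1_tensl !scaler_sumr; apply: eq_bigr => z _.
    by rewrite !scalerA !mulrA.
  under eq_bigr do under eq_bigr do under eq_bigr do rewrite exchange_big.
  under eq_bigr do under eq_bigr do rewrite exchange_big.
  under eq_bigr do rewrite exchange_big.
  rewrite exchange_big; apply: eq_bigr => z _ /=.
  rewrite /l2 scaler_suml.
  under [RHS]eq_bigr do rewrite scaler_suml.
  under eq_bigr do under eq_bigr do rewrite exchange_big.
  under eq_bigr do rewrite exchange_big.
  rewrite exchange_big; apply: eq_bigr => y _ /=.
  under eq_bigr do rewrite exchange_big.
  rewrite exchange_big; under [RHS]eq_bigr do rewrite /l1 scaler_sumr scaler_suml.
  rewrite [LHS](_ : _ = \sum_a' \sum_d \sum_b (amul H c d b * amul H b a' a * antipode H y d * comul H z y a') *: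
     (fX z *t (1%:M : 'M_(rdim N)))); last first.
    by apply: eq_bigr => a1 _; rewrite exchange_big.
  apply: eq_bigr => a' _; apply: eq_bigr => d _.
  rewrite -scaler_suml; congr (_ *: _).
  by rewrite /GRing.scale /= !mulr_sumr; apply: eq_bigr => b _; ring.
transitivity (l1 (counit H) fX *t ((c == a)%:R *: (1%:M : 'M_(rdim N)))); last first.
  have -> : l1 (counit H) fX = 1%:M := (dact_module H_hopf S_unit mX).2.
  by rewrite tensmxZr tensmx11.
rewrite l1_tensl; apply: eq_bigr => z _; rewrite tensmxZr scalerA; congr (_ *: _).
transitivity (l2 (comul H z) (fun y a' => l1 (antipode H y) (fun d =>
    l1 (amul H d a') (fun t => l1 (amul H c t) (fun k => (k == a)%:R : K^o))))).
  apply: (eq_l2 (V := K^o)) => y a'; apply: (eq_l1 (V := K^o)) => d.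
  rewrite -(amulA H_alg); apply: (eq_l1 (V := K^o)) => b.
  by rewrite l1_deltar.
by rewrite (antipodeL H_hopf) (amul1r H_alg).
Qed.

(** The map adjoint to id (x) [ind_unit] is f (x) v (x) n |-> f_2 v (x) f_1 (x) n. The antipode
    gives a left inverse, which is two-sided since the dimensions agree. *)
Lemma ind_tens_iso : iso (ind H M) Z.
Proof.
pose f := ind_adj g; pose p : 'M_(rdim (ind H M), rdim Z) := bcol psi.
have pf : p *m f = 1%:M.
  rewrite mul_brow; apply/esym; rewrite -brow_bin1; apply: eq_brow => a.
  rewrite bcol_mul; apply: eq_bcol => c; rewrite psi_g.
  by rewrite eq_sym.
exists f, p; split=> //; first exact: ind_adj_hom.
by apply: mulmx1C_eq pf; rewrite /= mulnCA.
Qed.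

End IndTens.
End InductionRestriction.

(** * The unit object as a retract of an induced module *)

Section UnitObject.
Variables (K : fieldType) (I : finType) (H : hopf K I).
Hypothesis H_hopf : is_hopf H.
Let H_bi := hopf_bialgebra H_hopf.
Let H_alg : is_algebra H. Proof. by case: H_bi. Qed.
Let H_coalg : is_coalgebra H. Proof. by case: H_bi. Qed.
Hypothesis S_unit :
  (\matrix_(a < #|I|, b < #|I|) antipode H (enum_val a) (enum_val b)) \in unitmx.

Let kD := triv_rep (double H) 1.
Let k := triv_rep H 1.

Let unit_drep : kD = drep (ract k) (fun a => aone H a *: 1%:M).
Proof.
congr Rep; apply/funext => u /=.
by rewrite -scalemxAl mul1mx scalerA.
Qed.

Lemma unit_dact_module : is_module (dual_algebra H) (Rep (fun a => aone H a *: (1%:M : 'M[K]_1))).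
Proof.
split=> [a b|] /=.
  rewrite -scalemxAl mul1mx scalerA -[RHS](l1_scal (fun k => comul H k a b) (aone H : I -> K^o)).
  congr (_ *: _).
  have := comul1 H_bi (fun p q => (p == a)%:R * (q == b)%:R : K^o).
  under eq_l1 => c do rewrite l2_deltar.
  move=> e2; transitivity (l1 (aone H) (fun k => comul H k a b : K^o)); last first.
    by apply: eq_bigr => c _; exact: mulrC.
  rewrite e2.
  transitivity (l1 (aone H) (fun p => (p == a)%:R * aone H b : K^o)).
    by rewrite -(l1_scal (V := K^o)) l1_deltar.
  apply: (eq_l1 (V := K^o)) => p.
  by rewrite -[in LHS](l1_deltar (aone H) b) [LHS](l1Z (V := K^o)).
rewrite -[LHS](l1_scal (counit H) (aone H : I -> K^o)) -[RHS]scale1r -(counit1 H_bi).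
by congr (_ *: _); apply: eq_bigr => c _; exact: mulrC.
Qed.

Lemma double_unit_module : is_module (double H) kD.
Proof.
rewrite unit_drep; apply: drep_module => //; [exact: triv_rep_module|exact: unit_dact_module|].
move=> i F.
transitivity (F i *: (1%:M : 'M[K]_1)).
  transitivity (l2 (comul H i) (fun j k => counit H j *: (F k *: (1%:M : 'M[K]_1)))).
    apply: eq_l2 => j c.
    transitivity (l1 (fun x => l1 (amul H c x) F) (aone H : I -> K^o) *: (counit H j *: (1%:M : 'M[K]_1))).
      by rewrite l1_scal; apply: eq_l1 => x; rewrite /= -scalemxAr mulmx1.
    rewrite scalerA mulrC -scalerA; congr (_ *: (_ *: _)).
    transitivity (l1 (aone H) (fun x => l1 (amul H c x) F)).
      by apply: eq_bigr => x _; exact: mulrC.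
    by rewrite (amul1r H_alg).
  by rewrite (comul1l H_coalg i (fun k => F k *: (1%:M : 'M[K]_1))).
transitivity (l2 (comul H i) (fun j k => counit H k *: (F j *: (1%:M : 'M[K]_1)))).
  by rewrite (comul1r H_coalg i (fun k => F k *: (1%:M : 'M[K]_1))).
apply: eq_l2 => j c.
transitivity (l1 (fun x => l1 (amul H x j) F) (aone H : I -> K^o) *: (counit H c *: (1%:M : 'M[K]_1))).
  rewrite scalerA mulrC -scalerA; congr (_ *: (_ *: _)).
  transitivity (l1 (aone H) (fun x => l1 (amul H x j) F)).
    by rewrite (amul1l H_alg).
  by apply: eq_bigr => x _; exact: mulrC.
by rewrite l1_scal; apply: eq_l1 => x; rewrite /= -scalemxAl mul1mx.
Qed.

Let res_unit i : ract (res H kD) i = ract k i.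
Proof.
rewrite -[RHS](ract_res_drep _ i unit_dact_module).
by apply: eq_l1 => a; rewrite /= -scalemxAl mul1mx scalerA.
Qed.

Let dact_unit a : dact H kD a = aone H a *: 1%:M.
Proof.
rewrite /dact /= -[in RHS](mulr1 (aone H a)) -(counit1 H_bi) -scalerA l1_scal l1Z.
by apply: eq_l1 => i; rewrite scalerA.
Qed.

Lemma double_tens_unit X : iso (tens (double H) X kD) X.
Proof.
apply: tens_unit_iso => u v.
have [_ _ c1r] := H_coalg.
transitivity (\sum_b \sum_j (amul H b v.1 u.1 * comul H u.2 v.2 j * (aone H b * counit H j))).
  by rewrite pair_bigA; apply: eq_bigr => -[].
transitivity ((v.1 == u.1)%:R * (u.2 == v.2)%:R : K).
  rewrite -(c1r u.2 v.2); have <- := amul1l H_alg v.1 (fun x => (x == u.1)%:R : K^o).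
  rewrite mulr_suml; apply: eq_bigr => b _; rewrite mulr_sumr; apply: eq_bigr => j _.
  by rewrite l1_deltar /GRing.scale /=; ring.
by rewrite -natrM mulnb eq_sym -xpair_eqE; case: u v => [a b] [c d].
Qed.

Lemma tens_unit M : iso (tens H M k) M.
Proof. by apply: tens_unit_iso; case: H_coalg. Qed.

(** In Ind k = H^* the functional lam spans a copy of the unit object: [lamL] is invariance under
    H^* and [lamJ] invariance under H. By [lam1] the canonical map f |-> f(1) sends it to 1. *)
Variable lam : I -> K.
Hypothesis lam1 : l1 (aone H) (lam : I -> K^o) = 1.
Hypothesis lamL : forall (V : lmodType K) i (F : I -> V),
  l2 (comul H i) (fun a b => lam b *: F a) = lam i *: l1 (aone H) F.
Hypothesis lamJ : forall i x,
  l2 (comul H i) (fun p r => double_coef H lam x p r : K^o) = counit H i * lam x.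

Let lam_comul i a : \sum_j comul H i a j * lam j = lam i * aone H a.
Proof.
rewrite -[RHS]/(lam i *: (aone H a : K^o)) -(l1_deltar (aone H) a) -lamL.
rewrite /l2 exchange_big; apply: eq_bigr => j _ /=.
rewrite -(l1_deltar ((comul H i)^~ j) a) mulr_suml; apply: eq_bigr => b _.
by rewrite /GRing.scale /=; ring.
Qed.

(* The splitting of the canonical map Ind k = H^* -> k is 1 |-> lam. *)
Lemma unit_retract_ind : retract kD (ind H k).
Proof.
have mk : is_module H k by exact: triv_rep_module.
have mI := ind_module H_hopf S_unit mk.
pose g : 'M[K]_(rdim kD, rdim k) := 1%:M.
have hg : @is_hom K I k (res H kD) g.
  by move=> i; rewrite res_unit mul1mx mulmx1.
exists (bcol (fun a => lam a *: 1%:M)), (@ind_adj K I H k kD g); split.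
- apply: (double_hom H_hopf S_unit double_unit_module mI) => [i|a].
    rewrite res_unit (ract_res_ind H_hopf) /= l2_mulmxl.
    transitivity (l2 (comul H i) (fun p r => bcol (fun x => double_coef H lam x p r *: (1%:M : 'M[K]_1)))).
      rewrite -(bcol_l2 (comul H i) (fun p r x => double_coef H lam x p r *: (1%:M : 'M[K]_1))).
      rewrite bcol_mul; apply: eq_bcol => x.
      by rewrite -scalemxAl mul1mx scalerA mulrC -lamJ l2_scal.
    apply: eq_l2 => p t; rewrite l2_mulmxl.
    transitivity (l2 (comul H t) (fun q r => counit H q *: bcol (fun x => double_coef H lam x p r *: (1%:M : 'M[K]_1)))).
      by rewrite (comul1l H_coalg t (fun r => bcol (fun x => double_coef H lam x p r *: (1%:M : 'M[K]_1)))).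
    apply: eq_l2 => q r; rewrite tens_bcol.
    apply/matrixP => a b; rewrite !mxE -double_coef_delta.
    rewrite /l1 mulr_suml mulr_sumr !summxE; apply: eq_bigr => c _.
    by rewrite /= -scalemxAl mul1mx !mxE /GRing.scale /=; ring.
  rewrite dact_unit (dact_ind H_hopf) // tens_bcol bcol_mul; apply: eq_bcol => x.
  rewrite -scalemxAr mulmx1 scalerA mulrC -lam_comul scaler_suml.
  by apply: eq_bigr => j _; rewrite mul1mx scalerA.
- exact: (ind_adj_hom H_hopf S_unit mk double_unit_module hg).
rewrite brow_bcol -[RHS]scale1r -[X in X *: _]lam1 scaler_suml; apply: eq_bigr => a _.
by rewrite dact_unit -scalemxAr mulmx1 /g mulmx1 scalerA mulrC.
Qed.

End UnitObject.

(** * Transfer of thick ideals and primes *)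

Section ThickIdeals.
Variables (K : fieldType) (I : finType) (H : hopf K I).
Implicit Types (M N X Y : rep K I) (J P : set (rep K I)).

Lemma thick_ideal_subcat J : thick_ideal H J -> thick_subcat H J.
Proof. by case=> tJ sJ _; split. Qed.

Lemma thick_ideal_module J M : thick_ideal H J -> J M -> is_module H M.
Proof. by case=> -[mJ _ _ _ _ _] _ _; exact: mJ. Qed.

Lemma thick_ideal_retract J M N : thick_ideal H J -> is_module H M ->
  retract M N -> J N -> J M.
Proof. by case=> tJ sJ _; apply: thick_retract tJ sJ. Qed.

Lemma thick_ideal_iso J M N : thick_ideal H J -> is_module H M -> is_module H N ->
  iso M N -> J M <-> J N.
Proof.
move=> tJ mM mN MN; split; apply: (thick_ideal_retract tJ) => //.
  exact/iso_retract/iso_sym.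
exact: iso_retract.
Qed.

Lemma bigcap_thick_subcat (A : Type) (F : A -> set (rep K I)) :
  (forall a, thick_subcat H (F a)) ->
  thick_subcat H [set M | is_module H M /\ forall a, F a M]%classic.
Proof.
move=> tF; split; first split.
- by move=> M [].
- move=> M N mN MN [mM FM]; split=> // a.
  by case: (tF a) => -[_ Fi _ _ _ _] _; apply: Fi MN (FM a).
- split; first exact: rep0_module.
  by move=> a; case: (tF a) => -[].
- move=> M N [mM FM] [mN FN]; split; first exact: dsum_module.
  by move=> a; case: (tF a) => -[_ _ _ Fd _ _] _; exact: Fd.
- move=> M Q S i q iq; have [mM _ mS _] := iq.
  by split=> -[_ FM]; split=> // a; case: (tF a) => -[_ _ _ _ Fs _] _;
    apply/(Fs _ _ _ _ _ iq).
- move=> M N C S f g h tr [mM FM] [mN FN]; have [Q [i [q [j [_ [_ mC] _ _ _]]]]] := tr.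
  split=> // a; case: (tF a) => -[_ _ _ _ _ Fc] _.
  exact: Fc tr (FM a) (FN a).
move=> M N mM mN [_ FMN]; split; split=> // a;
  by case: (tF a) => _ /(_ _ _ mM mN (FMN a))[].
Qed.

End ThickIdeals.

Section SpectrumTransfer.
Variables (K : fieldType) (I : finType) (H : hopf K I).
Hypothesis H_hopf : is_hopf H.
Hypothesis S_unit :
  (\matrix_(a < #|I|, b < #|I|) antipode H (enum_val a) (enum_val b)) \in unitmx.
Let D := double H.
Let k := triv_rep H 1.
Let mk : is_module H k := triv_rep_module H_hopf 1.
Let mres := res_module H_hopf S_unit.
Let mtens := tens_module H_hopf.
Let mind := ind_module H_hopf S_unit.
Let mtensD := double_tens_module H_hopf S_unit.
Implicit Types (M N : rep K I) (X Y : rep K (I * I)%type).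

Definition pullback (J : set (rep K I)) : set (rep K (I * I)%type) :=
  [set X | is_module D X /\ J (res H X)]%classic.

(* Inverse to [pullback], by [pull_pushforward] and [push_pullback]. *)
Definition pushforward (J : set (rep K (I * I)%type)) : set (rep K I) :=
  [set M | is_module H M /\ forall N1 N2, is_module H N1 -> is_module H N2 ->
    J (ind H (tens H N1 (tens H M N2)))]%classic.

Lemma pullback_thick J : thick_ideal H J -> thick_ideal D (pullback J).
Proof.
move=> tJ; have [tP sP] := preimage_thick_subcat (res_functor H_hopf S_unit) (thick_ideal_subcat tJ).
split=> // X Y [mX JX] mY; have [JXY JYX] := thick_tens tJ JX (mres mY).
by split; split; rewrite ?res_tens //; apply: mtensD.
Qed.

(** For fixed N1 and N2 the condition defines a preimage under an exact functor. Tensoring M by N is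
    absorbed into N1 or N2, which range over all modules. *)
Lemma pushforward_thick J : thick_ideal D J -> thick_ideal H (pushforward J).
Proof.
move=> tJ.
pose A := ({N | is_module H N} * {N | is_module H N})%type.
pose F (a : A) : set (rep K I) := [set M | is_module H M /\
  J (ind H (tens H (sval a.1) (tens H M (sval a.2))))]%classic.
have tF a : thick_subcat H (F a).
  case: a => -[N1 m1] [N2 m2].
  have t1 := preimage_thick_subcat (ind_functor H_hopf S_unit) (thick_ideal_subcat tJ).
  have t2 := preimage_thick_subcat (tensl H_hopf S_unit m1) t1.
  have t3 := preimage_thick_subcat (tensr H_hopf S_unit m2) t2.
  congr (thick_subcat H _): t3; apply/seteqP; split=> M /=.
    by move=> [mM [_ [_ JM]]].
  move=> [mM JM]; split=> //; split; first exact: mtens.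
  by split=> //; apply: mtens => //; exact: mtens.
have [tG sG] : thick_subcat H (pushforward J).
  have := bigcap_thick_subcat tF.
  congr (thick_subcat H _); apply/seteqP; split=> M [mM JM]; split=> //.
    by move=> N1 N2 m1 m2; have [] := JM (exist _ N1 m1, exist _ N2 m2).
  by move=> [[N1 m1] [N2 m2]]; split=> //=; exact: JM.
split=> // M N [mM JM] mN; split; (split; first exact: mtens) => N1 N2 m1 m2.
  have := JM N1 (tens H N N2) m1 (mtens mN m2).
  apply: (thick_ideal_retract tJ); first by apply: mind; do !apply: mtens.
  apply: (retract_fobj (ind_functor H_hopf S_unit)); apply: iso_retract.
  by apply: tens_iso => //; [exact: iso_refl|exact: tensA].
have := JM (tens H N1 N) N2 (mtens m1 mN) m2.
apply: (thick_ideal_retract tJ); first by apply: mind; do !apply: mtens.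
apply: (retract_fobj (ind_functor H_hopf S_unit)); apply: iso_retract.
apply: (@iso_trans _ _ _ (tens H N1 (tens H N (tens H M N2)))).
  by apply: tens_iso => //; [exact: iso_refl|exact: tensA].
exact/iso_sym/tensA.
Qed.

(** Primes are defined by thick ideals, so a product of two objects must be tested with every object
    B between them. This quantifier is what makes the class an ideal in [N]. *)
Definition right_factors (P : set (rep K I)) A : set (rep K I) :=
  [set N | is_module H N /\ forall B, is_module H B -> P (tens H A (tens H B N))]%classic.

Definition left_factors (P : set (rep K I)) C : set (rep K I) :=
  [set M | is_module H M /\ forall B, is_module H B -> P (tens H M (tens H B C))]%classic.

Lemma right_factors_thick P A : thick_ideal H P -> is_module H A ->
  thick_ideal H (right_factors P A).
Proof.
move=> tP mA.
pose F (a : {B | is_module H B}) : set (rep K I) := [set N | is_module H N /\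
  P (tens H A (tens H (sval a) N))]%classic.
have tF a : thick_subcat H (F a).
  case: a => B mB.
  have t1 := preimage_thick_subcat (tensl H_hopf S_unit mA) (thick_ideal_subcat tP).
  have t2 := preimage_thick_subcat (tensl H_hopf S_unit mB) t1.
  congr (thick_subcat H _): t2; apply/seteqP; split=> M /=; first by case=> ? [].
  by move=> [mM PM]; split=> //; split=> //; exact: mtens.
have [tG sG] : thick_subcat H (right_factors P A).
  have := bigcap_thick_subcat tF.
  congr (thick_subcat H _); apply/seteqP; split=> M [mM PM]; split=> //.
    by move=> B mB; have [] := PM (exist _ B mB).
  by move=> [B mB]; split=> //=; exact: PM.
split=> // N X [mN PN] mX; split; (split; first exact: mtens) => B mB.
  apply: (thick_ideal_retract tP _ _ (thick_tens tP (PN B mB) mX).1).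
    by do !apply: mtens.
  apply/iso_retract/iso_sym; apply: iso_trans (tensA H_hopf _ _ _) _.
  by apply: tens_iso => //; [exact: iso_refl|exact: tensA].
apply: (thick_ideal_retract tP _ _ (PN _ (mtens mB mX))); first by do !apply: mtens.
by apply/iso_retract/tens_iso => //; [exact: iso_refl|exact/iso_sym/tensA].
Qed.

Lemma left_factors_thick P C : thick_ideal H P -> is_module H C ->
  thick_ideal H (left_factors P C).
Proof.
move=> tP mC.
pose F (a : {B | is_module H B}) : set (rep K I) := [set M | is_module H M /\
  P (tens H M (tens H (sval a) C))]%classic.
have tF a : thick_subcat H (F a).
  by case: a => B mB; exact: (preimage_thick_subcat (tensr H_hopf S_unit (mtens mB mC)) (thick_ideal_subcat tP)).
have [tG sG] : thick_subcat H (left_factors P C).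
  have := bigcap_thick_subcat tF.
  congr (thick_subcat H _); apply/seteqP; split=> M [mM PM]; split=> //.
    by move=> B mB; have [] := PM (exist _ B mB).
  by move=> [B mB]; split=> //=; exact: PM.
split=> // M X [mM PM] mX; split; (split; first exact: mtens) => B mB.
  apply: (thick_ideal_retract tP _ _ (PM _ (mtens mX mB))); first by do !apply: mtens.
  apply/iso_retract; apply: iso_trans (tensA H_hopf _ _ _) _.
  by apply: tens_iso => //; [exact: iso_refl|exact/iso_sym/tensA].
apply: (thick_ideal_retract tP _ _ (thick_tens tP (PM B mB) mX).2); first by do !apply: mtens.
exact/iso_retract/tensA.
Qed.

Hypothesis unit_retract : retract (triv_rep D 1) (ind H k).

(** Everything follows from [swap]. For N1 = N2 = k it puts X (x) Ind (k (x) k) in J, and X = X (x)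
    1 is a retract of it; conversely X in J puts all the products in J. *)
Lemma pull_pushforward J : thick_ideal D J -> pullback (pushforward J) = J.
Proof.
move=> tJ.
have swap X N1 N2 : is_module D X -> is_module H N1 -> is_module H N2 ->
    iso (ind H (tens H N1 (tens H (res H X) N2)))
        (tens D X (ind H (tens H N1 N2))).
  move=> mX m1 m2; apply: iso_trans (ind_tens_iso H_hopf S_unit mX (mtens m1 m2)).
  apply: (iso_fobj (ind_functor H_hopf S_unit)).
  apply: iso_trans (tensA H_hopf _ _ _).
  apply: iso_trans (iso_sym (tensA H_hopf _ _ _)) _.
  by apply: tens_iso => //; [exact: half_braiding|exact: iso_refl].
apply/seteqP; split=> X.
  move=> [mX [_ /(_ k k mk mk)]].
  have mI : is_module D (ind H (tens H k (tens H (res H X) k))).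
    by apply: mind; do !apply: mtens => //; exact: mres.
  have mI' : is_module D (ind H (tens H k k)) by apply: mind; exact: mtens.
  move=> /(thick_ideal_iso tJ mI (mtensD mX mI') (swap _ _ _ mX mk mk)).
  apply: (thick_ideal_retract tJ) => //.
  apply: (@retract_trans _ _ _ (tens D X (triv_rep D 1))).
    exact/iso_retract/iso_sym/double_tens_unit.
  apply: tens_retract; first exact/iso_retract/iso_refl.
  apply: retract_trans unit_retract (iso_retract _).
  exact/(iso_fobj (ind_functor H_hopf S_unit))/iso_sym/tens_unit.
move=> JX; have mX := thick_ideal_module tJ JX; split=> //.
split=> [|N1 N2 m1 m2]; first exact: mres.
have mI : is_module D (ind H (tens H N1 N2)) by apply: mind; exact: mtens.
apply/(thick_ideal_iso tJ _ _ (swap _ _ _ mX m1 m2)); last exact: (thick_tens tJ JX mI).1.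
  by apply: mind; do !apply: mtens => //; exact: mres.
exact: mtensD.
Qed.

Hypothesis detect : forall M, is_module H M -> exists2 X, is_module D X &
  forall J, thick_ideal H J -> J (res H X) <-> J M.

(** Both sides are thick ideals with the same pullback, and [detect] replaces any M by an object Res
    X, on which the pullbacks decide. *)
Lemma push_pullback J : thick_ideal H J -> pushforward (pullback J) = J.
Proof.
move=> tJ; have tR := pullback_thick tJ; have tP := pushforward_thick tR.
suff E M : is_module H M -> pushforward (pullback J) M <-> J M.
  by apply/seteqP; split=> M JM; apply/E => //;
    [exact: thick_ideal_module tP JM|exact: thick_ideal_module tJ JM].
move=> mM; have [X mX XM] := detect mM.
split=> [/(XM _ tP) PX|/(XM _ tJ) JX].
  by have: pullback (pushforward (pullback J)) X by []; rewrite pull_pushforward // => -[_ /(XM _ tJ)].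
have: pullback (pushforward (pullback J)) X by rewrite pull_pushforward.
by move=> [_ /(XM _ tP)].
Qed.

Lemma pushforward_sub J L : (J `<=` L)%classic -> (pushforward J `<=` pushforward L)%classic.
Proof. by move=> JL M [mM JM]; split=> // N1 N2 m1 m2; apply: JL; exact: JM. Qed.

Lemma pullback_sub J L : (J `<=` L)%classic -> (pullback J `<=` pullback L)%classic.
Proof. by move=> JL X [mX JX]; split=> //; apply: JL. Qed.

(** To apply primeness to the pushforwards of J and L, start from Res X (x) Res Y in P with X and Y
    detecting the given objects. The half-braiding inserts any B between the factors; then
    [right_factors] and [left_factors] are thick ideals, so [detect] replaces first Res Y and then
    Res X by the original objects. *)
Lemma pullback_prime P : prime_ideal H P -> prime_ideal D (pullback P).
Proof.
move=> [tP [M mM nPM] pP]; split; first exact: pullback_thick.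
  have [X mX XM] := detect mM; exists X => // -[_ /(XM _ tP)]; exact: nPM.
move=> J L tJ tL JL.
have tJ' := pushforward_thick tJ; have tL' := pushforward_thick tL.
have [] := pP _ _ tJ' tL'; first last.
- by move=> /pullback_sub; rewrite (pull_pushforward tL); right.
- by move=> /pullback_sub; rewrite (pull_pushforward tJ); left.
move=> M' N JM' LN; have {}mM' := thick_ideal_module tJ' JM'.
have mN := thick_ideal_module tL' LN.
have [X mX XM'] := detect mM'; have [Y mY YN] := detect mN.
have JX : J X by rewrite -(pull_pushforward tJ); split=> //; apply/XM'.
have LY : L Y by rewrite -(pull_pushforward tL); split=> //; apply/YN.
have [_ PXY] := JL _ _ JX LY; rewrite res_tens // in PXY.
have mrX := mres mX; have mrY := mres mY.
have PXN : right_factors P (res H X) N.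
  apply/(YN _ (right_factors_thick tP mrX)); split=> // B mB.
  apply: (thick_ideal_retract tP (N := tens H (tens H (res H X) (res H Y)) B)); last first.
  - exact: (thick_tens tP PXY mB).1.
  - apply: iso_retract; apply: iso_trans (iso_sym (tensA H_hopf _ _ _)).
    by apply: tens_iso; [exact: iso_refl|exact: half_braiding].
  - by do !apply: mtens.
have [_ PMN] : left_factors P N M'.
  by apply/(XM' _ (left_factors_thick tP mN)); split=> // B mB; apply: PXN.2.
apply: (thick_ideal_retract tP _ _ (PMN _ mk)); first exact: mtens.
apply: iso_retract; apply: iso_trans (tensA H_hopf _ _ _).
by apply: tens_iso; [exact/iso_sym/tens_unit|exact: iso_refl].
Qed.

(** Pull the two ideals back, use primeness over the double, and push forward again. *)
Lemma pushforward_prime Q : prime_ideal D Q -> prime_ideal H (pushforward Q).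
Proof.
move=> [tQ [X mX nQX] pQ]; have tP := pushforward_thick tQ; split=> //.
  exists (res H X); first exact: mres.
  by move=> QX; apply: nQX; rewrite -(pull_pushforward tQ).
move=> J L tJ tL JL.
have [] := pQ _ _ (pullback_thick tJ) (pullback_thick tL); first last.
- by move=> /pushforward_sub; rewrite !push_pullback //; right.
- by move=> /pushforward_sub; rewrite !push_pullback //; left.
move=> X' Y [mX' JX] [mY LY]; rewrite -(pull_pushforward tQ); split; first exact: mtensD.
by rewrite res_tens //; exact: JL.
Qed.

Lemma thick_ideals_eq (J0 : finType) (B : hopf K J0) (J L : thick_ideals B) :
  thick_set J = thick_set L -> J = L.
Proof. by case: J L => [J tJ] [L tL] /= E; rewrite E in tJ *; congr MkThick; exact: Prop_irrelevance. Qed.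

Lemma Spc_eq (J0 : finType) (B : hopf K J0) (P Q : Spc B) :
  prime_set P = prime_set Q -> P = Q.
Proof. by case: P Q => [J tJ] [L tL] /= E; rewrite E in tJ *; congr MkSpc; exact: Prop_irrelevance. Qed.

Lemma spectrum_transfer : res_homeomorphism H /\ thick_ideals_bijection H.
Proof.
split; last first.
  exists (fun J => MkThick (pushforward_thick (thick_setP J))).
  exists (fun J => MkThick (pullback_thick (thick_setP J))) => J; apply: thick_ideals_eq => /=.
    exact/pull_pushforward/thick_setP.
  exact/push_pullback/thick_setP.
pose f (P : Spc H) := MkSpc (pullback_prime (prime_setP P)).
pose g (Q : Spc D) := MkSpc (pushforward_prime (prime_setP Q)).
exists f; split=> //; split.
  apply/continuousP => U /Spc_openP[T UT].
  apply/Spc_openP; exists [set res H X | X in [set X | T X /\ is_module D X]]%classic => P.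
  split=> [/UT[X TX [mX PX]]|[_ [X [TX mX] <-] PX]]; first by exists (res H X) => //; exists X.
  by apply/UT; exists X.
exists g; split=> [P|Q|].
- apply: Spc_eq; exact/push_pullback/prime_thick/prime_setP.
- apply: Spc_eq; exact/pull_pushforward/prime_thick/prime_setP.
apply/continuousP => U /Spc_openP[T UT]; apply/Spc_openP.
(* An open set is given by objects M of H; objects X of the double that detect them define its
   preimage under [g]. *)
exists [set X | is_module D X /\ exists M, [/\ T M, is_module H M &
  forall J, thick_ideal H J -> J (res H X) <-> J M]]%classic => Q.
have tQ := prime_thick (prime_setP Q); have tP := pushforward_thick tQ.
have QE X : is_module D X -> prime_set Q X <-> pushforward Q (res H X).
  by move=> mX; rewrite -{1}(pull_pushforward tQ); split=> [[]|].
split=> [/UT[M TM PM]|[X [mX [M [TM mM XM]]] /(QE _ mX)/(XM _ tP) PM]]; last first.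
  by apply/UT; exists M.
have mM := thick_ideal_module tP PM; have [X mX XM] := detect mM.
by exists X; [split=> //; exists M|apply/QE => //; apply/XM].
Qed.

End SpectrumTransfer.

(** * Integrals on cosemisimple Hopf algebras *)

Section RightIntegral.
Variables (K : fieldType) (I : finType) (H : hopf K I).
Hypothesis H_hopf : is_hopf H.
Let H_bi := hopf_bialgebra H_hopf.
Let H_alg : is_algebra H. Proof. by case: H_bi. Qed.
Let H_coalg : is_coalgebra H. Proof. by case: H_bi. Qed.

Local Notation cm x F := (l2 (comul H x) F).
Local Notation ml x y F := (l1 (amul H x y) F).
Local Notation an x F := (l1 (antipode H x) F).
Local Notation one F := (l1 (aone H) F).

(* lam is an H^*-linear retraction of k -> H, 1 |-> 1, where f in H^* acts on H *)
(* by x |-> x_1 f(x_2).                                                        *)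
Lemma cosemisimple_integral : cosemisimple H -> exists2 lam : I -> K,
  l1 (aone H) (lam : I -> K^o) = 1 &
  forall (V : lmodType K) i (F : I -> V),
    l2 (comul H i) (fun a b => lam a *: F b) = lam i *: l1 (aone H) F.
Proof.
move=> ssH.
pose M := Rep (fun a => aone H a *: (1%:M : 'M[K]_1)).
pose N := Rep (fun a => mxI (fun j i => comul H i j a)).
have mN : is_module (dual_algebra H) N.
  have [cA _ c1r] := H_coalg; split=> [a b|] /=.
    rewrite mxI_mul -[RHS]/(l1 _ _) l1_mxI; apply: eq_mxI => x i.
    rewrite /l1 /GRing.scale /=; under eq_bigr do rewrite mulrC.
    rewrite cA; apply: eq_bigr => j _; exact: mulrC.
  rewrite -[LHS]/(l1 _ _) l1_mxI -mxI1; apply: eq_mxI => x i.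
  by rewrite eq_sym -(c1r i x); apply: eq_bigr => j _; rewrite /GRing.scale /= mulrC.
have h1 : @is_hom K I M N (cV1 H).
  move=> a /=; rewrite -scalemxAr mulmx1 /cV1 l1_mulmxr.
  under [RHS]eq_l1 => i do rewrite mxI_delta.
  transitivity (one (fun i => cm i (fun j b => (b == a)%:R *: cVdelta K j))).
    rewrite (comul1 H_bi) l1Z; apply: eq_l1 => j.
    by rewrite -(l1_scal (aone H) (fun b => (b == a)%:R)) l1_deltar.
  apply: eq_l1 => i; apply: eq_bigr => j _.
  by rewrite -(l1_deltar (comul H i j) a) l1_scal.
have [||r hr rf] := ssH M N (cV1 H) _ mN h1.
- exact: unit_dact_module.
- apply/mx_injP; exists (\row_p counit H (enum_val p)).
  rewrite /cV1 l1_mulmxr -[RHS]scale1r -[X in X *: _](counit1 H_bi) l1_scal; apply: eq_l1 => i.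
  by apply/matrixP => p q; rewrite -colE !mxE enum_rankK !ord1 mulr1.
pose lam i : K := r 0 (enum_rank i).
have lamE i : r *m cVdelta K i = (lam i)%:M.
  by apply/matrixP => p q; rewrite -colE !mxE !ord1 mulr1n.
exists lam => [|V i F].
  transitivity ((r *m cV1 H) 0 0); last by rewrite rf mxE.
  rewrite /cV1 l1_mulmxr /l1 summxE; apply: eq_bigr => i _.
  by rewrite lamE !mxE /GRing.scale /=.
rewrite l1Z [LHS]exchange_big; apply: eq_bigr => b _ /=.
transitivity ((\sum_a comul H i a b * lam a) *: F b).
  by rewrite scaler_suml; apply: eq_bigr => a _; rewrite scalerA.
have := congr1 (fun A => (A *m cVdelta K i) 0 0) (hr b).
rewrite -mulmxA mxI_delta l1_mulmxr /= -!scalemxAl mul1mx lamE !mxE summxE mulr1n => E.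
rewrite scalerA; congr (_ *: _); rewrite -E; apply: eq_bigr => a _.
by rewrite lamE !mxE mulr1n /GRing.scale /=.
Qed.

Variable lam : I -> K.
Hypothesis lam1 : one (lam : I -> K^o) = 1.
Hypothesis lamR : forall (V : lmodType K) i (F : I -> V),
  cm i (fun a b => lam a *: F b) = lam i *: one F.

Let L x y : K := ml x y (lam : I -> K^o).

Let LE (V : lmodType K) x y (v : V) : ml x y (fun k => lam k *: v) = L x y *: v.
Proof. by rewrite -l1_scal. Qed.

(** Right invariance gives lam(x y_1) 1 = lam(x_1 y_1) x_2 y_2; multiply by S of the next leg of y,
    and y_2 S(y_3) cancels. *)
Lemma integral_translate_r (V : lmodType K) x y (F : I -> V) :
  cm y (fun a b => L x a *: an b F) = cm x (fun a b => L a y *: F b).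
Proof.
transitivity (cm y (fun c d => cm d (fun d1 d2 => an d2 (fun s =>
    cm x (fun a b => L a c *: ml b d1 (fun u => ml u s F)))))).
  transitivity (cm y (fun e d2 => cm e (fun c d1 => an d2 (fun s =>
    cm x (fun a b => L a c *: ml b d1 (fun u => ml u s F)))))).
    apply: eq_l2 => e d2; rewrite l21C l1Z; apply: eq_l1 => s.
    rewrite l22C.
    transitivity (ml x e (fun k => cm k (fun p q => lam p *: ml q s F))).
      under eq_l1 => k do rewrite lamR.
      by rewrite LE (amul1l H_alg).
    rewrite (comulM H_bi); apply: eq_l2 => a b; apply: eq_l2 => c d1.
    rewrite -LE; apply: eq_l1 => p.
    by rewrite l1Z.
  exact: (comulA H_coalg y (fun c d1 d2 => an d2 (fun s =>
    cm x (fun a b => L a c *: ml b d1 (fun u => ml u s F))))).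
transitivity (cm y (fun c d => counit H d *: cm x (fun a b => L a c *: F b))).
  apply: eq_l2 => c d.
  transitivity (cm x (fun a b => L a c *: (counit H d *: F b))); last first.
    by rewrite l2Z; apply: eq_l2 => a b; rewrite !scalerA mulrC.
  under eq_l2 => d1 d2 do rewrite l12C.
  rewrite l22C; apply: eq_l2 => a b.
  under eq_l2 => d1 d2 do rewrite -l1Z; rewrite -l2Z.
  under eq_l2 => d1 d2 do under eq_l1 => s do rewrite (amulA H_alg).
  by rewrite (antipodeR H_hopf d (fun t => ml b t F)) (amul1r H_alg).
exact: (comul1r H_coalg y (fun c => cm x (fun a b => L a c *: F b))).
Qed.

(* By [integral_translate_r], if lam(x y) = 0 for all y, then the elements     *)
(* x_1 f(x_2) have the same property; taking x_1 S(x_2) shows eps(x) = 0, and  *)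
(* eps(x_1 f(x_2)) = f(x).                                                     *)
Lemma integral_nondegenerate (u : I -> K) :
  (forall y, l1 u (fun x => L x y : K^o) = 0) -> forall i, u i = 0.
Proof.
move=> uL b.
have slice (v : I -> K) y (G : I -> K^o) : (forall y, l1 v (fun x => L x y : K^o) = 0) ->
    l1 v (fun x => cm x (fun a c => L a y *: G c)) = 0.
  move=> vL; under eq_l1 => x do rewrite -integral_translate_r.
  rewrite l12C /l2 big1 // => a _; rewrite big1 // => c _.
  by rewrite -(l1_scal v (L^~ a)) vL scale0r scaler0.
have eps0 (v : I -> K) : (forall y, l1 v (fun x => L x y : K^o) = 0) ->
    l1 v (counit H : I -> K^o) = 0.
  move=> vL.
  transitivity (\sum_s l1 v (fun x => cm x (fun a c => L a s *: (antipode H c s : K^o)))).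
    rewrite -[RHS]/(\sum_s \sum_x _) [RHS]exchange_big; apply: eq_bigr => x _ /=.
    rewrite -scaler_sumr; congr (_ *: _).
    transitivity (counit H x *: one (lam : I -> K^o)); first by rewrite lam1 [RHS]mulr1.
    rewrite -(antipodeR H_hopf) [RHS]exchange_big; apply: eq_bigr => a _ /=.
    rewrite [RHS]exchange_big; apply: eq_bigr => c _ /=; rewrite -scaler_sumr.
    by congr (_ *: _); apply: eq_bigr => s _; rewrite /GRing.scale /= mulrC.
  by rewrite big1 // => s _; exact: (slice v s (antipode H ^~ s)).
pose ub a : K := l1 u (fun x => comul H x a b : K^o).
have ubE (F : I -> K^o) : l1 ub F = l1 u (fun x => l1 (fun a => comul H x a b) F).
  exact: (l1_comp u (fun x a => comul H x a b) F).
rewrite -(eps0 ub); last first.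
  move=> y; rewrite ubE -[RHS](slice u y (fun c => (c == b)%:R) uL).
  apply: eq_l1 => i; apply: eq_bigr => a _.
  rewrite -[comul H i a b](l1_deltar (comul H i a) b) /GRing.scale /= mulr_suml.
  by apply: eq_bigr => c _; rewrite /GRing.scale /=; ring.
rewrite ubE -[LHS](l1_deltar u b); apply: (eq_l1 (V := K^o)) => i.
rewrite -[LHS](comul1l H_coalg i (fun c => (c == b)%:R : K^o)).
apply: eq_bigr => a _; rewrite -[comul H i a b](l1_deltar (comul H i a) b) /GRing.scale /= mulr_suml.
by apply: eq_bigr => c _; rewrite /GRing.scale /=; ring.
Qed.

Let B : 'M[K]_#|I| := mxI (fun j i => L i j).

(** In finite dimension, nondegeneracy on one side makes the Gram matrix of lam(xy) invertible,
    hence gives both one-sided inverses. *)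
Lemma frobenius_mx : exists c : I -> I -> K,
  (forall x z, l1 (c x) (fun y => L z y : K^o) = (x == z)%:R) /\
  (forall x z, l1 (fun y => L y x) (fun y => c y z : K^o) = (x == z)%:R).
Proof.
have [C CB] : exists C, C *m B = 1%:M.
  apply/mx_injP => v w; rewrite /= => E; apply/eqP; rewrite -subr_eq0; apply/eqP.
  have {E} : B *m (v - w) = 0 by rewrite mulmxBr E subrr.
  move: (v - w) => {v w} v Bv; apply/matrixP => i j; rewrite !ord1 mxE {j}.
  rewrite -(enum_valK i); apply: (integral_nondegenerate (u := fun k => v (enum_rank k) 0)) => y.
  have := congr1 (fun M : 'cV[K]_#|I| => M (enum_rank y) 0) Bv; rewrite !mxE => <-.
  rewrite [RHS](reindex (@enum_rank I)) /=; last by apply: onW_bij; exact: enum_rank_bij.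
  by apply: eq_bigr => j _; rewrite mxE !enum_rankK /GRing.scale /= mulrC.
pose c x y := C (enum_rank x) (enum_rank y).
have EC : C = mxI c by apply/matrixP => i j; rewrite !mxE /c !enum_valK.
have mxI_inj f g : mxI f = mxI g :> 'M[K]_#|I| -> f =2 g.
  move=> E x y; have := congr1 (fun M : 'M[K]__ => M (enum_rank x) (enum_rank y)) E.
  by rewrite !mxE !enum_rankK.
exists c; split=> x z.
  by move: CB; rewrite EC /B mxI_mul -mxI1 => /mxI_inj /(_ x z).
by move/mulmx1C: CB; rewrite EC /B mxI_mul -mxI1 => /mxI_inj /(_ x z).
Qed.

Lemma frobenius_r (g : I -> K) : exists w : I -> K,
  forall z, l1 w (L z : I -> K^o) = g z.
Proof.
have [c [cL _]] := frobenius_mx.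
exists (fun y => l1 g (fun x => c x y : K^o)) => z.
etransitivity; first exact: (l1_comp g c).
rewrite -[RHS](l1_deltar g z).
by apply: (eq_l1 (V := K^o)) => x; rewrite cL.
Qed.

Lemma frobenius_l (g : I -> K) : exists v : I -> K,
  forall x, l1 v (L^~ x : I -> K^o) = g x.
Proof.
have [c [_ Lc]] := frobenius_mx.
exists (fun y => l1 g (fun z => c y z : K^o)) => x.
etransitivity; first exact: (l1_comp g (fun z y => c y z)).
rewrite -[RHS](l1_deltar g x).
apply: (eq_l1 (V := K^o)) => z; rewrite eq_sym -Lc.
by apply: eq_bigr => y _; exact: mulrC.
Qed.

(* If lam(a w) = eps(a) for all a, then x = lam(x w_1) S(w_2). *)
Lemma antipode_unit :
  (\matrix_(a < #|I|, b < #|I|) antipode H (enum_val a) (enum_val b)) \in unitmx.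
Proof.
have [w wL] := frobenius_r (counit H).
pose d x b : K := l1 w (fun y => \sum_a comul H y a b * L x a : K^o).
suff dS x (F : I -> K^o) : l1 (d x) (fun b => an b F) = F x.
  suff: mxI d *m mxI (antipode H) = 1%:M by case/mulmx1_unit.
  rewrite mxI_mul -mxI1; apply: eq_mxI => x z.
  rewrite -(dS x (fun k => (k == z)%:R)); apply: (eq_l1 (V := K^o)) => b.
  by rewrite l1_deltar.
etransitivity; first exact: (l1_comp w (fun y b => \sum_a comul H y a b * L x a)).
transitivity (l1 w (fun y => cm y (fun a b => L x a *: an b F))).
  apply: (eq_l1 (V := K^o)) => y; rewrite /l2 exchange_big; apply: eq_bigr => b _ /=.
  by rewrite scaler_suml; apply: eq_bigr => a _; rewrite scalerA.
under eq_l1 => y do rewrite integral_translate_r.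
rewrite l12C -[RHS](comul1l H_coalg x F); apply: (eq_l2 (V := K^o)) => a b.
by rewrite -l1_scal wL.
Qed.

Let S_unit := antipode_unit.

(* lam o S is a left integral with value 1 at 1, hence equal to lam. *)
Lemma integral_two_sided (V : lmodType K) i (F : I -> V) :
  cm i (fun a b => lam b *: F a) = lam i *: one F.
Proof.
pose la i : K := an i (lam : I -> K^o).
have laL (W : lmodType K) j (G : I -> W) : cm j (fun a b => la b *: G a) = la j *: one G.
  transitivity (an j (fun k => cm k (fun p q => lam p *: l1 (antipodeV H q) G))).
    rewrite (antipode_comul H_hopf); apply: eq_l2 => a b.
    rewrite l1_scal; apply: eq_l1 => p.
    by rewrite -l1Z (antipodeK S_unit).
  under eq_l1 => k do rewrite lamR (antipodeV1 H_hopf S_unit).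
  by rewrite -l1_scal.
suff lala j : la j = lam j.
  by rewrite -(lala i) -laL; apply: eq_l2 => a b; rewrite lala.
have := lamR j (la : I -> K^o).
have -> : one (la : I -> K^o) = 1 by rewrite (antipode1 H_hopf).
rewrite [RHS]mulr1 => <-.
rewrite -[LHS]mulr1 -lam1 -[LHS](laL K^o).
by apply: (eq_l2 (V := K^o)) => a b; exact: mulrC.
Qed.

(** Mirror image of [integral_translate_r]: compute S(x_1) x_2 y_1 lam(x_3 y_2) in two ways, with
    lam now invariant on the other side. *)
Lemma integral_translate_l (V : lmodType K) x y (F : I -> V) :
  cm y (fun a b => L x b *: F a) = cm x (fun a b => L b y *: an a F).
Proof.
apply/esym.
transitivity (cm x (fun a d => cm d (fun b c => an a (fun s =>
    cm y (fun p q => L c q *: ml b p (fun u => ml s u F)))))).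
  apply: eq_l2 => a d; rewrite l21C l1Z; apply: eq_l1 => s.
  transitivity (ml d y (fun k => cm k (fun u v => lam v *: ml s u F))).
    under eq_l1 => k do rewrite integral_two_sided.
    by rewrite LE (amul1r H_alg).
  rewrite (comulM H_bi); apply: eq_l2 => b c; apply: eq_l2 => p q.
  by rewrite l1Z; apply: eq_l1 => u; rewrite LE.
rewrite -(comulA H_coalg x (fun a b c => an a (fun s =>
    cm y (fun p q => L c q *: ml b p (fun u => ml s u F))))).
transitivity (cm x (fun e c => counit H e *: cm y (fun p q => L c q *: F p))).
  apply: eq_l2 => e c.
  under eq_l2 => a b do rewrite l12C.
  rewrite l22C l2Z; apply: eq_l2 => p q.
  under eq_l2 => a b do rewrite -l1Z; rewrite -l2Z.
  under eq_l2 => a b do under eq_l1 => s do rewrite -(amulA H_alg).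
  rewrite (antipodeL H_hopf e (fun t => ml t p F)) (amul1l H_alg).
  by rewrite !scalerA mulrC.
exact: (comul1l H_coalg x (fun c => cm y (fun p q => L c q *: F p))).
Qed.

(* The Nakayama automorphism nu, given by lam(x y) = lam(nu(y) x), satisfies   *)
(* S^2(nu(y)) = y_1 alpha(y_2), where alpha = eps o nu.                        *)
Lemma nakayama : exists alpha : I -> K,
  (forall x y, ml x y (alpha : I -> K^o) = alpha x * alpha y) /\
  (forall x y, L x y = cm y (fun a b => alpha b *:
        l1 (antipodeV H a) (fun c => l1 (antipodeV H c) (fun d => L d x : K^o)))).
Proof.
have frob_inj (u v : I -> K) :
    (forall y, l1 u (L^~ y : I -> K^o) = l1 v (L^~ y : I -> K^o)) -> u = v.
  move=> uv; apply/funext => i; apply/eqP; rewrite -subr_eq0; apply/eqP.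
  apply: (integral_nondegenerate (u := fun i => u i - v i)) => y.
  transitivity (l1 u (L^~ y : I -> K^o) - l1 v (L^~ y : I -> K^o)); last by rewrite uv subrr.
  by rewrite /l1 -sumrB; apply: eq_bigr => j _; rewrite -scalerBl.
have /choice[nu nuE] : forall y, exists v : I -> K,
    forall x, l1 v (L^~ x : I -> K^o) = L x y by move=> y; exact: frobenius_l.
pose alpha y : K := l1 (nu y) (counit H : I -> K^o).
exists alpha; split.
  (* [u] and [v] are the coordinates of nu(xy) and nu(x) nu(y). They agree by [frob_inj], since
     lam(a x y) = lam(nu(y) a x) = lam(nu(x) nu(y) a). *)
  move=> x y; pose u z : K := ml x y (fun k => nu k z : K^o).
  pose v z : K := l1 (nu x) (fun p => l1 (nu y) (fun q => amul H p q z : K^o) : K^o).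
  have uE (F : I -> K^o) : l1 u F = ml x y (fun k => l1 (nu k) F) by exact: (l1_comp (amul H x y) nu F).
  have vE (F : I -> K^o) : l1 v F = l1 (nu x) (fun p => l1 (nu y) (fun q => ml p q F)).
    etransitivity; first exact: (l1_comp (nu x) (fun p z => l1 (nu y) (fun q => amul H p q z : K^o)) F).
    by apply: eq_l1 => p; exact: (l1_comp (nu y) (amul H p) F).
  transitivity (l1 v (counit H : I -> K^o)).
    rewrite -[LHS]uE; congr (l1 _ _); apply: frob_inj => a; rewrite uE vE.
    transitivity (l1 (nu y) (fun q => l1 (nu x) (fun p => ml q a (fun t => L p t : K^o)))); last first.
      rewrite l11C; apply: eq_l1 => q; apply: eq_l1 => p.
      by rewrite -[LHS](amulA H_alg).
    transitivity (l1 (nu y) (fun q => ml a x (fun t => L q t : K^o))).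
      transitivity (ml x y (fun k => ml a k (lam : I -> K^o))).
        by apply: (eq_l1 (V := K^o)) => k; rewrite nuE.
      by rewrite -(amulA H_alg) l11C; apply: (eq_l1 (V := K^o)) => t; rewrite nuE.
    apply: (eq_l1 (V := K^o)) => q; rewrite l11C.
    transitivity (ml q a (fun t => L t x : K^o)); first exact/esym/(amulA H_alg).
    by apply: (eq_l1 (V := K^o)) => t; rewrite nuE.
  rewrite vE /alpha -[RHS]/(_ *: _) l1_scal; apply: (eq_l1 (V := K^o)) => p.
  rewrite -[RHS]/(_ *: _) l1Z; apply: (eq_l1 (V := K^o)) => q.
  by rewrite (counitM H_bi).
(* Here lam(z w) = eps(z), so that w_1 lam(z w_2) = S(z) and lam(w b) = alpha(b). Applying S to w_1
   lam(w_2 y) and evaluating in two ways gives S^2(nu(y)) = y_1 alpha(y_2). *)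
move=> x y; have [w wL] := frobenius_r (counit H).
have wS z (G : I -> K^o) : l1 w (fun k => cm k (fun a b => L z b *: G a)) = an z G.
  under eq_l1 => k do rewrite integral_translate_l.
  rewrite l12C -[RHS](comul1r H_coalg z (fun a => an a G)); apply: (eq_l2 (V := K^o)) => a b.
  by rewrite -(l1_scal w (L b)) wL.
have aE b : l1 w (L^~ b : I -> K^o) = alpha b.
  transitivity (l1 w (fun k => l1 (nu b) (fun p => L p k : K^o))).
    by apply: (eq_l1 (V := K^o)) => k; rewrite nuE.
  by rewrite l11C; apply: (eq_l1 (V := K^o)) => p; rewrite wL.
pose F a : K^o := l1 (antipodeV H a) (fun c => l1 (antipodeV H c) (fun d => L d x : K^o)).
transitivity (l1 (nu y) (fun k => an k (fun s => an s F))).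
  rewrite -nuE; apply: (eq_l1 (V := K^o)) => k.
  rewrite -[LHS](antipodeK S_unit k (fun d => L d x : K^o)).
  apply: (eq_l1 (V := K^o)) => s; apply/esym.
  exact: (antipodeK S_unit s (fun c => l1 (antipodeV H c) (fun d => L d x : K^o))).
transitivity (l1 w (fun k => cm y (fun a b => L k b *: F a))); last first.
  by rewrite l12C; apply: (eq_l2 (V := K^o)) => a b; rewrite -aE l1_scal.
under [RHS]eq_l1 => k do rewrite integral_translate_l.
transitivity (l1 (nu y) (fun p => l1 w (fun k => cm k (fun a b => L p b *: an a F)))).
  by apply: (eq_l1 (V := K^o)) => p; rewrite wS.
rewrite l11C; apply: (eq_l1 (V := K^o)) => k; rewrite l12C; apply: (eq_l2 (V := K^o)) => a b.
by rewrite -nuE l1_scal.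
Qed.

End RightIntegral.

(** * R-matrices *)

Section RMatrix.
Variables (K : fieldType) (I : finType) (H : hopf K I).
Hypothesis H_hopf : is_hopf H.
Let H_bi := hopf_bialgebra H_hopf.
Let H_alg : is_algebra H. Proof. by case: H_bi. Qed.
Let H_coalg : is_coalgebra H. Proof. by case: H_bi. Qed.

Local Notation cm x F := (l2 (comul H x) F).
Local Notation ml x y F := (l1 (amul H x y) F).
Local Notation an x F := (l1 (antipode H x) F).
Local Notation one F := (l1 (aone H) F).

Variable R : {ffun I * I -> K}.
Hypothesis R_mx : is_Rmatrix H R.

Definition rmx (a b : I) : K := R (a, b).

Local Notation rm F := (l2 rmx F).

Let l1_pair (V : lmodType K) (x : {ffun I * I -> K}) (F : I * I -> V) :
  l1 x F = l2 (fun a b => x (a, b)) (fun a b => F (a, b)).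
Proof. by rewrite l2E; apply: eq_bigr => -[]. Qed.

Let comul_basis x a b : elt_comul H (basis K x) (a, b) = comul H x a b.
Proof. by rewrite ffunE; exact: (l1_basis x (fun i => comul H i a b : K^o)). Qed.

Let l1_triple (V : lmodType K) (x : I * I * I -> K) (F : I * I * I -> V) :
  l1 x F = \sum_a \sum_b \sum_c x (a, b, c) *: F (a, b, c).
Proof.
rewrite [RHS](pair_bigA _ (fun a b => \sum_c x (a, b, c) *: F (a, b, c))) /=.
rewrite [RHS](pair_bigA _ (fun u c => x (u.1, u.2, c) *: F (u.1, u.2, c))) /=.
by apply: eq_bigr => -[[a b] c] _.
Qed.

Let l1_R13 (V : lmodType K) (F : I * I * I -> V) :
  l1 [ffun u : I * I * I => R (u.1.1, u.2) * aone H u.1.2] F =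
  rm (fun a c => one (fun b => F (a, b, c))).
Proof.
rewrite l1_triple; apply: eq_bigr => a _; rewrite exchange_big; apply: eq_bigr => c _ /=.
by rewrite scaler_sumr; apply: eq_bigr => b _; rewrite ffunE scalerA.
Qed.

Let l1_R23 (V : lmodType K) (F : I * I * I -> V) :
  l1 [ffun u : I * I * I => R (u.1.2, u.2) * aone H u.1.1] F =
  rm (fun b c => one (fun a => F (a, b, c))).
Proof.
rewrite l1_triple exchange_big; apply: eq_bigr => b _; rewrite exchange_big; apply: eq_bigr => c _ /=.
by rewrite scaler_sumr; apply: eq_bigr => a _; rewrite ffunE scalerA.
Qed.

Let l1_R12 (V : lmodType K) (F : I * I * I -> V) :
  l1 [ffun u : I * I * I => R (u.1.1, u.1.2) * aone H u.2] F =
  rm (fun a b => one (fun c => F (a, b, c))).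
Proof.
rewrite l1_triple; apply: eq_bigr => a _; apply: eq_bigr => b _ /=.
by rewrite scaler_sumr; apply: eq_bigr => c _; rewrite ffunE scalerA.
Qed.

Let mul3 (V : lmodType K) (F : I -> I -> I -> V) (u v : I * I * I) :
  l1 (amul (tens_algebra (tens_algebra H H) H) u v) (fun w => F w.1.1 w.1.2 w.2) =
  ml u.1.1 v.1.1 (fun p => ml u.1.2 v.1.2 (fun q => ml u.2 v.2 (fun r => F p q r))).
Proof.
rewrite (l1_tens_amul (tens_algebra H H) H u v (fun w c => F w.1 w.2 c)).
exact: (l1_tens_amul H H u.1 v.1 (fun p q => ml u.2 v.2 (fun r => F p q r))).
Qed.

Lemma rmx_comul_l (V : lmodType K) (F : I -> I -> I -> V) :
  rm (fun i c => cm i (fun a b => F a b c)) =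
  rm (fun a c => rm (fun b d => ml c d (fun q => F a b q))).
Proof.
have [_ _ /(congr1 (fun x : {ffun _ -> K} => l1 x (fun u => F u.1.1 u.1.2 u.2)))] := R_mx.
rewrite l1_elt_mul l1_R13 => E _.
transitivity (rm (fun a c => one (fun b => rm (fun b' c' => one (fun a' =>
    ml a a' (fun p => ml b b' (fun q => ml c c' (fun r => F p q r)))))))); last first.
  apply: eq_l2 => a c; rewrite l12C; apply: eq_l2 => b' c'.
  under eq_l1 => b do rewrite (amul1r H_alg).
  by rewrite (amul1l H_alg).
transitivity (l1 [ffun u : I * I * I => \sum_i R (i, u.2) * comul H i u.1.1 u.1.2]
    (fun u => F u.1.1 u.1.2 u.2)).
  rewrite l1_triple.
  transitivity (\sum_i \sum_c \sum_a \sum_b (rmx i c * comul H i a b) *: F a b c).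
    by apply: eq_bigr => i _; apply: eq_bigr => c _; rewrite scaler_sumr;
      apply: eq_bigr => a _; rewrite scaler_sumr; apply: eq_bigr => b _; rewrite scalerA.
  rewrite exchange_big /=; under eq_bigr do (rewrite exchange_big; under eq_bigr do rewrite exchange_big).
  rewrite exchange_big; apply: eq_bigr => a _ /=; rewrite exchange_big; apply: eq_bigr => b _ /=.
  by apply: eq_bigr => c _; rewrite ffunE scaler_suml.
rewrite E; apply: eq_l2 => a c; apply: eq_l1 => b; rewrite l1_R23.
by apply: eq_l2 => b' c'; apply: eq_l1 => a'; rewrite mul3.
Qed.

Lemma rmx_comul_r (V : lmodType K) (F : I -> I -> I -> V) :
  rm (fun a j => cm j (fun b c => F a b c)) =
  rm (fun a c => rm (fun b d => ml a b (fun p => F p d c))).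
Proof.
have [_ _ _ /(congr1 (fun x : {ffun _ -> K} => l1 x (fun u => F u.1.1 u.1.2 u.2)))] := R_mx.
rewrite l1_elt_mul l1_R13 => E.
transitivity (rm (fun a c => one (fun b => rm (fun a' b' => one (fun c' =>
    ml a a' (fun p => ml b b' (fun q => ml c c' (fun r => F p q r)))))))); last first.
  apply: eq_l2 => a c; rewrite l12C; apply: eq_l2 => a' b'.
  transitivity (ml a a' (fun p => one (fun b => ml b b' (fun q => one (fun c' =>
      ml c c' (fun r => F p q r)))))).
    rewrite [RHS]l11C; apply: eq_l1 => b.
    rewrite l11C; apply: eq_l1 => p.
    by rewrite l11C.
  by apply: eq_l1 => p; rewrite (amul1l H_alg b' (fun q => one (fun c' => ml c c' (fun r => F p q r)))) (amul1r H_alg).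
transitivity (l1 [ffun u : I * I * I => \sum_j R (u.1.1, j) * comul H j u.1.2 u.2]
    (fun u => F u.1.1 u.1.2 u.2)).
  rewrite l1_triple; apply: eq_bigr => a _.
  transitivity (\sum_j \sum_b \sum_c (rmx a j * comul H j b c) *: F a b c).
    by apply: eq_bigr => j _; rewrite scaler_sumr;
      apply: eq_bigr => b _; rewrite scaler_sumr; apply: eq_bigr => c _; rewrite scalerA.
  rewrite exchange_big; apply: eq_bigr => b _ /=; rewrite exchange_big; apply: eq_bigr => c _ /=.
  by rewrite ffunE scaler_suml.
rewrite E; apply: eq_l2 => a c; apply: eq_l1 => b; rewrite l1_R12.
by apply: eq_l2 => b' c'; apply: eq_l1 => a'; rewrite mul3.
Qed.

Lemma rmx_comul_op (V : lmodType K) x (F : I -> I -> V) :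
  cm x (fun a b => rm (fun c d => ml b c (fun p => ml a d (fun q => F p q)))) =
  rm (fun c d => cm x (fun a b => ml c a (fun p => ml d b (fun q => F p q)))).
Proof.
have [_ /(_ (basis K x))/(congr1 (fun x : {ffun _ -> K} => l1 x (fun u => F u.1 u.2)))] := R_mx.
rewrite !l1_elt_mul => E _ _.
transitivity (l1 [ffun u : I * I => elt_comul H (basis K x) (u.2, u.1)] (fun i => l1 R (fun j =>
    l1 (amul (tens_algebra H H) i j) (fun u : I * I => F u.1 u.2)))).
  rewrite l1_pair /l2 [RHS]exchange_big; apply: eq_bigr => a _; apply: eq_bigr => b _ /=.
  rewrite ffunE /= comul_basis l1_pair; congr (_ *: _); apply: eq_l2 => c d.
  exact/esym/(l1_tens_amul H H (b, a) (c, d) F).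
rewrite {}E l1_pair; apply: eq_l2 => c d; rewrite l1_pair.
apply: eq_bigr => a _; apply: eq_bigr => b _; rewrite comul_basis; congr (_ *: _).
exact: (l1_tens_amul H H (c, d) (a, b) F).
Qed.

Lemma rmx_inverse : exists ri : I -> I -> K, forall (V : lmodType K) (F : I -> I -> V),
  rm (fun a b => l2 ri (fun c d => ml a c (fun p => ml b d (fun q => F p q)))) =
  one (fun p => one (fun q => F p q)).
Proof.
have [[Ri [E _]] _ _ _] := R_mx; exists (fun a b => Ri (a, b)) => V F.
have {E} := congr1 (fun x : {ffun _ -> K} => l1 x (fun u => F u.1 u.2)) E.
rewrite l1_elt_mul l1_elt_one l1_tens_aone => <-.
rewrite l1_pair; apply: eq_l2 => a b; rewrite l1_pair; apply: eq_l2 => c d.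
exact/esym/(l1_tens_amul H H (a, b) (c, d) F).
Qed.

(** Applying eps to the first leg of R_13 R_23 gives R = (1 (x) e) R with e = (eps (x) id)(R).
    Cancel the invertible R. *)
Lemma rmx_counit_l (V : lmodType K) (F : I -> V) :
  rm (fun a b => counit H a *: F b) = one F.
Proof.
have [ri Rri] := rmx_inverse.
pose F2 p r := counit H p *: F r.
have F21 r : one (fun p => F2 p r) = F r by rewrite -l1_scal (counit1 H_bi) scale1r.
pose G b q := l2 ri (fun c d => ml b c (fun p => ml q d (fun r => F2 p r))).
have := rmx_comul_l (fun a b q => counit H a *: G b q).
under eq_l2 => i c do rewrite (comul1l H_coalg i (fun b => G b c)).
rewrite Rri l11C; under eq_l1 => q do rewrite F21.
move=> ->; apply: eq_l2 => a c.
transitivity (counit H a *: rm (fun b d => ml c d (G b))); last first.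
  by rewrite l2Z; apply: eq_l2 => b d; rewrite l1Z.
congr (_ *: _).
transitivity (rm (fun b d => l2 ri (fun c' d' => ml b c' (fun p => ml d d' (fun q =>
    ml c q (fun r => F2 p r)))))).
  by rewrite (Rri V (fun p q => ml c q (F2 p))) l11C; under [RHS]eq_l1 => q do rewrite l11C;
    rewrite (amul1r H_alg) /= F21.
apply: eq_l2 => b d; rewrite l12C; apply: eq_l2 => c' d'; rewrite [RHS]l11C.
by apply: eq_l1 => p; rewrite (amulA H_alg).
Qed.

Lemma rmx_counit_r (V : lmodType K) (F : I -> V) :
  rm (fun a b => counit H b *: F a) = one F.
Proof.
have [ri Rri] := rmx_inverse.
pose F2 s r := counit H r *: F s.
have F21 s : one (fun r => F2 s r) = F s by rewrite -l1_scal (counit1 H_bi) scale1r.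
pose G p d := l2 ri (fun c' d' => ml p c' (fun s => ml d d' (fun r => F2 s r))).
have := rmx_comul_r (fun a b c => counit H c *: G a b).
under eq_l2 => a j do rewrite (comul1r H_coalg j (G a)).
rewrite Rri; under eq_l1 => p do rewrite F21.
move=> ->; apply: eq_l2 => a c.
transitivity (counit H c *: rm (fun b d => ml a b (fun p => G p d))); last first.
  by rewrite l2Z; apply: eq_l2 => b d; rewrite l1Z.
congr (_ *: _).
transitivity (rm (fun b d => l2 ri (fun c' d' => ml b c' (fun p => ml d d' (fun q =>
    ml a p (fun s => F2 s q)))))).
  rewrite (Rri V (fun p q => ml a p (F2^~ q))).
  under eq_l1 => p do rewrite l11C.
  by rewrite (amul1r H_alg) F21.
apply: eq_l2 => b d; rewrite l12C; apply: eq_l2 => c' d'.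
transitivity (ml b c' (fun p => ml a p (fun s => ml d d' (F2 s)))).
  by apply: eq_l1 => p; rewrite l11C.
by rewrite -(amulA H_alg).
Qed.

Hypothesis S_unit :
  (\matrix_(a < #|I|, b < #|I|) antipode H (enum_val a) (enum_val b)) \in unitmx.

Local Notation av x F := (l1 (antipodeV H x) F).

Let rm_mul_an (V : lmodType K) (F : I -> I -> V) :
  rm (fun a c => rm (fun b d => ml a b (fun p => an d (fun s => ml s c (fun q => F p q))))) =
  one (fun p => one (F p)).
Proof.
rewrite -(rmx_comul_r (fun p d c => an d (fun s => ml s c (F p)))).
under eq_l2 => a j do rewrite (antipodeL H_hopf j (F a)).
exact: (rmx_counit_r (fun a => one (F a))).
Qed.

Let rm_av_mul (V : lmodType K) (F : I -> I -> V) :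
  rm (fun a c => rm (fun b d => ml c d (fun q => av b (fun s => ml s a (fun p => F p q))))) =
  one (fun p => one (F p)).
Proof.
rewrite -(rmx_comul_l (fun a b q => av b (fun s => ml s a (F^~ q)))).
under eq_l2 => i c do rewrite (antipodeVL H_hopf S_unit i (F^~ c)).
by rewrite (rmx_counit_l (fun c => one (F^~ c))) l11C.
Qed.

(* Both sides are one-sided inverses of R in H (x) H^op. *)
Lemma rmx_antipode (V : lmodType K) (F : I -> I -> V) :
  rm (fun a b => av a (fun s => F s b)) = rm (fun a b => an b (fun s => F a s)).
Proof.
transitivity (rm (fun e f => av e (fun u => rm (fun a c => rm (fun b d =>
    ml a b (fun p => an d (fun v => ml v c (fun q => ml u p (fun p' =>
    ml q f (fun q' => F p' q')))))))))).
  apply: eq_l2 => e f; apply: eq_l1 => u.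
  rewrite (rm_mul_an (fun p q => ml u p (fun p' => ml q f (fun q' => F p' q')))).
  under eq_l1 => p do rewrite l11C.
  by rewrite (amul1r H_alg) (amul1l H_alg).
transitivity (rm (fun b d => an d (fun v => rm (fun a c => rm (fun e f =>
    ml c f (fun q => av e (fun u => ml u a (fun p => ml p b (fun p' =>
    ml v q (fun q' => F p' q')))))))))); last first.
  apply: eq_l2 => b d; apply: eq_l1 => v.
  rewrite (rm_av_mul (fun p q => ml p b (fun p' => ml v q (fun q' => F p' q')))).
  under eq_l1 => p do rewrite l11C.
  by rewrite (amul1l H_alg) (amul1r H_alg).
transitivity (rm (fun b d => rm (fun a c => rm (fun e f => an d (fun v => av e (fun u =>
    ml u a (fun p => ml p b (fun p' => ml v c (fun q => ml q f (fun q' => F p' q')))))))))).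
  under eq_l2 => e f do (rewrite l12C; under eq_l2 => a c do rewrite l12C).
  rewrite l22C; under eq_l2 => a c do rewrite l22C.
  rewrite l22C; apply: eq_l2 => b d; apply: eq_l2 => a c; apply: eq_l2 => e f.
  under eq_l1 => u do rewrite l11C.
  rewrite l11C; apply: eq_l1 => v; apply: eq_l1 => u.
  rewrite (amulA H_alg u a b (fun p' => ml v c (fun q => ml q f (fun q' => F p' q')))).
  by apply: eq_l1 => p; rewrite l11C.
apply: eq_l2 => b d; rewrite [RHS]l12C; apply: eq_l2 => a c; rewrite [RHS]l12C; apply: eq_l2 => e f.
apply: eq_l1 => v; rewrite [RHS]l11C; apply: eq_l1 => u.
rewrite [RHS]l11C; apply: eq_l1 => p; rewrite [RHS]l11C; apply: eq_l1 => p'.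
by rewrite (amulA H_alg v c f (F p')).
Qed.

(** The element R is fixed by S (x) S, by [rmx_antipode]. *)
Lemma rmx_antipodeV_r (V : lmodType K) (F : I -> I -> V) :
  rm (fun a b => av b (fun s => F a s)) = rm (fun a b => an a (fun s => F s b)).
Proof.
transitivity (rm (fun a b => av a (fun s => an s (fun x => av b (fun y => F x y))))).
  by apply: eq_l2 => a b; rewrite (antipodeVK S_unit).
rewrite (rmx_antipode (fun s b => an s (fun x => av b (fun y => F x y)))).
apply: eq_l2 => a b; rewrite l11C; apply: eq_l1 => x.
by rewrite (antipodeK S_unit).
Qed.

Let rm_deltal (V : lmodType K) x (G : I -> V) :
  rm (fun a b => (a == x)%:R *: G b) = l1 (rmx x) G.
Proof.
rewrite /l2 (bigD1 x) //= [X in _ + X]big1 ?addr0 => [|a /negbTE ax].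
  by apply: eq_bigr => b _; rewrite eqxx scale1r.
by rewrite big1 // => b _; rewrite ax scale0r scaler0.
Qed.

Let rm_deltar (V : lmodType K) y (G : I -> V) :
  rm (fun a b => (b == y)%:R *: G a) = l1 (rmx^~ y) G.
Proof. by apply: eq_bigr => a _; rewrite -(l1_deltar (rmx a) y) l1_scal. Qed.

(** A functional f acts by (f (x) id)(R). This is multiplicative by [rmx_comul_l] and unital by
    [rmx_counit_l], and the Yetter-Drinfeld condition is the relation of [rmx_comul_op] between R
    and the two coproducts. *)
Lemma rmx_drep M : is_module H M ->
  exists2 X, is_module (double H) X & res H X = M.
Proof.
case: M => n rho mM; have [/= MM M1] := mM.
pose phi a := l1 (rmx a) rho.
have phi_module : is_module (dual_algebra H) (Rep phi).
  split=> [a b|] /=; last first.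
    rewrite -[RHS]M1 -[RHS](rmx_counit_l rho); apply: eq_bigr => a _.
    by rewrite scaler_sumr; apply: eq_bigr => b _; rewrite !scalerA mulrC.
  transitivity (rm (fun a' c => (a' == a)%:R *: rm (fun b' d => (b' == b)%:R *: ml c d rho))).
    rewrite rm_deltal /phi l1_mulmxl; apply: eq_l1 => c.
    by rewrite rm_deltal l1_mulmxr; apply: eq_l1 => d; exact: MM.
  transitivity (rm (fun i c => cm i (fun a' b' => ((a' == a)%:R * (b' == b)%:R) *: rho c))).
    rewrite (rmx_comul_l (fun a' b' q => ((a' == a)%:R * (b' == b)%:R) *: rho q)).
    apply: eq_l2 => a' c; rewrite l2Z; apply: eq_l2 => b' d.
    by rewrite scalerA l1Z.
  apply: eq_bigr => k _; rewrite scaler_sumr; apply: eq_bigr => c _.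
  by rewrite -l2_scal l2_deltar !scalerA mulrC.
exists (drep rho phi); last by rewrite res_drep.
apply: drep_module => // i F.
transitivity (rm (fun c d => cm i (fun a b => ml c a (fun p => ml d b (fun q => F p *: rho q))))).
  rewrite -rmx_comul_op; apply: eq_l2 => j k; rewrite /phi.
  under eq_l1 => x do rewrite l1_mulmxr.
  transitivity (rm (fun x b => ml k x F *: (rho j *m rho b))).
    by apply: eq_bigr => x _; rewrite scaler_sumr; apply: eq_bigr => b _; rewrite !scalerA mulrC.
  apply: eq_l2 => x b; rewrite l1_scal; apply: eq_l1 => p.
  by rewrite MM -[RHS]l1Z.
rewrite l22C; apply: eq_l2 => j k; rewrite /phi.
under [RHS]eq_l1 => x do rewrite l1_mulmxl.
transitivity (rm (fun x b => ml x j F *: (rho b *m rho k))).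
  apply: eq_l2 => x b; rewrite l1_scal; apply: eq_l1 => p.
  by rewrite MM -[LHS]l1Z.
by apply: eq_bigr => x _; rewrite scaler_sumr; apply: eq_bigr => b _; rewrite !scalerA mulrC.
Qed.

Variable lam : I -> K.
Hypothesis lam1 : one (lam : I -> K^o) = 1.
Hypothesis lamR : forall (V : lmodType K) i (F : I -> V),
  cm i (fun a b => lam a *: F b) = lam i *: one F.
Let L x y : K := ml x y (lam : I -> K^o).
Let lamL := integral_two_sided H_hopf lam1 lamR.
Let transL := integral_translate_l H_hopf lam1 lamR.

Let ll : K := rm (fun a b => lam a *: (lam b : K^o)).

(** Apply S (x) lam (x) lam to R_13 R_23, which is R with the coproduct applied to its first leg;
    invariance of lam collapses that leg. *)
Let collapse_z (V : lmodType K) (G : I -> V) :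
  rm (fun a c => rm (fun p j => (lam p * L c j) *: an a G)) = ll *: one G.
Proof.
transitivity (rm (fun i c => (lam i * lam c) *: one G)); last by rewrite -l2_scal.
transitivity (rm (fun i c => cm i (fun a b => lam b *: an a (fun x => lam c *: G x)))); last first.
  apply: eq_l2 => i c; rewrite (lamL i (fun a => an a (fun x => lam c *: G x))).
  by rewrite (antipode1 H_hopf) -l1Z scalerA.
rewrite (rmx_comul_l (fun a b c => lam b *: an a (fun x => lam c *: G x))).
apply: eq_l2 => a c; apply: eq_l2 => p j.
rewrite mulrC -scalerA.
transitivity (ml c j (fun q => lam q *: (lam p *: an a G))); first by rewrite -l1_scal.
by apply: eq_l1 => q; rewrite scalerA mulrC -scalerA; congr (_ *: _); rewrite l1Z.
Qed.

(* With t, r, R denoting copies of the R-matrix, R' and R'' its legs, one has   *)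
(* S(t') lam(t'' R'') lam(R' r') (x) r'' = (lam (x) lam)(R) S(t') (x) S(t'').  *)
Let quadratic (V : lmodType K) (F : I -> I -> V) : ll = 0 ->
  rm (fun a b => rm (fun c d => rm (fun e f => an a (fun s => (L b d * L c e) *: F s f)))) = 0.
Proof.
move=> ll0.
transitivity (rm (fun a b => cm b (fun b1 b2 => an a (fun s => rm (fun p j =>
    (lam p * L b2 j) *: an b1 (fun v => F s v)))))).
  apply: eq_l2 => a b.
  transitivity (an a (fun s => rm (fun c d => rm (fun e f =>
      ml c e (fun p => lam p *: (L b d *: F s f)))))).
    rewrite l12C; apply: eq_l2 => c d; rewrite l12C; apply: eq_l2 => e f.
    by apply: eq_l1 => s; rewrite -l1_scal scalerA mulrC.
  rewrite -l12C; apply: eq_l1 => s.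
  rewrite -(rmx_comul_r (fun p f d => lam p *: (L b d *: F s f))).
  rewrite l22C; apply: eq_l2 => p j.
  rewrite -l2Z (transL b j (F s)) l2Z.
  by apply: eq_l2 => b1 b2; rewrite scalerA.
rewrite (rmx_comul_r (fun a b1 b2 => an a (fun s => rm (fun p j =>
    (lam p * L b2 j) *: an b1 (fun v => F s v))))).
transitivity (rm (fun b d => an b (fun y => rm (fun a c => rm (fun p j =>
    (lam p * L c j) *: an a (fun x => ml y x (fun s => an d (F s)))))))).
  rewrite l22C; apply: eq_l2 => b d; rewrite [RHS]l12C; apply: eq_l2 => a c.
  rewrite (antipodeM H_hopf); apply: eq_l1 => y.
  under eq_l1 => x do rewrite l12C.
  rewrite l12C; apply: eq_l2 => p j; rewrite l1Z; apply: eq_l1 => x; rewrite l1Z.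
  by [].
transitivity (rm (fun b d => an b (fun y => (0 : V)))).
  apply: eq_l2 => b d; apply: eq_l1 => y.
  by rewrite (collapse_z (fun x => ml y x (fun s => an d (F s)))) ll0 scale0r.
rewrite /l2 big1 // => b _; rewrite big1 // => d _.
by rewrite /l1 big1 ?scaler0 // => y _; rewrite scaler0.
Qed.

Let tr_mxI (f : I -> I -> K) : \tr (mxI f) = \sum_x f x x.
Proof.
rewrite [RHS](reindex (@enum_val I I)) /=; last by apply: onW_bij; exact: enum_val_bij.
by apply: eq_bigr => i _; rewrite mxE.
Qed.

(* Write P, S, M for the matrices of R, of the antipode and of lam(xy), and     *)
(* G = M P^T M. If (lam (x) lam)(R) = 0, then P G P = 0 by [quadratic], while  *)
(* tr (P S G) = 1 because (lam (x) lam) (R' t' (x) S(t'') R'') = 1. But        *)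
(* P S = S^-T P and P = P F P for some F, so tr (P S G) = tr (S F P G P) = 0.  *)
Lemma integral_rmx_neq0 : ll != 0.
Proof.
apply/eqP => ll0.
pose P := mxI rmx; pose S := mxI (antipode H); pose T := mxI (antipodeV H).
pose M := mxI L; pose G := M *m P^T *m M.
have mxIT f : (mxI f)^T = mxI (fun x y => f y x) :> 'M[K]_#|I|.
  by apply/matrixP => i j; rewrite !mxE.
have PGP : P *m G *m P = 0.
  rewrite /G !mulmxA /P /M mxIT !mxI_mul; apply/matrixP => i j; rewrite mxE [RHS]mxE.
  set x := enum_val i; set y := enum_val j.
  rewrite -(quadratic (fun s f => av s (fun k => (k == x)%:R * (f == y)%:R : K^o)) ll0).
  transitivity (l1 (rmx x) (fun b => l1 (L b) (fun d => l1 (rmx^~ d) (fun c =>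
      l1 (L c) (fun e => rmx e y : K^o))))).
    etransitivity; first exact: (l1_comp (V := K^o) _ L).
    etransitivity; first exact: (l1_comp (V := K^o) _ (fun i k => rmx k i)).
    exact: (l1_comp (V := K^o) _ L).
  transitivity (rm (fun a b => (a == x)%:R *: rm (fun c d => rm (fun e f =>
      (f == y)%:R *: (L b d * L c e : K^o))))); last first.
    apply: (eq_l2 (V := K^o)) => a b; rewrite l2Z; apply: (eq_l2 (V := K^o)) => c d.
    rewrite l2Z; apply: (eq_l2 (V := K^o)) => e f.
    rewrite -[RHS]l1Z (antipodeK S_unit a (fun k => (k == x)%:R * (f == y)%:R : K^o)).
    by rewrite /GRing.scale /=; ring.
  rewrite rm_deltal; apply: (eq_l1 (V := K^o)) => b; under [RHS]eq_l2 => c d do rewrite rm_deltar.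
  rewrite /l2 [RHS]exchange_big; apply: eq_bigr => d _ /=; rewrite /l1 scaler_sumr.
  apply: eq_bigr => c _; rewrite !scaler_sumr; apply: eq_bigr => e _.
  by rewrite /GRing.scale /=; ring.
have trPSG : \tr (P *m S *m G) = 1.
  rewrite /G !mulmxA /P /S /M mxIT !mxI_mul tr_mxI.
  transitivity (rm (fun b d => an d (fun s => l1 (L s) (fun c => l1 (rmx^~ c) (fun a =>
      L a b : K^o))))).
    apply: eq_bigr => b _.
    etransitivity; first exact: (l1_comp (V := K^o) _ (fun i k => rmx k i)).
    etransitivity; first exact: (l1_comp (V := K^o) _ L).
    exact: (l1_comp (V := K^o) _ (antipode H)).
  transitivity (one (lam : I -> K^o) *: one (lam : I -> K^o)); last by rewrite lam1 /GRing.scale /= mulr1.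
  rewrite l1_scal; under [RHS]eq_l1 => p do rewrite l1Z.
  rewrite -(rm_mul_an (fun p q => lam p *: (lam q : K^o))) l22C; apply: (eq_l2 (V := K^o)) => b d.
  transitivity (rm (fun a c => an d (fun s => L a b *: (L s c : K^o)))); last first.
    apply: (eq_l2 (V := K^o)) => a c; rewrite -l1Z l1_scal; apply: (eq_l1 (V := K^o)) => p.
    by rewrite l1Z; apply: (eq_l1 (V := K^o)) => s; rewrite l1Z.
  rewrite -l12C; apply: (eq_l1 (V := K^o)) => s; rewrite /l2 exchange_big; apply: eq_bigr => c _ /=.
  by rewrite scaler_sumr; apply: eq_bigr => a _; rewrite /GRing.scale /=; ring.
have PS : P *m S = T^T *m P.
  rewrite mxIT !mxI_mul; apply: eq_mxI => x z.
  transitivity (rm (fun a b => an b (fun s => (a == x)%:R *: ((s == z)%:R : K^o)))).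
    by rewrite -rm_deltal; apply: (eq_l2 (V := K^o)) => a b; rewrite -l1Z l1_deltar.
  rewrite -(rmx_antipode (fun a s => (a == x)%:R *: ((s == z)%:R : K^o))).
  transitivity (l1 (rmx^~ z) (fun a => antipodeV H a x : K^o)).
    rewrite -rm_deltar; apply: (eq_l2 (V := K^o)) => a b.
    by rewrite -l1_scal l1_deltar /GRing.scale /= mulrC.
  by apply: eq_bigr => a _; rewrite /GRing.scale /= mulrC.
have [F PFP] : exists F, P *m F *m P = P by exists (pinvmx P); rewrite mulmxKpV.
move: G PGP trPSG => G PGP trPSG.
suff : \tr (P *m S *m G) = 0 by rewrite trPSG => /eqP; rewrite oner_eq0.
rewrite PS -PFP !mulmxA -PS -!mulmxA mxtrace_mulC -!mulmxA.
by rewrite (mulmxA P G P) PGP !mulmx0 mxtrace0.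
Qed.

Let nak := nakayama H_hopf lam1 lamR.

(* Put z = lam(R') R''. Both sides are obtained by evaluating lam(z r'') r'    *)
(* divided by lam(z): z absorbs the second leg of R on either side.            *)
Lemma modular_rmx alpha (V : lmodType K) (F : I -> V) :
  (forall x y, L x y = cm y (fun a b => alpha b *:
     av a (fun c => av c (fun d => L d x : K^o)))) ->
  rm (fun a b => alpha b *: F a) = one F.
Proof.
move=> LE; apply: (scalerI integral_rmx_neq0).
pose W := rm (fun p j => lam p *: rm (fun a b => L j b *: F a)).
transitivity W; last first.
  have := rmx_comul_l (fun a b q => lam a *: (lam q *: F b)).
  under eq_l2 => i c do rewrite (lamR i (fun b => lam c *: F b)).
  move=> E; transitivity (rm (fun i c => lam i *: one (fun b => lam c *: F b))).
    rewrite E; apply: eq_l2 => p j; rewrite l2Z; apply: eq_l2 => a b.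
    by rewrite l1_scal l1Z.
  rewrite l2_scal; apply: eq_l2 => p j.
  by rewrite -l1Z scalerA.
pose TT (G : I -> V) x := av x (fun c => av c G).
(* S^-2 on the second leg of R becomes S^2 on the first, by two uses of [rmx_antipodeV_r]. *)
have TTr (G : I -> I -> V) : rm (fun b d => TT (G b) d) =
    rm (fun b d => an b (fun y => an y (fun x => G x d))).
  rewrite /TT (rmx_antipodeV_r (fun b c => av c (G b))).
  under eq_l2 => b d do rewrite l11C.
  rewrite (rmx_antipodeV_r (fun b e => an b (fun x => G x e))).
  by [].
pose E3 j p d c := alpha c *: (TT (fun d' => L d' j *: F p) d).
transitivity (rm (fun p j => lam p *: rm (fun a b => cm b (fun b1 b2 => E3 j a b1 b2)))); last first.
  apply: eq_l2 => p j; congr (_ *: _); apply: eq_l2 => a b.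
  rewrite LE l2_scal; apply: eq_l2 => b1 b2.
  rewrite -scalerA; congr (_ *: _); rewrite l1_scal; apply: eq_l1 => c.
  by rewrite l1_scal.
transitivity (rm (fun p j => lam p *: rm (fun a c => rm (fun b d => ml a b (fun k => E3 j k d c))))); last first.
  by apply: eq_l2 => p j; rewrite (rmx_comul_r (E3 j)).
(* The second absorption property of z, from the invariance of lam on the other side. *)
have zQ (Q : I -> V) : rm (fun p j => lam p *: rm (fun b d => L d j *: Q b)) = ll *: one Q.
  have := rmx_comul_l (fun a b q => lam b *: (lam q *: Q a)).
  under eq_l2 => i c do rewrite (lamL i (fun a => lam c *: Q a)).
  move=> E; transitivity (rm (fun i c => lam i *: one (fun a => lam c *: Q a))).
    rewrite E l22C; apply: eq_l2 => p j; rewrite l2Z; apply: eq_l2 => b d.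
    by rewrite l1_scal l1Z.
  by rewrite l2_scal; apply: eq_l2 => i c; rewrite -l1Z scalerA.
transitivity (rm (fun a c => alpha c *: rm (fun p j => lam p *: rm (fun b d => L d j *:
    an b (fun y => an y (fun x => ml a x F)))))).
  rewrite l2Z; apply: eq_l2 => a c; rewrite zQ !(antipode1 H_hopf) (amul1r H_alg).
  by rewrite !scalerA mulrC.
under [RHS]eq_l2 => p j do rewrite l2Z.
rewrite [RHS]l22C; apply: eq_l2 => a c; rewrite l2Z; apply: eq_l2 => p j.
rewrite scalerA mulrC -scalerA; congr (_ *: _).
pose G b d' := ml a b (fun k => L d' j *: F k).
transitivity (alpha c *: rm (fun b d => TT (G b) d)).
  congr (_ *: _); rewrite TTr; apply: eq_l2 => b d; rewrite l1Z; apply: eq_l1 => y.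
  by rewrite l1Z; apply: eq_l1 => x; rewrite /G -l1Z.
rewrite l2Z; apply: eq_l2 => b d; rewrite /E3 -l1Z; congr (_ *: _).
rewrite /TT [RHS]l11C; apply: eq_l1 => x; rewrite [RHS]l11C; apply: eq_l1 => y.
by [].
Qed.

(** Applying alpha to the second leg of [rmx_comul_op], with [modular_rmx], shows that alpha is
    central in H^* . Then [nakayama] gives lam(S^-1(j_2) x j_1) = alpha(j) lam(x). At x = 1 the left
    side is eps(j), so alpha = eps. *)
Lemma cosemisimple_rmx_integral i x :
  cm i (fun p r => double_coef H lam x p r : K^o) = counit H i * lam x.
Proof.
have [alpha [alphaM LE]] := nak.
have Ra (V : lmodType K) (F : I -> V) := modular_rmx F LE.
have central (V : lmodType K) y (F : I -> V) :
    cm y (fun a b => alpha b *: F a) = cm y (fun a b => alpha a *: F b).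
  have E : cm y (fun a b => rm (fun c d => (alpha a * alpha d) *: ml b c F)) =
           rm (fun c d => cm y (fun a b => (alpha d * alpha b) *: ml c a F)).
    have := rmx_comul_op y (fun p q => alpha q *: F p).
    under eq_l2 => a b do under eq_l2 => c d do rewrite l11C.
    under [in RHS]eq_l2 => c d do under eq_l2 => a b do rewrite l11C.
    under eq_l2 => a b do under eq_l2 => c d do under eq_l1 => q do rewrite -l1Z.
    under eq_l2 => a b do under eq_l2 => c d do rewrite -l1_scal alphaM.
    under [in RHS]eq_l2 => c d do under eq_l2 => a b do under eq_l1 => q do rewrite -l1Z.
    by under [in RHS]eq_l2 => c d do under eq_l2 => a b do rewrite -l1_scal alphaM.
  transitivity (rm (fun c d => cm y (fun a b => (alpha d * alpha b) *: ml c a F))).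
    rewrite l22C; apply: eq_l2 => a b.
    transitivity (rm (fun c d => alpha d *: (alpha b *: ml c a F))).
      by rewrite Ra -l1Z (amul1l H_alg).
    by apply: eq_l2 => c d; rewrite scalerA.
  rewrite -E; apply: eq_l2 => a b.
  transitivity (rm (fun c d => alpha d *: (alpha a *: ml b c F))).
    by apply: eq_l2 => c d; rewrite scalerA mulrC.
  by rewrite Ra -l1Z (amul1r H_alg).
have aJ j y : cm j (fun p r => double_coef H lam y p r : K^o) = alpha j * lam y.
  pose G b r : K^o := av b (fun c => av c (fun d => av r (fun s => ml s y (fun t => L d t : K^o)))).
  have GE q : cm q G = counit H q *: (lam y : K^o).
    transitivity (cm q (fun b r => av b (fun c => ml r c (fun k => av k (fun u => L u y : K^o))))).
      apply: (eq_l2 (V := K^o)) => b r; apply: (eq_l1 (V := K^o)) => c.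
      rewrite (antipodeVM H_hopf S_unit); apply: (eq_l1 (V := K^o)) => d.
      by apply: (eq_l1 (V := K^o)) => s; rewrite [RHS](amulA H_alg).
    rewrite (antipodeVR H_hopf S_unit q (fun k => av k (fun u => L u y : K^o))).
    by rewrite (antipodeV1 H_hopf S_unit) (amul1l H_alg).
  transitivity (cm j (fun p r => cm p (fun a b => alpha b *: G a r))).
    apply: (eq_l2 (V := K^o)) => p r; rewrite /double_coef.
    transitivity (av r (fun s => ml s y (fun t => cm p (fun a b => alpha b *:
        av a (fun c => av c (fun d => L d t : K^o)))))).
      by apply: (eq_l1 (V := K^o)) => s; apply: (eq_l1 (V := K^o)) => t; rewrite -LE.
    under eq_l1 => s do rewrite l12C.
    rewrite l12C; apply: (eq_l2 (V := K^o)) => a b.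
    under eq_l1 => s do rewrite -l1Z.
    rewrite -l1Z; congr (_ *: _).
    under eq_l1 => s do rewrite l11C.
    rewrite l11C; apply: (eq_l1 (V := K^o)) => c.
    under eq_l1 => s do rewrite l11C.
    by rewrite l11C.
  under eq_l2 => p r do rewrite (central K^o p (G^~ r)).
  rewrite (comulA H_coalg j (fun a b r => alpha a *: G b r)).
  under eq_l2 => a q do rewrite -l2Z GE.
  rewrite -[RHS](comul1r H_coalg j (fun a => alpha a *: (lam y : K^o))).
  by apply: (eq_l2 (V := K^o)) => a q; rewrite !scalerA mulrC.
have alpha_counit j : alpha j = counit H j.
  transitivity (one (fun x => cm j (fun p r => double_coef H lam x p r : K^o))).
    under eq_l1 => y do rewrite aJ.
    by rewrite -(l1Z (V := K^o)) lam1 /GRing.scale /= mulr1.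
  rewrite l12C -[RHS]mulr1 -lam1 -[RHS](antipodeVL H_hopf S_unit j (lam : I -> K^o)).
  apply: (eq_l2 (V := K^o)) => p r; rewrite l11C; apply: (eq_l1 (V := K^o)) => s.
  by rewrite (amul1r H_alg).
by rewrite aJ alpha_counit.
Qed.

End RMatrix.

Lemma quasitriangular_spectrum (K : fieldType) (I : finType) (H : hopf K I) :
  is_hopf H -> cosemisimple H -> quasitriangular H ->
  res_homeomorphism H /\ thick_ideals_bijection H.
Proof.
move=> H_hopf H_coss [R R_mx].
have [lam lam1 lamR] := cosemisimple_integral H_hopf H_coss.
have S_unit := antipode_unit H_hopf lam1 lamR.
apply: (spectrum_transfer H_hopf S_unit).
  apply: (unit_retract_ind H_hopf S_unit lam1).
    exact: (integral_two_sided H_hopf lam1 lamR).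
  exact: (cosemisimple_rmx_integral H_hopf R_mx S_unit lam1 lamR).
move=> M mM; have [X mX resX] := rmx_drep H_hopf R_mx S_unit mM.
by exists X => // J _; rewrite resX.
Qed.
(** * Smash coproducts *)

Section HopfFromForms.
Variables (K : fieldType) (I : finType) (H : hopf K I).

Local Notation cm x F := (l2 (comul H x) F).
Local Notation ml x y F := (l1 (amul H x y) F).
Local Notation an x F := (l1 (antipode H x) F).
Local Notation one F := (l1 (aone H) F).

Hypotheses
  (mulA : forall i j k (F : I -> K^o),
    ml i j (fun a => ml a k F) = ml j k (fun a => ml i a F))
  (mul1l : forall i (F : I -> K^o), one (fun a => ml a i F) = F i)
  (mul1r : forall i (F : I -> K^o), one (fun a => ml i a F) = F i)
  (comA : forall i (F : I -> I -> I -> K^o),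
    cm i (fun j c => cm j (fun a b => F a b c)) = cm i (fun a j => cm j (fun b c => F a b c)))
  (com1l : forall i (F : I -> K^o), cm i (fun a b => counit H a *: F b) = F i)
  (com1r : forall i (F : I -> K^o), cm i (fun a b => counit H b *: F a) = F i)
  (comM : forall i j (F : I -> I -> K^o), ml i j (fun k => cm k F) =
    cm i (fun a b => cm j (fun c d => ml a c (fun p => ml b d (fun q => F p q)))))
  (com1 : forall F : I -> I -> K^o, one (fun k => cm k F) = one (fun a => one (F a)))
  (epsM : forall i j, ml i j (counit H : I -> K^o) = counit H i * counit H j)
  (eps1 : one (counit H : I -> K^o) = 1)
  (antL : forall i (F : I -> K^o),
    cm i (fun a b => an a (fun s => ml s b F)) = counit H i *: one F)
  (antR : forall i (F : I -> K^o),
    cm i (fun a b => an b (fun s => ml a s F)) = counit H i *: one F).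

Let ext (A : finType) (x y : {ffun A -> K}) :
  (forall F : A -> K^o, l1 x F = l1 y F) -> x = y.
Proof.
by move=> xy; apply/ffunP => i; have := xy (fun b => (b == i)%:R); rewrite !l1_deltar.
Qed.

(** Converse of the Sweedler laws: an element is determined by the scalar forms on it, and
    coordinate forms recover the coefficient identities. *)
Lemma hopf_of_forms : is_hopf H.
Proof.
have ext2 (x y : {ffun I * I -> K}) : (forall F : I -> I -> K^o,
    l1 x (fun u => F u.1 u.2) = l1 y (fun u => F u.1 u.2)) -> x = y.
  move=> xy; apply: ext => F; have := xy (fun a b => F (a, b)).
  by under eq_l1 => u do rewrite -surjective_pairing;
    under [RHS]eq_l1 => u do rewrite -surjective_pairing.
split; first split.
- split=> [x y z|x|x]; apply: ext => F.
  + rewrite !l1_elt_mul; apply: eq_l1 => i; rewrite !l1_elt_mul; apply: eq_l1 => j.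
    by rewrite [RHS]l11C; apply: eq_l1 => k; rewrite mulA.
  + by rewrite l1_elt_mul l1_elt_one l11C; apply: (eq_l1 (V := K^o)) => i; rewrite mul1l.
  + by rewrite l1_elt_mul; apply: (eq_l1 (V := K^o)) => i; rewrite l1_elt_one mul1r.
- split=> [i a b c|i k|i j].
  + transitivity (cm i (fun j c' => comul H j a b *: ((c' == c)%:R : K^o))).
      by apply: eq_bigr => j _; rewrite -[RHS](l1Z (V := K^o)) l1_deltar mulrC.
    transitivity (cm i (fun a' j => comul H j b c *: ((a' == a)%:R : K^o))); last first.
      rewrite /l2 exchange_big; apply: eq_bigr => j _ /=.
      by rewrite -[LHS]/(l1 _ _) -(l1Z (V := K^o)) l1_deltar mulrC.
    have := comA i (fun p q r => ((p == a)%:R * (q == b)%:R) *: ((r == c)%:R : K^o)).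
    under eq_l2 => j r do rewrite -l2_scal l2_deltar.
    move=> ->; apply: (eq_l2 (V := K^o)) => p j.
    rewrite -(l2_deltar (comul H j)) l2_scal; apply: (eq_l2 (V := K^o)) => q r.
    by rewrite /GRing.scale /=; ring.
  + have := com1l i (fun b => (b == k)%:R); rewrite /l2 exchange_big => <-.
    rewrite [RHS](bigD1 k) //= [X in _ = _ + X]big1 ?addr0 => [|b /negbTE bk].
      by apply: eq_bigr => a _; rewrite eqxx /GRing.scale /= mulr1 mulrC.
    by rewrite big1 // => a _; rewrite bk !scaler0.
  + have := com1r i (fun b => (b == j)%:R); rewrite /l2 => <-.
    rewrite [RHS](bigD1 j) //= [X in _ = _ + X]big1 ?addr0 => [|b /negbTE bk].
      by apply: eq_bigr => a _; rewrite eqxx /GRing.scale /= mulr1.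
    by rewrite big1 // => a _; rewrite bk !scaler0.
- split.
    move=> x y; apply: ext2 => F.
    rewrite l1_elt_comul !l1_elt_mul.
    have e z G : l1 (elt_comul H z) G = l1 z (fun i => cm i (fun a b => G (a, b))) :> K^o.
      rewrite -(l1_elt_comul H z (fun a b => G (a, b))).
      by apply: eq_l1 => -[].
    rewrite e; apply: (eq_l1 (V := K^o)) => i.
    under [RHS]eq_l2 => a b do rewrite e.
    rewrite -l12C; apply: (eq_l1 (V := K^o)) => j; rewrite comM.
    apply: (eq_l2 (V := K^o)) => a b; apply: (eq_l2 (V := K^o)) => c d.
    exact/esym/(l1_tens_amul H H (a, b) (c, d) F).
  apply: ext2 => F.
  by rewrite l1_elt_comul !l1_elt_one com1 -(l1_tens_aone H H F).
- split=> [x y|]; rewrite !counitE ?l1_elt_one // l1_elt_mul.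
  transitivity (l1 x (fun i => l1 y (fun j => counit H i *: (counit H j : K^o)))).
    by apply: (eq_l1 (V := K^o)) => i; apply: (eq_l1 (V := K^o)) => j; rewrite epsM.
  rewrite -[RHS]/(_ *: _) l1_scal; apply: (eq_l1 (V := K^o)) => i; by rewrite -l1Z.
- move=> i; apply: (ext (A := I)) => F.
  etransitivity; first exact: (l1_sum_ffun _ F).
  transitivity (counit H i *: one F); last first.
    by rewrite -(l1_elt_one H F); exact/esym/(l1_scale_ffun _ (elt_one H) F).
  rewrite -antL; apply: eq_bigr => a _; etransitivity; first exact: (l1_sum_ffun _ F).
  apply: eq_bigr => b _; etransitivity; first exact: (l1_scale_ffun _ _ F).
  congr (_ *: _); etransitivity; first exact: (l1_elt_mul H _ _ F).
  by rewrite l1_elt_antipode; apply: (eq_l1 (V := K^o)) => s; rewrite l1_basis.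
move=> i; apply: (ext (A := I)) => F.
etransitivity; first exact: (l1_sum_ffun _ F).
transitivity (counit H i *: one F); last first.
  by rewrite -(l1_elt_one H F); exact/esym/(l1_scale_ffun _ (elt_one H) F).
rewrite -antR; apply: eq_bigr => a _; etransitivity; first exact: (l1_sum_ffun _ F).
apply: eq_bigr => b _; etransitivity; first exact: (l1_scale_ffun _ _ F).
congr (_ *: _); etransitivity; first exact: (l1_elt_mul H _ _ F).
by rewrite l1_basis l1_elt_antipode.
Qed.

End HopfFromForms.

Lemma sum_delta (K : fieldType) (V : lmodType K) (A : finType) (a : A) (F : A -> V) :
  \sum_b (b == a)%:R *: F b = F a.
Proof.
rewrite (bigD1 a) //= eqxx scale1r big1 ?addr0 // => b /negbTE ba.
by rewrite ba scale0r.
Qed.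

Section LeftAction.
Variables (gT lT : finGroupType) (to : groupAction [set: lT] [set: gT]).
Implicit Types (g h : gT) (x y : lT).

Lemma lact1 g : lact to 1 g = g.
Proof. by rewrite /lact invg1 act1. Qed.

Lemma lactM x y g : lact to (x * y)%g g = lact to x (lact to y g).
Proof. by rewrite /lact invMg actM. Qed.

Lemma lact_mul x g h : lact to x (g * h)%g = (lact to x g * lact to x h)%g.
Proof. by rewrite /lact gactM ?inE. Qed.

Lemma lact_inv x g : lact to x g^-1%g = (lact to x g)^-1%g.
Proof. by rewrite /lact gactV ?inE. Qed.

Lemma lact_1 x : lact to x 1%g = 1%g.
Proof. by rewrite /lact gact1 ?inE. Qed.

Lemma lact_eq1 x g : (lact to x g == 1%g) = (g == 1%g).
Proof.
apply/eqP/eqP => [E|->]; last exact: lact_1.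
by rewrite -(lact1 g) -(mulVg x) lactM E lact_1.
Qed.

End LeftAction.

Section SmashHopf.
Variables (K : fieldType) (gT lT : finGroupType).
Variable to : groupAction [set: lT] [set: gT].
Let H := smash_coproduct K to.
Implicit Types (g h : gT) (x y z : lT).

Local Notation cm x F := (l2 (comul H x) F).
Local Notation ml x y F := (l1 (amul H x y) F).
Local Notation an x F := (l1 (antipode H x) F).
Local Notation one F := (l1 (aone H) F).

Section Forms.
Variable V : lmodType K.
Implicit Type F : gT * lT -> V.

Lemma smash_mul u v F : ml u v F = (u.2 == v.2)%:R *: F ((u.1 * v.1)%g, u.2).
Proof.
rewrite /l1 (bigD1 ((u.1 * v.1)%g, u.2)) //= eqxx andbT big1 ?addr0 // => w /negbTE wn.
by rewrite wn andbF scale0r.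
Qed.

Lemma smash_comul u (F : gT * lT -> gT * lT -> V) :
  cm u F = \sum_y F (u.1, y) (lact to y^-1 u.1, (y^-1 * u.2)%g).
Proof.
transitivity (\sum_a \sum_b \sum_y ((a == (u.1, y)) && (b == (lact to y^-1 u.1, (y^-1 * u.2)%g)))%:R *: F a b).
  by apply: eq_bigr => a _; apply: eq_bigr => b _; rewrite scaler_suml.
under eq_bigr do rewrite exchange_big; rewrite exchange_big; apply: eq_bigr => y _ /=.
rewrite (bigD1 (u.1, y)) //= [X in _ + X]big1 ?addr0 => [|a /negbTE an]; last first.
  by rewrite big1 // => b _; rewrite an scale0r.
rewrite (bigD1 (lact to y^-1 u.1, (y^-1 * u.2)%g)) //= !eqxx scale1r big1 ?addr0 // => b /negbTE bn.
by rewrite bn scale0r.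
Qed.

Lemma smash_one F : one F = \sum_x F (1%g, x).
Proof.
rewrite /l1 [LHS](eq_bigr (fun u => (u.1 == 1%g)%:R *: F (u.1, u.2))) => [|[] //].
rewrite -(pair_bigA _ (fun g x => (g == 1%g)%:R *: F (g, x))) /= (bigD1 1%g) //= [X in _ + X]big1 ?addr0.
  by apply: eq_bigr => x _; rewrite eqxx scale1r.
by move=> g /negbTE gn; rewrite big1 // => x _; rewrite gn scale0r.
Qed.

Lemma smash_antipode u F : an u F = F (lact to u.2^-1 (u.1^-1)%g, (u.2^-1)%g).
Proof.
rewrite /l1 (bigD1 (lact to u.2^-1 (u.1^-1)%g, (u.2^-1)%g)) //= eqxx scale1r big1 ?addr0 // => w /negbTE wn.
by rewrite wn scale0r.
Qed.

End Forms.

Lemma smash_hopf : is_hopf H.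
Proof.
apply: hopf_of_forms.
- move=> [g x] [h y] [k z] F; rewrite !smash_mul /= !scalerA -mulgA.
  rewrite -!natrM !mulnb; by case: (x =P y) => [->|_]; rewrite ?andbF ?andbT ?scale0r.
- move=> [g x] F; rewrite smash_one; under eq_bigr do rewrite smash_mul /=.
  by rewrite (sum_delta x (fun y => F ((1 * g)%g, y))) mul1g.
- move=> [g x] F; rewrite smash_one; under eq_bigr do rewrite smash_mul /= eq_sym.
  by rewrite (sum_delta x (fun y => F ((g * 1)%g, x))) mulg1.
- move=> [g x] F; rewrite !smash_comul; under eq_bigr do rewrite smash_comul.
  under [RHS]eq_bigr do rewrite smash_comul /=.
  rewrite exchange_big; apply: eq_bigr => z _.
  rewrite (reindex_inj (mulgI z)); apply: eq_bigr => y _ /=.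
  by rewrite mulKg invMg lactM mulgA.
- move=> [g x] F; rewrite smash_comul /=.
  by rewrite (sum_delta 1%g (fun y => F (lact to y^-1 g, (y^-1 * x)%g))) invg1 lact1 mul1g.
- move=> [g x] F; rewrite smash_comul /=.
  under eq_bigr => y _ do rewrite -eq_mulVg1.
  by rewrite (sum_delta x (fun y => F (g, y))).
- move=> [g x] [h y] F; rewrite smash_mul !smash_comul scaler_sumr.
  apply: eq_bigr => z _; rewrite smash_comul.
  under eq_bigr => w _ do rewrite !smash_mul /= eq_sym.
  rewrite (sum_delta z (fun w => ((z^-1 * x)%g == (w^-1 * y)%g)%:R *: F ((g * h)%g, z)
    ((lact to z^-1 g * lact to w^-1 h)%g, (z^-1 * x)%g))).
  by rewrite (can_eq (mulKg _)) lact_mul.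
- move=> F; rewrite !smash_one; under eq_bigr do rewrite smash_comul.
  rewrite exchange_big; apply: eq_bigr => y _; rewrite smash_one.
  rewrite (reindex_inj (mulgI y)); apply: eq_bigr => x _.
  by rewrite mulKg lact_1.
- move=> [g x] [h y]; rewrite smash_mul /= /GRing.scale /= -!natrM !mulnb.
  suff -> : (x == y) && (x == 1%g) = (x == 1%g) && (y == 1%g) by [].
  by apply/andP/andP => -[/eqP-> /eqP->]; rewrite !eqxx.
- rewrite smash_one; rewrite -[RHS](sum_delta (1%g : lT) (fun=> 1 : K^o)).
  by apply: eq_bigr => x _; rewrite /GRing.scale /= mulr1.
- move=> [g x] F; rewrite smash_comul smash_one scaler_sumr.
  rewrite (reindex_inj invg_inj); apply: eq_bigr => y _.
  rewrite smash_antipode smash_mul /= !invgK.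
  rewrite -lact_mul mulVg lact_1 eq_sym.
  by rewrite -{2}(mulg1 y) (inj_eq (mulgI y)).
move=> [g x] F; rewrite smash_comul smash_one scaler_sumr.
apply: eq_bigr => y _; rewrite smash_antipode smash_mul /= invMg invgK.
rewrite -{1}(mul1g y) (inj_eq (mulIg y)) eq_sym eq_invg1.
case: eqP => [->|_]; last by rewrite !scale0r.
by rewrite invg1 mul1g -lact_inv -lactM mulgV lact1 mulgV.
Qed.

(** The antipode permutes the basis and is an involution. *)
Lemma smash_antipode_unit :
  (\matrix_(a < #|{: gT * lT}|, b < #|{: gT * lT}|) antipode H (enum_val a) (enum_val b)) \in unitmx.
Proof.
suff: mxI (antipode H) *m mxI (antipode H) = 1%:M by case/mulmx1_unit.
rewrite mxI_mul -mxI1; apply: eq_mxI => u v.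
rewrite (smash_antipode u (fun w => antipode H w v : K^o)) /=.
rewrite !invgK -lact_inv -lactM mulgV lact1 invgK eq_sym.
by case: u.
Qed.

Let av_smash (V : lmodType K) u (F : gT * lT -> V) :
  l1 (antipodeV H u) F = F (lact to u.2^-1 (u.1^-1)%g, (u.2^-1)%g).
Proof.
rewrite -[RHS](antipodeK smash_antipode_unit) smash_antipode /=.
by rewrite !invgK -lact_inv -lactM mulgV lact1 invgK -surjective_pairing.
Qed.

Hypothesis lT_neq0 : #|lT|%:R != 0 :> K.
(** The unit is the sum of the 1 (x) p_x over x in L, so 1/|L| normalises lam(1) = 1; here |L| must
    be nonzero in K. *)
Let lam (u : gT * lT) : K := (u.1 == 1%g)%:R / #|lT|%:R.

(** Invariance under H^* holds since x.g = 1 only for g = 1; invariance under H comes down to a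
    conjugate of h being 1 only for h = 1. *)
Lemma smash_unit_retract : retract (triv_rep (double H) 1) (ind H (triv_rep H 1)).
Proof.
apply: (unit_retract_ind smash_hopf smash_antipode_unit (lam := lam)).
- rewrite smash_one /lam /=; under eq_bigr do rewrite eqxx mul1r.
  by rewrite sumr_const -[LHS]mulr_natl; exact: mulfV.
- move=> V [g x] F; rewrite smash_comul smash_one scaler_sumr; apply: eq_bigr => y _.
  by rewrite /lam /= lact_eq1; case: eqP => [->//|_]; rewrite mul0r !scale0r.
move=> [g x] [h y]; rewrite smash_comul.
transitivity (\sum_z (z == y)%:R *: ((x == 1%g)%:R * lam (h, y) : K^o)); last by rewrite sum_delta.
apply: eq_bigr => z _; rewrite /double_coef av_smash smash_mul smash_mul /=.
rewrite invMg invgK /lam /=.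
have -> : ((x^-1 * z)%g == z) = (x == 1%g).
  by rewrite -{2}(mul1g z) (inj_eq (mulIg z)) eq_invg1.
case: (x =P 1%g) => [->|_]; last by rewrite scale0r mul0r !scaler0.
rewrite invg1 mul1g scale1r mul1r -lact_inv -lactM mulgV lact1.
by rewrite -mulgA -conjgE conjg_eq1.
Qed.

End SmashHopf.

(** * Block-diagonal matrices *)

Lemma bcolZ (K : fieldType) (I : finType) m n (c : K) (A : I -> 'M[K]_(m, n)) :
  c *: bcol A = bcol (fun i => c *: A i).
Proof. by apply/matrixP => i j; rewrite !mxE. Qed.

Lemma browZ (K : fieldType) (I : finType) m n (c : K) (A : I -> 'M[K]_(m, n)) :
  c *: brow A = brow (fun i => c *: A i).
Proof. by apply/matrixP => i j; rewrite !mxE. Qed.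

Section BlockDiagonal.
Variables (K : fieldType) (I : finType) (n : nat).
Implicit Type B : I -> 'M[K]_n.

Definition bdiag B : 'M[K]_(#|I| * n) := bcol (fun y => brow (fun j => (y == j)%:R *: B y)).

Lemma bdiagE B : bdiag B = bcol (fun y => B y *m bpr K n y).
Proof.
apply: eq_bcol => y; rewrite mul_brow; apply: eq_brow => j.
by rewrite -scalemxAr mulmx1.
Qed.

Lemma eq_bdiag B C : B =1 C -> bdiag B = bdiag C.
Proof. by move=> BC; apply: eq_bcol => y; rewrite BC. Qed.

Lemma bdiag_bcol m B (A : I -> 'M[K]_(n, m)) : bdiag B *m bcol A = bcol (fun y => B y *m A y).
Proof. by rewrite bdiagE bcol_mul; apply: eq_bcol => y; rewrite -mulmxA bpr_bcol. Qed.

Lemma bdiagM B C : bdiag B *m bdiag C = bdiag (fun y => B y *m C y).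
Proof. by rewrite [bdiag C]bdiagE bdiag_bcol bdiagE; apply: eq_bcol => y; rewrite mulmxA. Qed.

Lemma bdiag1 : bdiag (fun=> 1%:M) = 1%:M.
Proof. by rewrite -tensmx11 -(mxI1 K I) tens_bcol_brow. Qed.

Lemma bdiag_bin B y : bdiag B *m bin K n y = bin K n y *m B y.
Proof.
rewrite bdiag_bcol bcol_mul; apply: eq_bcol => j; rewrite -scalemxAr -scalemxAl mulmx1 mul1mx.
by case: eqP => [->//|_]; rewrite !scale0r.
Qed.

Lemma bpr_bdiag B y : bpr K n y *m bdiag B = B y *m bpr K n y.
Proof. by rewrite bdiagE bpr_bcol. Qed.

End BlockDiagonal.

Lemma brow_bdiag (K : fieldType) (I : finType) m n (X : I -> 'M[K]_(m, n)) (B : I -> 'M[K]_n) :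
  brow X *m bdiag B = brow (fun y => X y *m B y).
Proof.
by rewrite bdiagE brow_bcol [RHS]browE; apply: eq_bigr => y _; rewrite mulmxA.
Qed.

Lemma bpr_bin (K : fieldType) (I : finType) n (y : I) : bpr K n y *m bin K n y = 1%:M.
Proof. by rewrite bpr_bcol eqxx scale1r. Qed.

(** * Detection of thick ideals over a smash coproduct *)

Section SmashDetect.
Variables (K : fieldType) (gT lT : finGroupType).
Variable to : groupAction [set: lT] [set: gT].
Let H := smash_coproduct K to.

(* The sum over z in L of the characters (g, x) |-> [x = z]. *)
Definition smash_char : rep K (gT * lT)%type :=
  Rep (fun u => mxI (fun y z => ((y == u.2) && (z == u.2))%:R)).

Lemma smash_char_module : is_module H smash_char.
Proof.
split=> [u v|].
  rewrite -[RHS]/(l1 (amul H u v) (ract smash_char)) smash_mul /= mxI_mul.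
  apply/matrixP => i j; rewrite !mxE /l1 (bigD1 u.2) //= big1 => [|z /negbTE zx].
    rewrite eqxx andbT addr0 /GRing.scale /= -!natrM !mulnb.
    by congr (nat_of_bool _)%:R; case: (u.2 =P v.2) => [->|] //=; rewrite !andbF.
  by rewrite zx andbF scale0r.
rewrite -[LHS]/(l1 (aone H) (ract smash_char)) smash_one -mxI1.
apply/matrixP => i j; rewrite summxE !mxE (bigD1 (enum_val i)) //= big1 ?addr0.
  by rewrite mxE /= eqxx eq_sym.
by move=> x; rewrite mxE /= eq_sym => /negbTE ->.
Qed.

Let sum_diag_delta (f : lT -> K) (a b : lT) :
  \sum_y ((a == y) && (b == y))%:R * f y = (a == b)%:R * f a.
Proof.
rewrite (bigD1 a) //= eqxx eq_sym big1 ?addr0 // => y; rewrite eq_sym => /negbTE ->.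
by rewrite mul0r.
Qed.

Lemma tens_smash_char_l N : tens H smash_char N =
  Rep (fun u => bdiag (fun y => ract N (lact to y^-1 u.1, (y^-1 * u.2)%g))).
Proof.
congr Rep; apply/funext => u; rewrite -[LHS]/(l2 _ _) smash_comul.
apply/matrixP => p q; rewrite summxE !mxE.
under eq_bigr => y _ do rewrite /= tens_bcol_brow !mxE.
by rewrite (sum_diag_delta (fun y => ract N (lact to y^-1 u.1, (y^-1 * u.2)%g) _ _)).
Qed.

Lemma tens_smash_char_r N : iso (tens H N smash_char)
  (Rep (fun u => bdiag (fun y => ract N (u.1, (u.2 * y^-1)%g)))).
Proof.
exists (flip_mx K _ _), (flip_mx K _ _); split; rewrite ?flip_mxK // => u.
rewrite -[ract (tens _ _ _) _]/(l2 _ _) l2_mulmxr.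
under eq_l2 => j k do rewrite flip_tens.
rewrite -l2_mulmxl; congr (_ *m _) => /=; rewrite smash_comul.
(* Replacing y by x y^-1 makes y itself the L-component of the second leg. *)
apply/matrixP => p q; rewrite summxE !mxE (reindex_inj (mulgI u.2)) (reindex_inj invg_inj).
under eq_bigr => y _ do rewrite tens_bcol_brow !mxE /= invMg invgK mulgKV.
by rewrite (sum_diag_delta (fun y => ract N (u.1, (u.2 * y^-1)%g) _ _)).
Qed.

Variable M : rep K (gT * lT)%type.
Hypothesis mM : is_module H M.
Let n := rdim M.
(** A module is an L-graded representation of G: [A] is the action of G and the [p x] are the
    projections onto the homogeneous components. *)
Let A g : 'M[K]_n := \sum_y ract M (g, y).
Let p x : 'M[K]_n := ract M (1%g, x).

Let ractM u v : ract M u *m ract M v = (u.2 == v.2)%:R *: ract M ((u.1 * v.1)%g, u.2).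
Proof. by rewrite mM.1 -[LHS]/(l1 (amul H u v) (ract M)) smash_mul. Qed.

Let psum : \sum_x p x = 1%:M.
Proof. by rewrite -mM.2 -[RHS]/(l1 (aone H) (ract M)) smash_one. Qed.

Let ApM g x : A g *m p x = ract M (g, x).
Proof.
rewrite mulmx_suml; under eq_bigr => y _ do rewrite ractM /= mulg1.
exact: (sum_delta _ (fun y => ract M (g, y))).
Qed.

Let pAM g x : p x *m A g = ract M (g, x).
Proof.
rewrite mulmx_sumr; under eq_bigr => y _ do rewrite ractM /= mul1g eq_sym.
exact: (sum_delta _ (fun y => ract M (g, x))).
Qed.

Let AM g h : A g *m A h = A (g * h)%g.
Proof.
rewrite {1}/A mulmx_suml; apply: eq_bigr => y _.
rewrite mulmx_sumr; under eq_bigr => z _ do rewrite ractM /= eq_sym.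
exact: (sum_delta _ (fun z => ract M ((g * h)%g, y))).
Qed.

Let A1 : A 1%g = 1%:M. Proof. exact: psum. Qed.

Let rho (u : gT * lT) : 'M[K]_(#|lT| * n) :=
  (u.2 == 1%g)%:R *: bdiag (fun y => A (lact to y^-1 u.1)).
Let trans (w : lT) : 'M[K]_(#|lT| * n) := bcol (fun y => bpr K n (w^-1 * y)%g).
Let phi (u : gT * lT) : 'M[K]_(#|lT| * n) := (u.1 == 1%g)%:R *: trans u.2.

Let transM w z : trans w *m trans z = trans (w * z)%g.
Proof.
rewrite bcol_mul; apply: eq_bcol => y.
by rewrite bpr_bcol invMg mulgA.
Qed.

Let trans1 : trans 1%g = 1%:M.
Proof.
by rewrite -bdiag1 bdiagE; apply: eq_bcol => y; rewrite invg1 mul1g mul1mx.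
Qed.

(* On k[L] (x) M, (g, x) acts by y (x) m |-> [x = 1] y (x) (y^-1.g) m, and L    *)
(* by left translation of k[L]. With C = [smash_char], the restriction Z of    *)
(* this module is a summand of C (x) M (x) C, and M one of Z (x) C.            *)
Lemma smash_detect : exists2 X, is_module (double H) X &
  forall J, thick_ideal H J -> J (res H X) <-> J M.
Proof.
have phiE m (c : gT * lT -> K) (G : lT -> 'M[K]_m) :
    l1 c (fun v => (v.1 == 1%g)%:R *: G v.2) = \sum_w c (1%g, w) *: G w.
  rewrite -(smash_one to (fun v => c v *: G v.2)).
  by apply: eq_bigr => v _; rewrite !scalerA mulrC.
have m_phi : is_module (dual_algebra H) (Rep phi).
  split=> [a b|].
    have c1 x : comul H (1%g, x) a b = (x == (a.2 * b.2)%g)%:R * ((a.1 == 1%g)%:R * (b.1 == 1%g)%:R).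
      rewrite /= (bigD1 a.2) //= big1 ?addr0 => [|y /negbTE ya]; last first.
        by case: eqP => // E; rewrite E eqxx in ya.
      rewrite lact_1 -!natrM !mulnb; congr (nat_of_bool _)%:R.
      case: a b => [a1 a2] [b1 b2] /=; rewrite !xpair_eqE eqxx andbT.
      rewrite -(inj_eq (mulgI a2)) mulKVg [_ == x]eq_sym.
      by rewrite andbA andbC.
    rewrite -[RHS]/(l1 (fun k => comul H k a b) phi) phiE.
    under [RHS]eq_bigr => x _ do rewrite c1 -scalerA.
    by rewrite sum_delta /= /phi -scalemxAl -scalemxAr transM scalerA.
  rewrite -[LHS]/(l1 (counit H) phi) phiE sum_delta; exact: trans1.
have m_rho : is_module H (Rep rho).
  split=> [u v|].
    rewrite -[RHS]/(l1 (amul H u v) rho) smash_mul /= /rho -scalemxAl -scalemxAr bdiagM !scalerA /=.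
    case: (u.2 =P v.2) => [<-|uv]; last first.
      rewrite mul0r scale0r; case: eqP => [u1|_]; last by rewrite mul0r scale0r.
      by case: eqP => [v1|_]; [case: uv; rewrite u1 v1|rewrite mulr0 scale0r].
    case: eqP => [_|_]; last by rewrite !mulr0 !scale0r.
    rewrite !mulr1; congr (_ *: _); apply: eq_bdiag => y.
    by rewrite AM lact_mul.
  rewrite -[LHS]/(l1 (aone H) rho) smash_one /rho /=.
  rewrite sum_delta -bdiag1; apply: eq_bdiag => y.
  by rewrite lact_1 A1.
exists (drep rho phi).
  apply: (drep_module (smash_hopf K to) (smash_antipode_unit K to) m_rho m_phi) => -[g x] F.
  rewrite !smash_comul.
  (* Both sides of the Yetter-Drinfeld condition reduce to this term, since [rho] vanishes unless x
     = 1 and [phi] unless g = 1. *)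
  transitivity (F (g, x) *: (bdiag (fun y => A (lact to y^-1 g)) *m trans x)).
    transitivity (\sum_y (y == 1%g)%:R *: (F (lact to y^-1 g, (y^-1 * x)%g) *:
        (bdiag (fun z => A (lact to z^-1 g)) *m trans (y^-1 * x)%g))); last first.
      by rewrite sum_delta invg1 lact1 mul1g.
    apply: eq_bigr => y _; rewrite /phi.
    under eq_l1 => v do rewrite -scalemxAr.
    etransitivity; first exact: (phiE _ _ (fun w => rho (g, y) *m trans w)).
    under eq_bigr => w _ do rewrite smash_mul /= mulg1 eq_sym -scalerA.
    by rewrite sum_delta /rho /= -scalemxAl !scalerA mulrC.
  transitivity (\sum_y (y == x)%:R *: (F (g, y) *:
      (trans y *m bdiag (fun z => A (lact to z^-1 (lact to y^-1 g)))))).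
    rewrite sum_delta; congr (_ *: _); rewrite bdiag_bcol bcol_mul; apply: eq_bcol => y.
    by rewrite bpr_bdiag -lactM invMg invgK mulgK.
  apply: eq_bigr => y _; rewrite /phi; apply/esym.
  under eq_l1 => v do rewrite -scalemxAl.
  etransitivity; first exact: (phiE _ _ (fun w => trans w *m rho (lact to y^-1 g, (y^-1 * x)%g))).
  under eq_bigr => w _ do rewrite smash_mul /= mul1g -scalerA.
  by rewrite sum_delta /rho /= -scalemxAr !scalerA mulrC -eq_mulVg1.
rewrite res_drep // => J tJ; split=> JM.
  apply: (thick_ideal_retract tJ mM _ (thick_tens tJ JM smash_char_module).1).
  apply: (retract_trans (N := Rep (fun u => bdiag (fun y => rho (u.1, (u.2 * y^-1)%g))))); last first.
    exact/iso_retract/iso_sym/tens_smash_char_r.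
  (* Block w of Z (x) C has degree w, and the copy of M at 1 in k[L] carries the untwisted action of
     G. So the component of degree w of M goes to block w, at position 1. *)
  exists (bcol (fun w => bin K n 1%g *m p w)), (brow (fun w => p w *m bpr K n 1%g)).
  split=> [[g x]|[g x]|].
  - rewrite bcol_mul bdiag_bcol; apply: eq_bcol => w.
    rewrite /rho /= -scalemxAl mulmxA bdiag_bin invg1 lact1 -!mulmxA ApM ractM /= mul1g.
    by rewrite -eq_mulgV1 eq_sym scalemxAr.
  - rewrite brow_bdiag mul_brow; apply: eq_brow => w.
    rewrite /rho /= -scalemxAr -mulmxA bpr_bdiag invg1 lact1 !mulmxA pAM ractM /= mulg1.
    rewrite -eq_mulgV1 -scalemxAl.
    by case: eqP => [->//|_]; rewrite !scale0r.
  rewrite brow_bcol -psum; apply: eq_bigr => w _.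
  by rewrite mulmxA -(mulmxA (p w)) bpr_bin mulmx1 ractM eqxx scale1r mulg1.
pose N := Rep (fun u : gT * lT => bdiag (fun y => ract M (u.1, (u.2 * y^-1)%g))).
apply: (thick_ideal_retract tJ m_rho _
  (thick_tens tJ (thick_tens tJ JM smash_char_module).1 smash_char_module).2).
apply: (retract_trans (N := tens H smash_char N)); last first.
  apply/iso_retract/iso_sym/tens_iso; [exact: iso_refl|exact: tens_smash_char_r].
rewrite tens_smash_char_l.
(* Block (u, w) of C (x) M (x) C shifts the degree d of M to u d w. As Z has degree 1, only d = u^-1
   w^-1 occurs. *)
exists (bcol (fun u => bcol (fun w => p (u^-1 * w^-1)%g *m bpr K n u))).
exists (bcol (fun y => brow (fun w => p (y^-1 * w^-1)%g) *m bpr K (#|lT| * n) y)).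
split=> [[g x]|[g x]|].
- rewrite bcol_mul bdiag_bcol; apply: eq_bcol => u; rewrite bcol_mul bdiag_bcol; apply: eq_bcol => w.
  rewrite /rho /= -scalemxAr -mulmxA bpr_bdiag !mulmxA pAM ractM /= mulg1 -scalemxAl.
  rewrite (inj_eq (mulIg _)) -{4}(mulg1 u^-1%g) (inj_eq (mulgI _)).
  by case: eqP => [->|_]; rewrite ?mulg1 ?scale0r.
- rewrite bcol_mul /rho /= -scalemxAl bdiag_bcol bcolZ; apply: eq_bcol => y.
  rewrite -mulmxA bpr_bdiag !mulmxA [RHS]scalemxAl; congr (_ *m _).
  rewrite brow_bdiag mul_brow browZ; apply: eq_brow => w.
  by rewrite ractM ApM /= mul1g (inj_eq (mulIg _)) -{1}(mulg1 y^-1%g) (inj_eq (mulgI _)) eq_sym.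

rewrite bcol_mul -bdiag1 bdiagE; apply: eq_bcol => y.
rewrite -mulmxA bpr_bcol brow_bcol mul1mx -[RHS]mul1mx -psum mulmx_suml.
rewrite [RHS](reindex_inj (mulgI y^-1%g)) [RHS](reindex_inj invg_inj); apply: eq_bigr => w _.
by rewrite mulmxA ractM eqxx scale1r mulg1.
Qed.

End SmashDetect.

Lemma smash_spectrum (K : fieldType) (gT lT : finGroupType)
    (to : groupAction [set: lT] [set: gT]) : #|lT|%:R != 0 :> K ->
  res_homeomorphism (smash_coproduct K to) /\ thick_ideals_bijection (smash_coproduct K to).
Proof.
move=> lT_neq0.
apply: (spectrum_transfer (smash_hopf K to) (smash_antipode_unit K to)).
  exact: smash_unit_retract.
exact: smash_detect.
Qed.

Theorem theoremD (K : closedFieldType) :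
  (forall (I : finType) (H : hopf K I),
     is_hopf H -> cosemisimple H -> quasitriangular H ->
     res_homeomorphism H /\ thick_ideals_bijection H) /\
  (forall (gT lT : finGroupType) (to : groupAction [set: lT] [set: gT])
          (p : nat),
     p \in [pchar K] -> (p %| #|gT|)%N -> ~~ (p %| #|lT|)%N ->
     res_homeomorphism (smash_coproduct K to) /\
     thick_ideals_bijection (smash_coproduct K to)).
Proof.
split=> [I H|gT lT to p pK _ p_ndvd]; first exact: quasitriangular_spectrum.
by apply: smash_spectrum; rewrite -(dvdn_pcharf pK).
Qed.
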